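(* There exist a two-dimensional Riemannian manifold $M$ and a Bowen homeomorphism $f$ of $M$, with associated saddles $x_1,x_2$ and associated open set $V$, such that $$\mathcal O_{f|\overline V}=\{\delta_{x_2}\}.$$
   Context: A Bowen homeomorphism is a homeomorphism $f$ of a two-dimensional manifold $M$ which is non-singular (i.e. $m(f^{-1}(B))=0$ if and only if $m(B)=0$, where $m$ is the Lebesgue measure) and satisfies: (i) $f$ has three fixed points $x_1,x_2,x_3$. (ii) Restricted to the union of three small compact pairwise disjoint neighbourhoods $U_1,U_2,U_3$ of $x_1,x_2,x_3$ respectively, $f$ is a diffeomorphism onto $f(U_1\cup U_2\cup U_3)$; the fixed points $x_1,x_2$ are hyperbolic saddles and $x_3$ is a hyperbolic source. (iii) $W^s_1\setminus\{x_1\}=W^u_2\setminus\{x_2\}$ and $W^u_1\setminus\{x_1\}=W^s_2\setminus\{x_2\}$, where $W^{s}_{i},W^{u}_{i}$ denote half-branches of the global one-dimensional stable and unstable manifolds of $x_i$, $i=1,2$. They are embedded topological arcs, of $C^1$ type in a neighbourhood of the saddles. Thus $W^s_1\cup W^s_2$ is a compact, simple, closed arc, which is the boundary of an open set $V$ homeomorphic to a 2-ball. (iv) $x_3\in V$, and every orbit in $V\setminus\{x_3\}$ includes $x_1$ and $x_2$ in its $\omega$-limit set and has $\{x_3\}$ as $\alpha$-limit set. For $x\in M$, let $\nu_n(x)=\frac1n\sum_{j=0}^{n-1}\delta_{f^j(x)}$ and let $\mathcal L^*(x)$ be the set of all weak$^*$-limits of convergent subsequences of $\{\nu_n(x)\}_{n\ge1}$.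 Fix a metric $\mathrm{dist}^*$ inducing the weak$^*$ topology on Borel probability measures. For a forward invariant set $B$ ($B\subset f^{-1}(B)$) of positive Lebesgue measure, $\mathcal O_{f|B}$ denotes the set of all SRB-like measures for $f|_B$: probability measures $\mu$ such that for all $\epsilon>0$ the set $\{x\in B:\ \mathrm{dist}^*(\mathcal L^*(x),\mu)<\epsilon\}$ has positive Lebesgue measure. Here $\mathrm{dist}^*(\mathcal L^*(x),\mu)$ is the distance from $\mu$ to the set $\mathcal L^*(x)$. *)

(* Defs.v *)
From HB Require Import structures.
From mathcomp Require Import all_boot all_order all_algebra.
From mathcomp Require Import interval_inference.
From mathcomp Require Import all_classical all_reals all_analysis.
From mathcomp Require Import giry.
From mathcomp.real_closed Require Import complex.

Set Implicit Arguments.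
Unset Strict Implicit.
Unset Printing Implicit Defensive.

Import Order.TTheory GRing.Theory Num.Theory.
Import numFieldNormedType.Exports.

Local Open Scope classical_set_scope.
Local Open Scope ring_scope.

Notation plane R := (R * R)%type.

Section Plane.
Context {R : realType}.

(* [D] is meant to be open. *)
Fixpoint Ck (k : nat) {E F : normedModType R} (D : set E) (h : E -> F) : Prop :=
  match k with
  | 0%N => forall p, D p -> {for p, continuous h}
  | j.+1 => (forall p, D p -> differentiable h p) /\
            (forall v : E, Ck j D ('D_v h))
  end.

Definition smooth {E F : normedModType R} (D : set E) (h : E -> F) : Prop :=
  forall k, Ck k D h.

Definition plane_basis (i : 'I_2) : plane R := ((i == 0)%:R, (i == 1)%:R).

Definition plane_coord (p : plane R) (j : 'I_2) : R :=
  if j == 0 then p.1 else p.2.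

(* Row [i] is the image of the i-th basis vector. *)
Definition plane_mx (T : plane R -> plane R) : 'M[R]_2 :=
  \matrix_(i, j) plane_coord (T (plane_basis i)) j.

Definition spectrum (T : plane R -> plane R) : set R[i] :=
  [set z | eigenvalue (map_mx (real_complex R) (plane_mx T)) z].

Definition hyperbolic (T : plane R -> plane R) : Prop :=
  forall z, spectrum T z -> `|z| != 1.

Definition saddle (T : plane R -> plane R) : Prop :=
  [/\ hyperbolic T,
      exists2 z, spectrum T z & `|z| < 1
    & exists2 z, spectrum T z & 1 < `|z|].

Definition source (T : plane R -> plane R) : Prop :=
  forall z, spectrum T z -> 1 < `|z|.

(* The balls of the norm of [R * R] are squares. *)
Definition open_disc : set (plane R) := [set p | p.1 ^+ 2 + p.2 ^+ 2 < 1].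

End Plane.

Record chart (R : realType) (M : topologicalType) := Chart {
  chart_dom : set M;
  chart_map :> M -> plane R;
  chart_inv : plane R -> M;
  chart_dom_open : open chart_dom;
  chart_im_open : open (chart_map @` chart_dom);
  chart_mapK : forall x, chart_dom x -> chart_inv (chart_map x) = x;
  chart_map_continuous : {within chart_dom, continuous chart_map};
  chart_inv_continuous :
    {within chart_map @` chart_dom, continuous chart_inv} }.

Section Charts.
Context {R : realType} {M : topologicalType}.
Implicit Types c d : chart R M.

Definition chart_im c : set (plane R) := c @` chart_dom c.

Definition overlap c d : set (plane R) := c @` (chart_dom c `&` chart_dom d).

Definition transition c d : plane R -> plane R := d \o chart_inv c.

End Charts.

(* A smooth two-dimensional manifold, given by a (not necessarily maximal)
   atlas, with a smooth Riemannian metric: [metric c p u v] is the inner product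
   of the tangent vectors with coordinates [u] and [v] in the chart [c], at the
   point with coordinates [p]. It is constrained for charts of the atlas only.
   The space is pointed because [g_sigma_algebraType] asks for it; this only
   excludes the empty surface. *)
Record riemannianSurface (R : realType) := RiemannianSurface {
  surface_space :> ptopologicalType;
  surface_hausdorff : hausdorff_space surface_space;
  surface_second_countable : @second_countable surface_space;
  atlas : set (chart R surface_space);
  atlas_cover : forall x, exists2 c, atlas c & chart_dom c x;
  atlas_smooth : forall c d, atlas c -> atlas d ->
    smooth (overlap c d) (transition c d);
  metric : chart R surface_space -> plane R -> plane R -> plane R -> R;
  metric_linear : forall c p, atlas c -> chart_im c p ->
    forall (a : R) (u u' v : plane R),
      metric c p (a *: u + u') v = a * metric c p u v + metric c p u' v;
  metric_sym : forall c p, atlas c -> chart_im c p ->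
    forall u v, metric c p u v = metric c p v u;
  metric_pos : forall c p, atlas c -> chart_im c p ->
    forall u, u != 0 -> 0 < metric c p u u;
  metric_smooth : forall c, atlas c ->
    forall u v, smooth (chart_im c) (fun p => metric c p u v : R^o);
  metric_compat : forall c d p, atlas c -> atlas d -> overlap c d p ->
    forall u v, metric c p u v =
      metric d (transition c d p)
        ('d (transition c d) p u) ('d (transition c d) p v) }.

Definition borel (M : ptopologicalType) := g_sigma_algebraType (@open M).

Section Volume.
Context {R : realType} (M : riemannianSurface R).

Definition area_density (c : chart R M) (p : plane R) : R :=
  Num.sqrt (\det (\matrix_(i < 2, j < 2)
    metric c p (plane_basis i) (plane_basis j))).

(* The Lebesgue measure of M is the Riemannian volume, dm = sqrt(det g) dx dy
   in every chart. *)
Definition is_volume (m : {measure set (borel M) -> \bar R}) : Prop :=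
  forall (c : chart R M) (A : set (borel M)),
    atlas c -> measurable A -> A `<=` chart_dom c ->
    m A = (\int[(@lebesgue_measure R \x @lebesgue_measure R)%E]_(p in c @` A)
             (area_density c p)%:E)%E.

End Volume.

Section Dynamics.
Context {R : realType} (M : riemannianSurface R).

Definition homeomorphism (f finv : M -> M) : Prop :=
  [/\ continuous f, continuous finv, cancel f finv & cancel finv f].

Definition nonsingular (m : {measure set (borel M) -> \bar R}) (f : M -> M) :=
  forall B : set (borel M), measurable B -> m (f @^-1` B) = 0%E <-> m B = 0%E.

Definition local_rep (c d : chart R M) (f : M -> M) : plane R -> plane R :=
  d \o f \o chart_inv c.

Definition C1_map (O : set M) (f : M -> M) : Prop :=
  forall c d : chart R M, atlas c -> atlas d ->
    Ck 1 (c @` (O `&` chart_dom c `&` f @^-1` chart_dom d)) (local_rep c d f).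

(* A diffeomorphism of class C^1 from (an open neighbourhood of) K onto its
   image. *)
Definition diffeo_on (K : set M) (f finv : M -> M) : Prop :=
  exists O : set M, [/\ open O, K `<=` O, C1_map O f & C1_map (f @` O) finv].

(* For fixed points of f; the differential depends on the chart only up to
   conjugation. *)
Definition saddle_at (f : M -> M) (x : M) : Prop :=
  forall c : chart R M, atlas c -> chart_dom c x ->
    saddle ('d (local_rep c c f) (c x)).

Definition source_at (f : M -> M) (x : M) : Prop :=
  forall c : chart R M, atlas c -> chart_dom c x ->
    source ('d (local_rep c c f) (c x)).

(* The unstable set for f is the stable set for the inverse of f, and the
   alpha-limit set for f is the omega-limit set for the inverse of f. *)
Definition stable_set (f : M -> M) (x : M) : set M :=
  [set y | iter n f y @[n --> \oo] --> x].

Definition omega_limit (f : M -> M) (y : M) : set M :=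
  cluster (iter n f y @[n --> \oo]).

Definition C1_immersed_at0 (gamma : R -> M) : Prop :=
  forall c : chart R M, atlas c -> chart_dom c (gamma 0) ->
    exists2 e : R, 0 < e &
      Ck 1 (`]- e, e[%classic : set R^o) (c \o gamma : R^o -> plane R) /\
      (forall t, `]- e, e[%classic t -> 'D_(1 : R^o) (c \o gamma) t != 0).

(* [W], a stable or unstable set of [x], is an injectively immersed line through
   [x], and [H] is one of its two halves, endpoint [x] included; this half is a
   topologically embedded arc, of class C^1 near [x]. Reversing [gamma] gives
   the other half. *)
Definition half_branch (W : set M) (x : M) (H : set M) : Prop :=
  exists gamma : R -> M,
    [/\ [/\ continuous gamma, injective gamma & gamma 0 = x],
        range gamma = W,
        C1_immersed_at0 gamma,
        H = gamma @` `[0, +oo[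
      & exists2 g : M -> R, {within H, continuous g} &
          forall t, 0 <= t -> g (gamma t) = t].

Definition simple_closed_curve (C : set M) : Prop :=
  exists gamma : R -> M,
    [/\ {within `[0, 1], continuous gamma}, gamma 0 = gamma 1,
        {in `[0, 1[ &, injective gamma} & C = gamma @` `[0, 1]].

Definition homeomorphic_to_disc (V : set M) : Prop :=
  exists (a : M -> plane R) (b : plane R -> M),
    [/\ {within V, continuous a}, {within open_disc, continuous b},
        forall x, V x -> open_disc (a x) /\ b (a x) = x
      & forall p, open_disc p -> V (b p) /\ a (b p) = p].

Record bowen_data (m : {measure set (borel M) -> \bar R}) (f finv : M -> M)
    (x1 x2 x3 : M) (W1s W1u W2s W2u V : set M) : Prop := BowenData {
  bowen_homeo : homeomorphism f finv;
  bowen_nonsingular : nonsingular m f;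
  bowen_fixed : [/\ f x1 = x1, f x2 = x2 & f x3 = x3];
  bowen_local : exists U1 U2 U3 : set M,
    [/\ [/\ compact U1, compact U2 & compact U3],
        [/\ nbhs x1 U1, nbhs x2 U2 & nbhs x3 U3],
        [/\ U1 `&` U2 = set0, U1 `&` U3 = set0 & U2 `&` U3 = set0]
      & diffeo_on (U1 `|` U2 `|` U3) f finv];
  bowen_hyperbolic : [/\ saddle_at f x1, saddle_at f x2 & source_at f x3];
  bowen_branches :
    [/\ half_branch (stable_set f x1) x1 W1s,
        half_branch (stable_set finv x1) x1 W1u,
        half_branch (stable_set f x2) x2 W2s
      & half_branch (stable_set finv x2) x2 W2u];
  bowen_connections :
    W1s `\ x1 = W2u `\ x2 /\ W1u `\ x1 = W2s `\ x2;
  bowen_curve : simple_closed_curve (W1s `|` W2s);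
  bowen_open : open V;
  bowen_disc : homeomorphic_to_disc V;
  bowen_boundary : closure V `\` V = W1s `|` W2s;
  bowen_source : V x3;
  bowen_limits : forall y, V y -> y <> x3 ->
    [/\ omega_limit f y x1, omega_limit f y x2
      & omega_limit finv y = [set x3]] }.

Definition bowen_homeomorphism (m : {measure set (borel M) -> \bar R})
    (f : M -> M) (x1 x2 : M) (V : set M) : Prop :=
  exists (finv : M -> M) (x3 : M) (W1s W1u W2s W2u : set M),
    bowen_data m f finv x1 x2 x3 W1s W1u W2s W2u V.

End Dynamics.

Section Empirical.
Context {R : realType} (M : ptopologicalType) (f : M -> M) (x : M) (n : nat).

(* nu_(n+1)(x), so that the sequence is indexed from 0. *)
Definition empirical : set (borel M) -> \bar R :=
  mscale (n.+1%:R^-1 : R)%:nng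
    (msum (fun j => \d_(iter j f x : borel M)) n.+1).

HB.instance Definition _ := Measure.on empirical.

Let empirical_setT : empirical setT = 1%E.
Proof.
rewrite /empirical /mscale/= /msum (eq_bigr (fun=> 1%E)); last first.
  by move=> i _; exact: diracT.
by rewrite sumEFin sumr_const card_ord -EFinM mulVf// pnatr_eq0.
Qed.

HB.instance Definition _ :=
  Measure_isProbability.Build _ _ _ empirical empirical_setT.

End Empirical.

Section WeakStar.
Context {R : realType} (M : ptopologicalType).

Definition test_function : Type :=
  {phi : M -> R | continuous phi /\ exists k, forall x, `|phi x| <= k}.

HB.instance Definition _ := gen_eqMixin test_function.
HB.instance Definition _ := gen_choiceMixin test_function.

Definition test_integral (mu : probability (borel M) R) :
    {ptws test_function -> R} :=
  fun phi => (\int[mu]_x (sval phi x))%R.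

(* The coarsest topology for which mu |-> \int phi dmu is continuous for every
   bounded continuous phi. *)
Definition weak_star := initial_topology test_integral.

(* The values of a measure on non-measurable sets are irrelevant, hence
   measures are identified by [measure_eq], equality on Borel sets. *)
Record induces_weak_star
    (dist : probability (borel M) R -> probability (borel M) R -> R) : Prop :=
  InducesWeakStar {
    dist_ge0 : forall mu nu, 0 <= dist mu nu;
    dist_eq0 : forall mu nu, dist mu nu = 0 <-> measure_eq mu nu;
    dist_sym : forall mu nu, dist mu nu = dist nu mu;
    dist_triangle : forall mu nu xi, dist mu xi <= dist mu nu + dist nu xi;
    dist_nbhs : forall (mu : weak_star) (A : set weak_star),
      nbhs mu A <-> exists2 e, 0 < e & [set nu | dist mu nu < e] `<=` A }.

Definition limit_measures (f : M -> M) (x : M) : set weak_star :=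
  [set mu | exists2 k : nat -> nat, {homo k : i j / (i < j)%N} &
     (empirical f x (k n) : weak_star) @[n --> \oo] --> mu].

(* The distance to the empty set is +oo. *)
Definition dist_to_set
    (dist : probability (borel M) R -> probability (borel M) R -> R)
    (L : set (probability (borel M) R)) (mu : probability (borel M) R)
    : \bar R :=
  ereal_inf [set (dist nu mu)%:E | nu in L].

Definition SRB_like (m : {measure set (borel M) -> \bar R})
    (dist : probability (borel M) R -> probability (borel M) R -> R)
    (f : M -> M) (B : set M) : set (probability (borel M) R) :=
  [set mu | forall e : R, 0 < e ->
     let A := [set x : borel M |
       B x /\ (dist_to_set dist (limit_measures f x) mu < e%:E)%E] in
     measurable A /\ (0 < m A)%E].

End WeakStar.

(* Main.v *)
(** The map [bowen] of the plane preserves the unit square. It is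
    (x, y) |-> (2x, y/4) near the saddle (0, 0), the conjugate of this by the
    point reflection [flip] near the saddle (1, 1), and the four sides of the
    square are saddle connections. An orbit leaving (0, 0) at height y reaches
    (1, 1) at distance about exp(-2/y) from the stable side x = 1, so it stays
    there for about 1/y steps: exponentially longer than it stayed at (0, 0).
    An orbit leaving (1, 1) at distance v from the side y = 1 comes back to
    (0, 0) at distance about 1/|8 ln v| from its stable side, so this next stay
    is only logarithmically long. Hence the time averages of all orbits in the
    open square except the centre converge to the Dirac mass at (1, 1), and the
    other points of the closed square that do not behave so form a null set.

    A Lyapunov function, decreasing along orbits off the centre, shows that
    orbits accumulate on the boundary in the future and on the centre in the
    past. *)
Require Import Defs.
From HB Require Import structures.
From mathcomp Require Import all_boot all_order all_algebra.
From mathcomp Require Import all_classical all_reals all_analysis.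
From mathcomp Require Import giry measurable_realfun.
From mathcomp Require Import ring lra.
From mathcomp.real_closed Require Import complex.

Set Implicit Arguments.
Unset Strict Implicit.
Unset Printing Implicit Defensive.

Import Order.TTheory GRing.Theory Num.Theory.
Import numFieldNormedType.Exports.

Local Open Scope classical_set_scope.
Local Open Scope ring_scope.

(** * The transit map between the two saddles *)

(** For a diffeomorphism, successive stays at the two saddles would have bounded ratios, and both
    saddles would keep a share of the time. So one transit has to be flat and the other infinitely
    steep along the connections; smoothness can only be kept near the fixed points. Null sets must
    nevertheless be preserved: the transits are Lipschitz on pieces away from the sides, and the
    plane reduces to the line by sections.

    The constants 2 and 1/8 of the two transits lie on either side of the constant 1/2 of the gauge
    [psi]; this is what leaves room for a strict decrease of [lyap].

    The map is an instance of [eye l m k] with [k] an arbitrary decreasing function, because its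
    inverse and its point reflection have the same form: one computation at (0, 0) gives the stable
    and the unstable sets of both saddles.

    Time averages are not derived from estimates of sojourn times. A single nonnegative function
    [pot] drops by ln 2, up to a small error, at each step spent outside a small square at (1, 1),
    as long as the orbit is close to the boundary, and it hardly grows at the other steps. *)

Section Transit.
Context {R : realType}.
Implicit Types b c u v x y : R.

(** Flat at 0 and normalised so that 1/2 is a fixed point for every c, with slope 2 c there.
    [logo c] is its inverse on the half-line below 1/2; beyond 1/2 it has a pole, whence the upper
    bounds in what follows. *)
Definition expo c y := if y <= 0 then y else expR (c * (2 - y^-1)) / 2.

Definition logo c u := if u <= 0 then u else (2 - ln (2 * u) / c)^-1.

Lemma expo_gt0 c y : 0 < y -> 0 < expo c y.
Proof. by move=> y0; rewrite /expo leNgt y0/= divr_gt0// expR_gt0. Qed.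

Lemma expo_le0 c y : y <= 0 -> expo c y = y.
Proof. by rewrite /expo => ->. Qed.

Lemma expo_half c : expo c 2^-1 = 2^-1.
Proof. by rewrite /expo leNgt invr_gt0 ltr0n/= invrK subrr mulr0 expR0 mul1r. Qed.

Lemma expo_lt c y1 y2 : 0 < c -> y1 < y2 -> expo c y1 < expo c y2.
Proof.
move=> c0 y12; have [y2le|y2gt] := leP y2 0.
  by rewrite !expo_le0// ltW// (lt_le_trans y12).
have [y1le|y1gt] := leP y1 0.
  by rewrite (expo_le0 _ y1le) (le_lt_trans y1le)// expo_gt0.
rewrite /expo !leNgt y1gt y2gt/= ltr_pM2r// ltr_expR ltr_pM2l//.
by rewrite ltrD2l ltrN2 ltf_pV2.
Qed.

Lemma logo_den c u : 0 < c -> 0 < u <= 2^-1 -> 2 <= 2 - ln (2 * u) / c.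
Proof.
move=> c0 /andP[u0 u2]; rewrite lerDl oppr_ge0 pmulr_lle0 ?invr_gt0//.
by apply: ln_le0; lra.
Qed.

Lemma logo_gt0 c u : 0 < c -> 0 < u <= 2^-1 -> 0 < logo c u.
Proof.
move=> c0 u0; have /andP[u1 _] := u0.
by rewrite /logo leNgt u1/= invr_gt0 (lt_le_trans _ (logo_den c0 u0)).
Qed.

Lemma logo_le0 c u : u <= 0 -> logo c u = u.
Proof. by rewrite /logo => ->. Qed.

Lemma logo_half c : logo c 2^-1 = 2^-1.
Proof.
by rewrite /logo leNgt invr_gt0 ltr0n/= divff// ln1 mul0r subr0.
Qed.

Lemma logo_lt c u1 u2 : 0 < c -> u1 < u2 -> u2 <= 2^-1 -> logo c u1 < logo c u2.
Proof.
move=> c0 u12 u2h; have [u2le|u2gt] := leP u2 0.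
  by rewrite !logo_le0// ltW// (lt_le_trans u12).
have u2i : 0 < u2 <= 2^-1 by rewrite u2gt.
have [u1le|u1gt] := leP u1 0.
  by rewrite (logo_le0 _ u1le) (le_lt_trans u1le)// logo_gt0.
have u1i : 0 < u1 <= 2^-1 by rewrite u1gt ltW// (lt_le_trans u12).
rewrite /logo !leNgt u1gt u2gt/= ltf_pV2 ?posrE.
- by rewrite ltrD2l ltrN2 ltr_pM2r ?invr_gt0// ltr_ln ?posrE; lra.
- exact: lt_le_trans (logo_den c0 u1i).
- exact: lt_le_trans (logo_den c0 u2i).
Qed.

Lemma logoK c u : 0 < c -> u <= 2^-1 -> expo c (logo c u) = u.
Proof.
move=> c0 uh; have [ule|ugt] := leP u 0; first by rewrite logo_le0// expo_le0.
have ui : 0 < u <= 2^-1 by rewrite ugt.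
rewrite /expo leNgt logo_gt0//= /logo leNgt ugt/= invrK.
have -> : c * (2 - (2 - ln (2 * u) / c)) = ln (2 * u).
  by field; rewrite gt_eqF.
by rewrite lnK ?posrE; lra.
Qed.

Lemma expoK c y : 0 < c -> y <= 2^-1 -> logo c (expo c y) = y.
Proof.
move=> c0 yh; have [yle|ygt] := leP y 0; first by rewrite expo_le0// logo_le0.
rewrite /logo leNgt expo_gt0//= /expo leNgt ygt/=.
rewrite mulrCA divff// mulr1 expRK.
have -> : 2 - c * (2 - y^-1) / c = y^-1 by field; rewrite !gt_eqF.
by rewrite invrK.
Qed.

(* The maxima (and minima) with affine functions make [kap] affine near 1/2, and
   the values on negative numbers only matter for bijectivity on the line. *)
Definition beta y := Num.max (2 * y - 2^-1) (expo 2 y).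
Definition betai u := Num.min ((u + 2^-1) / 2) (logo 2 u).
Definition alpha v := Num.max (2 * v - 2^-1) (logo 8^-1 v).
Definition alphai x := Num.min ((x + 2^-1) / 2) (expo 8^-1 x).

Lemma beta_half : beta 2^-1 = 2^-1.
Proof. by rewrite /beta expo_half max_r//; lra. Qed.

Lemma alpha_half : alpha 2^-1 = 2^-1.
Proof. by rewrite /alpha logo_half max_r//; lra. Qed.

Lemma betai_half : betai 2^-1 = 2^-1.
Proof. by rewrite /betai logo_half min_r//; lra. Qed.

Lemma alphai_half : alphai 2^-1 = 2^-1.
Proof. by rewrite /alphai expo_half min_r//; lra. Qed.

Lemma beta_le0 y : y <= 0 -> beta y = y.
Proof. by move=> y0; rewrite /beta expo_le0// max_r//; lra. Qed.

Lemma alpha_le0 y : y <= 0 -> alpha y = y.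
Proof. by move=> y0; rewrite /alpha logo_le0// max_r//; lra. Qed.

Lemma betai_le0 y : y <= 0 -> betai y = y.
Proof. by move=> y0; rewrite /betai logo_le0// min_r//; lra. Qed.

Lemma alphai_le0 y : y <= 0 -> alphai y = y.
Proof. by move=> y0; rewrite /alphai expo_le0// min_r//; lra. Qed.

Lemma beta_lt y1 y2 : y1 < y2 -> beta y1 < beta y2.
Proof.
move=> y12; rewrite /beta gt_max !lt_max; apply/andP; split.
  by apply/orP; left; lra.
by apply/orP; right; exact: expo_lt.
Qed.

Lemma alpha_lt y1 y2 : y1 < y2 -> y2 <= 2^-1 -> alpha y1 < alpha y2.
Proof.
move=> y12 y2h; rewrite /alpha gt_max !lt_max; apply/andP; split.
  by apply/orP; left; lra.
by apply/orP; right; apply: logo_lt.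
Qed.

Lemma betai_lt y1 y2 : y1 < y2 -> y2 <= 2^-1 -> betai y1 < betai y2.
Proof.
move=> y12 y2h; rewrite /betai lt_min !gt_min; apply/andP; split.
  by apply/orP; left; lra.
by apply/orP; right; exact: logo_lt.
Qed.

Lemma alphai_lt y1 y2 : y1 < y2 -> alphai y1 < alphai y2.
Proof.
move=> y12; rewrite /alphai lt_min !gt_min; apply/andP; split.
  by apply/orP; left; lra.
by apply/orP; right; apply: expo_lt.
Qed.

(** The inverse of a maximum of increasing functions is the minimum of their inverses. *)
Lemma betaK y : y <= 2^-1 -> betai (beta y) = y.
Proof.
move=> yh; rewrite /betai /beta.
have [h|h] := leP (2 * y - 2^-1) (expo 2 y).
  rewrite ?(max_r h) expoK// min_r//; lra.
rewrite ?(max_l (ltW h)) min_l; first by lra.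
rewrite -{1}(_ : logo 2 (expo 2 y) = (2 * y - 2^-1 + 2^-1) / 2); last first.
  by rewrite expoK//; lra.
by apply/ltW/logo_lt => //; lra.
Qed.

Lemma alphaK y : y <= 2^-1 -> alphai (alpha y) = y.
Proof.
move=> yh; rewrite /alphai /alpha.
have [h|h] := leP (2 * y - 2^-1) (logo 8^-1 y).
  rewrite ?(max_r h) logoK// min_r//; lra.
rewrite ?(max_l (ltW h)) min_l; first by lra.
rewrite -{1}(_ : expo 8^-1 (logo 8^-1 y) = (2 * y - 2^-1 + 2^-1) / 2); last first.
  by rewrite logoK//; lra.
by apply/ltW/expo_lt => //; lra.
Qed.

Lemma betaiK y : y <= 2^-1 -> beta (betai y) = y.
Proof.
move=> yh; rewrite /betai /beta.
have [h|h] := leP ((y + 2^-1) / 2) (logo 2 y).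
  rewrite ?(min_l h) max_l; first by lra.
  have yy : (y + 2^-1) / 2 <= 2^-1 by lra.
  have -> : 2 * ((y + 2^-1) / 2) - 2^-1 = y by lra.
  rewrite -[leRHS](@logoK 2) //.
  by rewrite le_eqVlt in h; case/orP: h => [/eqP->//|h]; apply/ltW/expo_lt.
rewrite ?(min_r (ltW h)) max_r; rewrite logoK//; lra.
Qed.

Lemma alphaiK y : y <= 2^-1 -> alpha (alphai y) = y.
Proof.
move=> yh; rewrite /alphai /alpha.
have [h|h] := leP ((y + 2^-1) / 2) (expo 8^-1 y).
  rewrite ?(min_l h) max_l; first by lra.
  have -> : 2 * ((y + 2^-1) / 2) - 2^-1 = y by lra.
  rewrite -[leRHS](@expoK 8^-1) //.
  rewrite le_eqVlt in h; case/orP: h => [/eqP->//|h]; apply/ltW/logo_lt => //.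
  rewrite -(expo_half 8^-1); move: yh; rewrite le_eqVlt => /predU1P[->//|yh].
  by apply/ltW/expo_lt.
rewrite ?(min_r (ltW h)) max_r; rewrite expoK//; lra.
Qed.

Definition glue (b a : R -> R) y := if y <= 2^-1 then 1 - b y else a (1 - y).

(** Both transits in one decreasing homeomorphism: after leaving (0, 0) at height y the distance to
    the side x = 1 is 1 - [kap y] = [beta y], and after leaving (1, 1) at v = 1 - y the distance to
    x = 0 is [kap y] = [alpha v]. *)
Definition kap := glue beta alpha.
Definition kapi := glue alphai betai.

Lemma glue_lt (b a : R -> R) :
  (forall y1 y2, y1 < y2 -> y2 <= 2^-1 -> b y1 < b y2) ->
  (forall y1 y2, y1 < y2 -> y2 <= 2^-1 -> a y1 < a y2) ->
  b 2^-1 = 2^-1 -> a 2^-1 = 2^-1 ->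
  forall y1 y2, y1 < y2 -> glue b a y2 < glue b a y1.
Proof.
move=> bi ai bh ah y1 y2 y12; rewrite /glue.
have [y2h|y2h] := leP y2 2^-1.
  rewrite ifT; last by lra.
  by rewrite ltrD2l ltrN2 bi.
have := @ai (1 - y2) 2^-1; rewrite ah => /(_ ltac:(lra) ltac:(lra)) a2.
have [y1h|y1h] := leP y1 2^-1; last by apply: ai; lra.
suff : b y1 <= 2^-1 by lra.
by rewrite -bh; move: y1h; rewrite le_eqVlt => /predU1P[->//|y1h]; apply/ltW/bi.
Qed.

(** The roles of the two halves are exchanged in the inverse because a decreasing map fixing 1/2
    exchanges the half-lines on its two sides. *)
Lemma glueK (b a b' a' : R -> R) :
  (forall y1 y2, y1 < y2 -> y2 <= 2^-1 -> b y1 < b y2) ->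
  (forall y1 y2, y1 < y2 -> y2 <= 2^-1 -> a y1 < a y2) ->
  b 2^-1 = 2^-1 -> a 2^-1 = 2^-1 -> a' 2^-1 = 2^-1 ->
  (forall y, y <= 2^-1 -> b' (b y) = y) ->
  (forall y, y <= 2^-1 -> a' (a y) = y) ->
  cancel (glue b a) (glue a' b').
Proof.
move=> bi ai bh ah ah' bK aK y; rewrite /glue.
have [yh|yh] := leP y 2^-1.
  move: yh; rewrite le_eqVlt => /predU1P[->|yh].
    by rewrite bh ifT; [rewrite (_ : 1 - 2^-1 = 2^-1) ?ah'|]; lra.
  have := @bi _ _ yh; rewrite bh => /(_ (lexx _)) bb.
  rewrite ifF; last by apply/negbTE; rewrite -ltNge; lra.
  by rewrite subKr bK// ltW.
have := @ai (1 - y) 2^-1; rewrite ah => /(_ ltac:(lra) ltac:(lra)) a2.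
by rewrite ifT ?aK; lra.
Qed.

Lemma kap_lt y1 y2 : y1 < y2 -> kap y2 < kap y1.
Proof.
apply: glue_lt; rewrite ?beta_half ?alpha_half//; last exact: alpha_lt.
by move=> ? ? + _; exact: beta_lt.
Qed.

Lemma kapi_lt y1 y2 : y1 < y2 -> kapi y2 < kapi y1.
Proof.
apply: glue_lt; rewrite ?betai_half ?alphai_half//; last exact: betai_lt.
by move=> ? ? + _; exact: alphai_lt.
Qed.

Lemma kapK : cancel kap kapi.
Proof.
apply: glueK; rewrite ?beta_half ?alpha_half ?alphai_half//.
- by move=> ? ? + _; exact: beta_lt.
- exact: alpha_lt.
- exact: betaK.
- exact: alphaK.
Qed.

Lemma kapiK : cancel kapi kap.
Proof.
apply: glueK; rewrite ?betai_half ?alphai_half ?beta_half//.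
- by move=> ? ? + _; exact: alphai_lt.
- exact: betai_lt.
- exact: alphaiK.
- exact: betaiK.
Qed.

Lemma kap_le_half y : y <= 2^-1 -> kap y = 1 - beta y.
Proof. by rewrite /kap /glue => ->. Qed.

Lemma kap_ge_half y : 2^-1 <= y -> kap y = alpha (1 - y).
Proof.
rewrite le_eqVlt => /predU1P[<-|y2]; last by rewrite /kap /glue leNgt y2.
by rewrite kap_le_half// beta_half (_ : 1 - 2^-1 = 2^-1) ?alpha_half//; lra.
Qed.

Lemma kap0 : kap 0 = 1.
Proof. by rewrite kap_le_half ?beta_le0 ?subr0// invr_ge0. Qed.

Lemma kap1 : kap 1 = 0.
Proof. by rewrite kap_ge_half ?subrr ?alpha_le0//; lra. Qed.

Lemma kapi0 : kapi 0 = 1.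
Proof. by rewrite -kap1 kapK. Qed.

Lemma kapi1 : kapi 1 = 0.
Proof. by rewrite -kap0 kapK. Qed.

(** At 1/2 both [expo 2] and [logo 8^-1] have slope 4, so below it they first run under the line of
    slope 2. The elementary bounds on exp and ln reduce this to -2 (2 y - 1) (3 y - 1) >= 0 and,
    with v = 1 - y, to -2 (2 v - 1) (8 v - 3) >= 0: hence the end points 1/3 and 5/8. *)
Lemma kap_affine y : 3^-1 <= y <= 5 / 8 -> kap y = 3 / 2 - 2 * y.
Proof.
move=> /andP[y3 y8]; have [yh|yh] := leP y 2^-1.
  rewrite kap_le_half// /beta max_l; first by lra.
  have y0 : 0 < y by lra.
  rewrite /expo (leNgt y 0) y0/=.
  set s := 2 * (y^-1 - 2); have s0 : 0 <= s.
    by rewrite mulr_ge0// subr_ge0 -(invrK 2) lef_pV2 ?posrE.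
  have -> : 2 * (2 - y^-1) = - s by rewrite /s; ring.
  have e1 := expR_ge1Dx s; have e2 : expR s * expR (- s) = 1.
    by rewrite -expRD subrr expR0.
  have ys : y * (1 + s) = 2 - 3 * y.
    by rewrite /s; field; rewrite gt_eqF.
  have h1 : y * (1 + s) * expR (- s) <= y.
    by rewrite -mulrA ger_pMr// -[leRHS]e2 ler_pM2r ?expR_gt0.
  rewrite ys in h1.
  set e := expR (- s) in h1 *.
  have h2 : (2 - 3 * y) * (4 * y - 1) >= y by nra.
  nra.
rewrite kap_ge_half; last by lra.
set v := 1 - y.
have v1 : 3 / 8 <= v by rewrite /v; lra.
have v2 : v < 2^-1 by rewrite /v; lra.
rewrite /alpha max_l; first by rewrite /v; lra.
have v0 : 0 < v by lra.
rewrite /logo (leNgt v 0) v0/= invrK.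
have l : ln (2 * v) <= 2 * v - 1.
  by have := @le_ln1Dx R (2 * v - 1); rewrite addrCA subrr addr0; apply; lra.
set d := _ - _ * 8; have d1 : 10 - 16 * v <= d by rewrite /d; lra.
have d0 : 0 < d by lra.
by rewrite -div1r ler_pdivrMr//; nra.
Qed.

End Transit.

(** * The map and its inverse *)

Section EyeMap.
Context {R : realType}.
Implicit Types (l m : R) (k : R -> R) (p : plane R).

(* [eyeX] clamps [k y] between [l x - (l - 1)] and [l x]; the share [eyeT] of the
   stretching which the clamping removes is returned in the second coordinate.
   So the inverse is again of this form, with coordinates swapped: [eyeK]. *)
Definition eyeX l k p := Num.max (l * p.1 - (l - 1)) (Num.min (l * p.1) (k p.2)).

Definition eyeT l k p := (l * p.1 - eyeX l k p) / (l - 1).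

Definition eye l m k p : plane R :=
  (eyeX l k p, m * p.2 + (1 - m) * eyeT l k p).

Definition swap p : plane R := (p.2, p.1).

Definition flip p : plane R := (1 - p.1, 1 - p.2).

Definition kflip k y := 1 - k (1 - y).

Lemma swapK : involutive swap. Proof. by case. Qed.

Lemma flipK : involutive flip.
Proof. by case=> x y; rewrite /flip/= !subKr. Qed.

Lemma eye_low l m k x y : 1 < l -> l * x <= k y ->
  eye l m k (x, y) = (l * x, m * y).
Proof.
move=> l1 xk; have h : eyeX l k (x, y) = l * x.
  by rewrite /eyeX/= min_l// max_r//; lra.
by rewrite /eye /eyeT h subrr mul0r mulr0 addr0.
Qed.

Lemma eye_up l m k x y : 1 < l -> k y <= l * x - (l - 1) ->
  eye l m k (x, y) = (l * x - (l - 1), m * y + (1 - m)).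
Proof.
move=> l1 xk; have h : eyeX l k (x, y) = l * x - (l - 1).
  by rewrite /eyeX/= min_r ?max_l//; lra.
by rewrite /eye /eyeT h/= subKr divff ?mulr1 ?subr_eq0 ?gt_eqF.
Qed.

Lemma eye_mid l m k x y : 1 < l -> l * x - (l - 1) <= k y <= l * x ->
  eye l m k (x, y) = (k y, m * y + (1 - m) * ((l * x - k y) / (l - 1))).
Proof.
move=> l1 /andP[xk1 xk2]; have h : eyeX l k (x, y) = k y.
  by rewrite /eyeX/= min_r ?max_r.
by rewrite /eye /eyeT h.
Qed.

Lemma eye_cases l k x y : [\/ l * x <= k y, k y <= l * x - (l - 1)
  | l * x - (l - 1) <= k y <= l * x].
Proof.
have [h1|h1] := leP (l * x) (k y); first by constructor 1.
have [h2|h2] := leP (k y) (l * x - (l - 1)); first by constructor 2.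
by constructor 3; rewrite !ltW.
Qed.

Lemma eyeT_itv l k p : 1 < l -> 0 <= eyeT l k p <= 1.
Proof.
move=> l1; have l0 : 0 < l - 1 by lra.
have X1 : l * p.1 - (l - 1) <= eyeX l k p by rewrite /eyeX le_max lexx.
have X2 : eyeX l k p <= l * p.1.
  by rewrite /eyeX ge_max ge_min lexx/= andbT; lra.
by rewrite /eyeT ler_pdivlMr// mul0r ler_pdivrMr// mul1r; lra.
Qed.

(** The reflection exchanges the lower and the upper clamp, so that facts about (0, 0) for arbitrary
    [k] also apply to (1, 1). *)
Lemma eye_flip l m k p : 1 < l ->
  eye l m (kflip k) (flip p) = flip (eye l m k p).
Proof.
case: p => x y l1.
have fE a b : flip (a, b) = (1 - a, 1 - b) by [].
rewrite fE; have kE : kflip k (1 - y) = 1 - k y by rewrite /kflip subKr.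
have l0 : l - 1 != 0 by rewrite subr_eq0 gt_eqF.
case: (eye_cases l k x y) => h.
- rewrite eye_up ?kE//; last by lra.
  by rewrite eye_low// fE; congr pair; ring.
- rewrite eye_low ?kE//; last by lra.
  by rewrite eye_up// fE; congr pair; ring.
- rewrite eye_mid ?kE//; last by lra.
  by rewrite eye_mid// fE; congr pair; field.
Qed.

Definition decreasing k := forall y1 y2, y1 < y2 -> k y2 < k y1.

Lemma decreasing_le k : decreasing k -> forall y1 y2, (k y2 <= k y1) = (y1 <= y2).
Proof.
move=> kd y1 y2; apply/idP/idP => [|]; last first.
  by rewrite le_eqVlt => /predU1P[->//|/kd/ltW].
by apply: contraTT; rewrite -!ltNge; exact: kd.
Qed.

Lemma decreasing_kflip k : decreasing k -> decreasing (kflip k).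
Proof.
by move=> kd y1 y2 y12; rewrite /kflip ltrD2l ltrN2 kd// ltrD2l ltrN2.
Qed.

Lemma eyeK l m k k' : 1 < l -> 0 < m < 1 -> decreasing k ->
  cancel k k' -> cancel k' k ->
  cancel (eye l m k) (swap \o eye m^-1 l^-1 k' \o swap).
Proof.
move=> l1 /andP[m0 m1] kd kK k'K [x y].
rewrite /comp.
have mi : 1 < m^-1 by rewrite invf_gt1.
have lp : 0 < l by lra.
have l0 : l - 1 != 0 by rewrite subr_eq0 gt_eqF.
have l0' : l != 0 by rewrite gt_eqF.
have m0' : m != 0 by rewrite gt_eqF.
have m1' : 1 - m != 0 by rewrite subr_eq0 gt_eqF.
have k'd z w : (z <= k' w) = (w <= k z).
  by rewrite -[in LHS](kK z) -{1}(k'K w) -(decreasing_le kd) !k'K.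
have k'd' z w : (k' w <= z) = (k z <= w).
  by rewrite -[in LHS](kK z) -{1}(k'K w) -(decreasing_le kd) !k'K.
case: (eye_cases l k x y) => h.
- have e : eye m^-1 l^-1 k' (m * y, l * x) = (y, x).
    rewrite eye_low//; last by rewrite mulrA mulVf// mul1r k'd.
    by rewrite !mulrA !mulVf// !mul1r.
  by rewrite (eye_low m l1 h); exact: (congr1 swap e).
- have e0 : m^-1 * (m * y + (1 - m)) - (m^-1 - 1) = y by field.
  have e : eye m^-1 l^-1 k' (m * y + (1 - m), l * x - (l - 1)) = (y, x).
    rewrite eye_up//; last by rewrite e0 k'd'.
    by rewrite e0; congr pair; field.
  by rewrite (eye_up m l1 h); exact: (congr1 swap e).
- set t := (l * x - k y) / (l - 1).
  have t01 : 0 <= t <= 1.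
    by rewrite /t ler_pdivlMr ?ler_pdivrMr ?subr_gt0//; lra.
  (* Since t lies in [0, 1], the value [k' (k y)] = y lies between the two clamps of the inverse,
     which then recovers the same share t. *)
  have e0 : m^-1 * (m * y + (1 - m) * t) = y + (m^-1 - 1) * t by field.
  have mm : 0 < m^-1 - 1 by lra.
  have e : eye m^-1 l^-1 k' (m * y + (1 - m) * t, k y) = (y, x).
    rewrite eye_mid//; last by rewrite kK e0; apply/andP; split; nra.
    rewrite kK e0; congr pair.
    by rewrite /t; field; do ?[apply/andP; split] => //; lra.
  by rewrite (eye_mid m l1 h); exact: (congr1 swap e).
Qed.

(** A monotone surjection has no jumps: the preimages of [k x + e] and [k x - e] bracket x. *)
Lemma decreasing_continuous k k' : decreasing k -> cancel k' k -> continuous k.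
Proof.
move=> kd k'K x; apply/cvgrPdist_lt => e e0.
pose a := k' (k x + e); pose b := k' (k x - e).
have ka : k a = k x + e by rewrite k'K.
have kb : k b = k x - e by rewrite k'K.
have ax : a < x by rewrite ltNge -(decreasing_le kd) ka -ltNge; lra.
have xb : x < b by rewrite ltNge -(decreasing_le kd) kb -ltNge; lra.
near=> y.
have ay : a < y by near: y; exact: lt_nbhsr.
have yb : y < b by near: y; exact: lt_nbhsl.
have := kd _ _ ay; have := kd _ _ yb; rewrite ka kb ltr_norml; lra.
Unshelve. all: by end_near. Qed.

Lemma pair_continuous (T U W : topologicalType) (f : T -> U) (g : T -> W) :
  continuous f -> continuous g -> continuous (fun x => (f x, g x)).
Proof. by move=> fc gc x; apply: cvg_pair; [exact: fc|exact: gc]. Qed.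

Lemma eye_continuous l m k : continuous k -> continuous (eye l m k).
Proof.
move=> kc.
have Xc : continuous (eyeX l k).
  move=> p; apply: (@continuous_max _ _ (fun p => l * p.1 - (l - 1))
    (fun p => Num.min (l * p.1) (k p.2))).
    apply: cvgB; last exact: cvg_cst.
    by apply: cvgM; [exact: cvg_cst|exact: cvg_fst].
  apply: (@continuous_min _ _ (fun p => l * p.1) (fun p => k p.2)).
    by apply: cvgM; [exact: cvg_cst|exact: cvg_fst].
  by apply: (cvg_comp _ _ (@cvg_snd _ _ _ _ _)); exact: kc.
apply: pair_continuous => // p; apply: cvgD.
  by apply: cvgM; [exact: cvg_cst|exact: cvg_snd].
apply: cvgM; first exact: cvg_cst.
apply: cvgM; last exact: cvg_cst.
apply: cvgB; last exact: Xc.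
by apply: cvgM; [exact: cvg_cst|exact: cvg_fst].
Qed.

Lemma swap_continuous : continuous swap.
Proof. by apply: pair_continuous => p; [exact: cvg_snd|exact: cvg_fst]. Qed.

Lemma flip_continuous : continuous flip.
Proof.
by apply: pair_continuous => p; apply: cvgB; (exact: cvg_cst || exact: cvg_fst || exact: cvg_snd).
Qed.

(** The whole stable manifold of (0, 0): the line through the left side, up to the corner (0, 1),
    continued by the top side towards (1, 1), which is excluded. *)
Definition stable_line : set (plane R) :=
  [set p | (p.1 = 0 /\ p.2 <= 1) \/ (p.2 = 1 /\ 0 <= p.1 < 1)].

Section StableLine.
Variables (l m : R) (k : R -> R).
Hypotheses (l1 : 1 < l) (m01 : 0 < m < 1) (kd : decreasing k).
Hypotheses (k0 : k 0 = 1) (k1 : k 1 = 0).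

Let kge0 y : (0 <= k y) = (y <= 1).
Proof. by rewrite -k1 decreasing_le. Qed.

Let kle0 y : (k y <= 0) = (1 <= y).
Proof. by rewrite -k1 decreasing_le. Qed.

(** The top side is stretched away from (1, 1) and bent around the corner (0, 1) onto the left side,
    which is contracted towards (0, 0). *)
Lemma eye_stable_line p : stable_line (eye l m k p) <-> stable_line p.
Proof.
have /andP[m0 m1] := m01; have l1' := l1.
have l0 : 0 < l by exact: lt_trans ltr01 l1.
case: p => x y; split.
  case: (eye_cases l k x y) => h.
  - rewrite eye_low// /stable_line/= => -[[/eqP]|[my x01]].
      rewrite mulf_eq0 (gt_eqF l0)/= => /eqP x0 _; left; split=> //.
      by rewrite -kge0 (le_trans _ h)// x0 mulr0.
    have : y <= 1 by rewrite -kge0 (le_trans _ h)//; case/andP: x01.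
    by move=> y1; exfalso; nra.
  - rewrite eye_up// /stable_line/= => -[[xe my]|[my x01]].
      have y1 : y <= 1 by nra.
      have : k y <= 0 by rewrite -xe.
      by rewrite kle0 => y1'; right; split; [lra|apply/andP; split; nra].
    have y1 : y = 1 by nra.
    by right; split=> //; apply/andP; split; nra.
  - rewrite eye_mid// /stable_line/=; set t := (_ - _) / (_ - _).
    have t01 : 0 <= t <= 1.
      by rewrite /t ler_pdivlMr ?ler_pdivrMr ?subr_gt0//; lra.
    move=> [[ky _]|[my ky]].
      have y1 : y = 1 by apply/eqP; rewrite eq_le -kge0 -kle0 ky lexx.
      by right; split=> //; rewrite ky in h; apply/andP; split; nra.
    have [ky0|ky0] := ltP 0 (k y).
      have : 1 <= y by nra.
      by rewrite -kle0 => ky0'; exfalso; lra.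
    have ky1 : k y = 0 by lra.
    have y1 : y = 1 by apply/eqP; rewrite eq_le -kge0 -kle0 ky1 lexx.
    by right; split=> //; rewrite ky1 in h; apply/andP; split; nra.
move=> -[[/= x0 y1]|[/= y1 x01]].
  by rewrite eye_low ?x0 ?mulr0 ?kge0//; left; split=> //=; nra.
have [h|h] := leP 0 (l * x - (l - 1)).
  by rewrite eye_up ?y1 ?k1//; right; split=> /=; [ring|apply/andP; split; nra].
rewrite eye_mid ?y1 ?k1//; last by apply/andP; split; nra.
left; split=> //=; rewrite subr0.
have : l * x / (l - 1) <= 1 by rewrite ler_pdivrMr ?subr_gt0//; lra.
nra.
Qed.

End StableLine.

End EyeMap.

(** * A Lyapunov function *)

Section Levels.
Context {R : realType}.
Implicit Types u v x y : R.

(** This is exp(-s) <= 1 / (1 + s) for s = c (1/y - 2), cleared of denominators. *)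
Lemma expo_le (c y : R) : 0 < c -> 0 < y <= 2^-1 ->
  expo c y * (y + c * (1 - 2 * y)) <= y / 2.
Proof.
move=> c0 /andP[y0 yh]; rewrite /expo (leNgt y 0) y0/=.
set s := c * (y^-1 - 2); have s0 : 0 <= s.
  by apply: mulr_ge0; [exact: ltW|rewrite subr_ge0 -(invrK 2) lef_pV2 ?posrE].
have -> : c * (2 - y^-1) = - s by rewrite /s; ring.
have e1 := expR_ge1Dx s; have e2 : expR s * expR (- s) = 1.
  by rewrite -expRD subrr expR0.
have ys : y * (1 + s) = y + c * (1 - 2 * y).
  by rewrite /s; field; rewrite gt_eqF.
rewrite -ys; have h0 : (1 + s) * expR (- s) <= 1.
  by rewrite -[leRHS]e2 ler_pM2r ?expR_gt0.
set e := expR (- s) in h0 *; nra.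
Qed.

(** The threshold 1/2 is sharp, the slope of [expo c] at its fixed point 1/2 being 2 c. *)
Lemma expo_le_id (c y : R) : 2^-1 <= c -> 0 < y <= 2^-1 -> expo c y <= y.
Proof.
move=> ch /[dup] yy /andP[y0 yh]; have c0 : 0 < c by lra.
have := expo_le c0 yy; have := expo_gt0 c y0.
set e := expo c y => e0 h.
have : y + c * (1 - 2 * y) >= 2^-1 by nra.
nra.
Qed.

Lemma beta_le y : y <= 2^-1 -> beta y <= y.
Proof.
move=> yh; have [y0|y0] := leP y 0; first by rewrite beta_le0.
rewrite /beta ge_max; apply/andP; split; first by lra.
by rewrite expo_le_id ?y0//; lra.
Qed.

Lemma beta_gt0 y : 0 < y -> 0 < beta y.
Proof. by move=> y0; rewrite /beta lt_max expo_gt0 ?orbT. Qed.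

Lemma alpha_gt0 v : 0 < v <= 2^-1 -> 0 < alpha v.
Proof. by move=> v0; rewrite /alpha lt_max logo_gt0 ?orbT. Qed.

Lemma alpha_le_half v : v <= 2^-1 -> alpha v <= 2^-1.
Proof.
rewrite -{2}alpha_half le_eqVlt => /predU1P[->//|vh].
by apply/ltW/alpha_lt.
Qed.

Lemma alpha_ge v : v <= 2^-1 -> logo 8^-1 v <= alpha v.
Proof. by move=> vh; rewrite /alpha le_max lexx orbT. Qed.

(** The constant 1/2 makes the gauge tangent to the identity at 1/2; it lies above the identity
    before that ([psi_ge]). *)
Definition psi : R -> R := logo 2^-1.

Lemma psi_half : psi 2^-1 = 2^-1. Proof. exact: logo_half. Qed.

Lemma psi_lt u v : u < v -> v <= 2^-1 -> psi u < psi v.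
Proof. exact: logo_lt. Qed.

Lemma psi_le u v : u <= v -> v <= 2^-1 -> psi u <= psi v.
Proof.
rewrite le_eqVlt => /predU1P[->//|uv vh]; exact/ltW/psi_lt.
Qed.

Lemma psi_ge v : v <= 2^-1 -> v <= psi v.
Proof.
move=> vh; have [v0|v0] := leP v 0; first by rewrite /psi logo_le0.
rewrite -{1}(@logoK _ 2^-1 v)// expo_le_id// logo_gt0 ?v0//=.
by rewrite -[leRHS]psi_half psi_le.
Qed.

(** After applying the increasing inverse [expo 2^-1] of [psi], the claim is [beta y] <
    [expo 2^-1 y]. The exponential part of [beta] is smaller because 2 > 1/2, and the affine part
    because exp z >= 1 + z. *)
Lemma psi_beta y : 0 < y < 2^-1 -> psi (beta y) < y.
Proof.
move=> /andP[y0 yh]; rewrite -{2}(@expoK _ 2^-1 y) ?ltW//.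
have iy : 2 < y^-1 by rewrite -(invrK 2) ltf_pV2 ?posrE.
apply: psi_lt; last first.
  by rewrite -{2}(expo_half 2^-1) ltW// expo_lt.
rewrite /beta gt_max; apply/andP; split; last first.
  by rewrite /expo (leNgt y 0) y0/= ltr_pM2r// ltr_expR; lra.
have [y4|y4] := leP y 4^-1.
  by apply: le_lt_trans (expo_gt0 _ y0); lra.
have := expR_ge1Dx (2^-1 * (2 - y^-1)).
rewrite /expo (leNgt y 0) y0/=; set e := expR _ => h.
have yy : y * y^-1 = 1 by rewrite divff// gt_eqF.
set z := y^-1 in yy h iy *.
have : 2 * y - 2^-1 < (1 + 2^-1 * (2 - z)) / 2; last by lra.
rewrite -(ltr_pM2l y0).
have -> : y * ((1 + 2^-1 * (2 - z)) / 2) = y - 1 / 4 * (y * z) by field.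
by rewrite yy; nra.
Qed.

Lemma alpha_psi v : 0 < v < 2^-1 -> alpha v < psi v.
Proof.
move=> /andP[v0 vh]; rewrite /alpha gt_max; apply/andP; split.
  by apply: lt_le_trans (psi_ge (ltW vh)); lra.
have lv : ln (2 * v) < 0 by apply: ln_lt0; lra.
rewrite /psi /logo (leNgt v 0) v0/= !invrK ltf_pV2 ?posrE; lra.
Qed.

(** With a = [alpha v] this reads 3 a - 1 < v, the form used in [lyap_mid_ge]. *)
Lemma alpha_third v : 0 < v < 2^-1 -> alpha v < (1 + v) / 3.
Proof.
move=> /andP[v0 vh]; rewrite /alpha gt_max; apply/andP; split; first by lra.
rewrite /logo (leNgt v 0) v0/= invrK.
have l : ln (2 * v) <= 2 * v - 1.
  by have := @le_ln1Dx R (2 * v - 1); rewrite addrCA subrr addr0; apply; lra.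
set d := _ - _ * 8; have d1 : 10 - 16 * v <= d by rewrite /d; lra.
have d0 : 0 < d by lra.
by rewrite -div1r ltr_pdivrMr//; nra.
Qed.

(** When ln (2 v) < -1/2, the coefficient 8 of [alpha] against the coefficient 2 of [psi] leaves a
    margin of at least 3 in the denominators, which pays for replacing v by v/2 at the price 2 ln 2.
    Closer to 1/2, [alpha] is below the identity. *)
Lemma alpha_alt v : 0 < v <= 2^-1 -> alpha v <= v \/ alpha v <= psi (v / 2).
Proof.
move=> /andP[v0 vh].
have l : ln (2 * v) <= 2 * v - 1.
  by have := @le_ln1Dx R (2 * v - 1); rewrite addrCA subrr addr0; apply; lra.
have l0 : ln (2 * v) <= 0 by lra.
rewrite /alpha /logo (leNgt v 0) v0/= invrK.
have [s|s] := leP (- 2^-1) (ln (2 * v)).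
  left; rewrite ge_max; apply/andP; split; first by lra.
  by rewrite -div1r ler_pdivrMr; nra.
right; rewrite ge_max; apply/andP; split.
  apply: le_trans (psi_ge _); last by lra.
  (* From 1/2 < ln (1 / (2 v)) <= 1 / (2 v) - 1 one gets v < 1/3, hence 2 v - 1/2 <= v/2. *)
  have z0 : 0 < (2 * v)^-1 by rewrite invr_gt0; lra.
  have := @le_ln1Dx R ((2 * v)^-1 - 1).
  rewrite addrCA subrr addr0 lnV ?posrE; last by lra.
  move=> /(_ ltac:(lra)) h.
  have : 2 * v * (2 * v)^-1 = 1 by rewrite divff// gt_eqF//; lra.
  by set z := (2 * v)^-1 in z0 h * => zz; nra.
have v20 : 0 < v / 2 by lra.
rewrite /psi /logo (leNgt (v / 2)) v20/= invrK.
have -> : 2 * (v / 2) = v by field.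
have -> : ln v = ln (2 * v) - ln 2 by rewrite lnM ?posrE//; lra.
have l2 : ln 2 <= 1 :> R.
  by have := @le_ln1Dx R 1; apply; lra.
have l2' : 0 <= ln 2 :> R by apply: ln_ge0; lra.
by rewrite lef_pV2 ?posrE; lra.
Qed.

End Levels.

(** * Strict decrease of the Lyapunov function along orbits *)

Section Lyapunov.
Context {R : realType}.
Implicit Types (u v x y : R) (p : plane R).

Definition bowen : plane R -> plane R := eye 2 4^-1 kap.

Definition square : set (plane R) := [set p | 0 < p.1 < 1 /\ 0 < p.2 < 1].

Definition center : plane R := (2^-1, 2^-1).

(* [lam p] vanishes on the two sides meeting at (0, 0), and [lam (flip p)] on
   those meeting at (1, 1). The gauge [psi] lies between the two transits:
   [psi (beta y) < y] and [alpha v < psi v], hence [lyap] decreases. *)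
Definition mh x := Num.min x 2^-1.

Definition lam p := 2 * mh p.1 * mh p.2.

Definition lyap p := Num.min (lam p) (psi (lam (flip p))).

Lemma bowen_low x y : 2 * x <= kap y -> bowen (x, y) = (2 * x, y / 4).
Proof. by move=> h; rewrite /bowen eye_low ?(mulrC y)//; lra. Qed.

Lemma bowen_up x y : kap y <= 2 * x - 1 ->
  bowen (x, y) = (2 * x - 1, y / 4 + 3 / 4).
Proof. by move=> h; rewrite /bowen eye_up; [congr pair; lra|lra|lra]. Qed.

Lemma bowen_mid x y : 2 * x - 1 <= kap y <= 2 * x ->
  bowen (x, y) = (kap y, y / 4 + 3 / 4 * (2 * x - kap y)).
Proof. move=> h; have e : 2 - 1 = 1 :> R by lra.
by rewrite /bowen eye_mid; [rewrite e divr1; congr pair; lra|lra|lra]. Qed.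

Lemma bowen_cases x y : [\/ 2 * x <= kap y, kap y <= 2 * x - 1
  | 2 * x - 1 <= kap y <= 2 * x].
Proof.
case: (eye_cases 2 kap x y) => h; [constructor 1|constructor 2|constructor 3];
  lra.
Qed.

Lemma kap_half : kap 2^-1 = 2^-1 :> R.
Proof. by rewrite kap_affine; lra. Qed.

Lemma bowen_center : bowen center = center.
Proof.
by rewrite /center bowen_mid kap_half; [congr pair; lra|apply/andP; split; lra].
Qed.

Lemma bowenK : cancel bowen (swap \o eye 4 2^-1 kapi \o swap).
Proof.
have := @eyeK R 2 4^-1 kap kapi; rewrite invrK; apply.
- by lra.
- by apply/andP; split; lra.
- exact: kap_lt.
- exact: kapK.
- exact: kapiK.
Qed.

Lemma kap_itv y : 0 < y < 1 -> 0 < kap y < 1.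
Proof. move=> /andP[y0 y1].
by apply/andP; split; [rewrite -kap1|rewrite -kap0]; exact: kap_lt. Qed.

Lemma mhl x : x <= 2^-1 -> mh x = x. Proof. exact: min_l. Qed.

Lemma mhr x : 2^-1 <= x -> mh x = 2^-1. Proof. exact: min_r. Qed.

Lemma mh_le x : mh x <= x. Proof. by rewrite /mh ge_min lexx. Qed.

Lemma mh_le_half x : mh x <= 2^-1. Proof. by rewrite /mh ge_min lexx orbT. Qed.

Lemma mh_gt0 x : 0 < x -> 0 < mh x.
Proof. by move=> x0; rewrite /mh lt_min x0/=; lra. Qed.

Lemma lam_le_half p : square p -> lam p <= 2^-1.
Proof.
case: p => x y [/= /andP[x0 _] /andP[y0 _]]; rewrite /lam/=.
have := mh_gt0 x0; have := mh_gt0 y0; have := mh_le_half x; have := mh_le_half y.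
by set a := mh x; set b := mh y; nra.
Qed.

Lemma lam_gt0 p : square p -> 0 < lam p.
Proof.
case: p => x y [/= /andP[x0 _] /andP[y0 _]]; rewrite /lam/=.
by rewrite !mulr_gt0// mh_gt0.
Qed.

Lemma square_flip p : square p -> square (flip p).
Proof.
by case: p => x y [/= /andP[? ?] /andP[? ?]]; split=> /=; apply/andP; split; lra.
Qed.

Lemma lyap_gt0 p : square p -> 0 < lyap p.
Proof.
move=> sp; rewrite /lyap lt_min lam_gt0//=.
have h := square_flip sp; rewrite logo_gt0// lam_gt0//=.
exact: lam_le_half.
Qed.

(** [lam p] reaches 1/2 only when both coordinates are at least 1/2, and [lam (flip p)] only when
    both are at most 1/2. *)
Lemma lyap_lt_half p : square p -> p <> center -> lyap p < 2^-1.
Proof.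
move=> sp pc; rewrite /lyap gt_min.
apply/orP; apply: contrapT => /not_orP[/negP + /negP].
rewrite -!leNgt => h1 h2; apply: pc.
have h2' : 2^-1 <= lam (flip p).
  rewrite leNgt; apply/negP => h; move: h2; apply/negP; rewrite -ltNge.
  by rewrite -psi_half psi_lt.
case: p sp h1 h2' {h2} => x y [/= /andP[x0 x1] /andP[y0 y1]].
rewrite /lam/=.
have k a b : 0 < a -> 0 < b -> 2^-1 <= 2 * mh a * mh b -> 2^-1 <= a /\ 2^-1 <= b.
  move=> a0 b0; have := mh_gt0 a0; have := mh_gt0 b0.
  have := mh_le_half a; have := mh_le_half b; have := mh_le a; have := mh_le b.
  set a' := mh a; set b' := mh b => *; split; nra.
have x1' : 0 < 1 - x by lra.
have y1' : 0 < 1 - y by lra.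
move=> /(k _ _ x0 y0)[? ?] /(k _ _ x1' y1')[? ?].
by rewrite /center; congr pair; lra.
Qed.

Lemma lyap_le_lam p : lyap p <= lam p.
Proof. by rewrite /lyap ge_min lexx. Qed.

Lemma lyap_le_psi p : lyap p <= psi (lam (flip p)).
Proof. by rewrite /lyap ge_min lexx orbT. Qed.

Lemma lam_le_mul x y : 0 < x -> 0 < y -> lam (x, y) <= 2 * x * y.
Proof.
move=> x0 y0; rewrite /lam/= -!mulrA ler_pM2l//.
by rewrite ler_pM ?mh_le// ltW// mh_gt0.
Qed.

Lemma bowen_square p : square p -> square (bowen p).
Proof.
case: p => x y [/= x01 y01]; have ky := kap_itv y01.
case: (bowen_cases x y) => h.
- by rewrite bowen_low//; split=> /=; apply/andP; split; lra.
- by rewrite bowen_up//; split=> /=; apply/andP; split; lra.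
- by rewrite bowen_mid//; split=> /=; apply/andP; split; lra.
Qed.

(** The step halves x y, which bounds the new [lam]. The old second bound can only compete when y >
    1/2, and then [alpha_psi] applies because 2 x <= [kap y] = [alpha (1 - y)]. *)
Lemma lyap_low x y : square (x, y) -> 2 * x <= kap y ->
  lyap (2 * x, y / 4) < lyap (x, y).
Proof.
move=> [/= /andP[x0 x1] /andP[y0 y1]] h.
have /andP[ky0 ky1] : 0 < kap y < 1 by rewrite kap_itv ?y0.
have xy : lyap (2 * x, y / 4) <= x * y.
  apply: le_trans (lyap_le_lam _) _; apply: le_trans (lam_le_mul _ _) _; lra.
apply: le_lt_trans xy _; rewrite /lyap lt_min /lam/=.
rewrite (@mhl x); last by lra.
rewrite (@mhr (1 - x)); last by lra.
have [yh|yh] := leP y 2^-1.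
  rewrite mhl// mhr; last by lra.
  rewrite (_ : 2 * 2^-1 * 2^-1 = 2^-1) ?psi_half; last by lra.
  by apply/andP; split; nra.
rewrite mhr ?(ltW yh)// mhl; last by lra.
rewrite (_ : 2 * 2^-1 * (1 - y) = 1 - y); last by lra.
apply/andP; split; first by nra.
have := @alpha_psi R (1 - y); rewrite -kap_ge_half ?(ltW yh)// => k.
by apply: lt_trans (k _); [nra|apply/andP; split; lra].
Qed.

(** The mirror image of [lyap_low]: the product (1 - x) (1 - y) is halved, and [psi_beta] replaces
    [alpha_psi]. *)
Lemma lyap_up x y : square (x, y) -> kap y <= 2 * x - 1 ->
  lyap (2 * x - 1, y / 4 + 3 / 4) < lyap (x, y).
Proof.
move=> [/= /andP[x0 x1] /andP[y0 y1]] h.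
have /andP[ky0 ky1] : 0 < kap y < 1 by rewrite kap_itv ?y0.
have uv : lam (flip (2 * x - 1, y / 4 + 3 / 4)) <= (1 - x) * (1 - y).
  by apply: le_trans (lam_le_mul _ _) _ => /=; lra.
apply: (@le_lt_trans _ _ (psi ((1 - x) * (1 - y)))).
  by apply: le_trans (lyap_le_psi _) _; apply: psi_le => //; nra.
rewrite /lyap lt_min /lam/=.
rewrite (@mhr x); last by lra.
rewrite (@mhl (1 - x)); last by lra.
have [yh|yh] := leP y 2^-1.
  rewrite mhl// mhr; last by lra.
  rewrite (_ : 2 * 2^-1 * y = y); last by lra.
  apply/andP; split; last by apply: psi_lt; nra.
  rewrite kap_le_half// in h; have by0 := beta_gt0 y0.
  have byy := beta_le yh.
  have [->|yn] := eqVneq y 2^-1.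
    by rewrite -[ltRHS]psi_half; apply: psi_lt => //; nra.
  apply: le_lt_trans (psi_beta _); last by rewrite y0 lt_neqAle yn.
  by apply: psi_le; nra.
rewrite mhr ?(ltW yh)// mhl; last by lra.
rewrite (_ : 2 * 2^-1 * 2^-1 = 2^-1); last by lra.
apply/andP; split; last by apply: psi_lt; nra.
by rewrite -[ltRHS]psi_half; apply: psi_lt => //; nra.
Qed.

(* Near [y = 1/2] the two bounds [lam] and [psi \o lam \o flip] trade roles
   according to the size of [t]. *)
Lemma lyap_mid_le x y : square (x, y) -> (x, y) <> center -> y <= 2^-1 ->
  2 * x - 1 <= kap y <= 2 * x ->
  lyap (kap y, y / 4 + 3 / 4 * (2 * x - kap y)) < lyap (x, y).
Proof.
move=> sp pc yh h; have fE := bowen_mid h.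
have sfp : square (bowen (x, y)) by exact: bowen_square.
(* This settles the cases in which the old bound is the maximal value 1/2. *)
have fh : lyap (bowen (x, y)) < 2^-1.
  apply: lyap_lt_half => // fc; apply: pc; rewrite -(bowenK (x, y)) fc.
  by rewrite -{1}bowen_center bowenK.
rewrite fE in sfp fh.
have := sp => -[/= /andP[x0 x1] /andP[y0 y1]].
have ky := kap_le_half yh; have b0 := beta_gt0 y0; have by1 := beta_le yh.
move: h sfp fh {fE}; rewrite {}ky; set b := beta y in b0 by1 *.
move=> /andP[h1 h2] sfp fh.
set t := 2 * x - (1 - b) in sfp fh *.
set Y := y / 4 + 3 / 4 * t in sfp fh *.
have tE : x = (1 - b + t) / 2 by rewrite /t; lra.
have YE : Y = y / 4 + 3 / 4 * t by [].
have t0 : 0 <= t by rewrite /t; lra.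
have t1 : t <= 1 by rewrite /t; lra.
move: t Y tE YE t0 t1 sfp fh => t Y tE YE t0 t1 sfp fh.
case: sfp => /= _ /andP[Y0 Y1].
rewrite {2}/lyap lt_min; apply/andP; split.
  rewrite /lam/= (mhl yh).
  (* The split is at x = 1/2. On the right of it the new [psi] bound is compared by [psi_beta]; on
     the left the new [lam] is at most Y. *)
  have [tb|tb] := leP b t.
    rewrite (@mhr x); last by lra.
    rewrite (_ : 2 * 2^-1 * y = y); last by lra.
    move: yh; rewrite le_eqVlt => /predU1P[->//|yh].
    apply: le_lt_trans (psi_beta _); last by rewrite y0.
    apply: le_trans (lyap_le_psi _) _; apply: psi_le; last by rewrite -/b; lra.
    rewrite /lam/= subKr (@mhl b); last by lra.
    have := mh_le_half (1 - Y); rewrite -/b; set q := mh _ => qh; nra.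
  rewrite (@mhl x); last by lra.
  apply: (@le_lt_trans _ _ Y).
    apply: le_trans (lyap_le_lam _) _; rewrite /lam/= mhr; last by lra.
    by have := mh_le Y; lra.
  rewrite YE tE.
  have : t * (3 / 4 - y) < y * (3 / 4 - b) by nra.
  by lra.
rewrite /lam/= (@mhr (1 - y)); last by lra.
have [bt|bt] := leP 1 (b + (1 - t)).
  rewrite (@mhr (1 - x)); last by lra.
  by rewrite (_ : 2 * 2^-1 * 2^-1 = 2^-1) ?psi_half//; lra.
rewrite (@mhl (1 - x)); last by lra.
rewrite (_ : 2 * (1 - x) * 2^-1 = 1 - x); last by lra.
apply: le_lt_trans (lyap_le_psi _) _; apply: psi_lt; last by lra.
rewrite /lam/= subKr (@mhl b); last by lra.
have [tb|tb] := leP (1 - t) b; last first.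
  by have := mh_le_half (1 - Y); set q := mh _ => qh; nra.
apply: (@le_lt_trans _ _ (2 * b * (1 - Y))).
  by rewrite ler_pM2l ?mh_le//; lra.
have [b3|b3] := leP b 3^-1.
  have : (1 - t) * (3 * b - 1) <= 0 by nra.
  by rewrite YE tE; nra.
(* Since b <= y, this suffices for 2 b (1 - Y) < 1 - x. *)
suff : (1 - t) * (3 * b - 1) < b * b by rewrite YE tE; nra.
by have [sb|sb] := ltP (1 - t) b; nra.
Qed.

Lemma lyap_mid_ge x y : square (x, y) -> (x, y) <> center -> 2^-1 <= y ->
  2 * x - 1 <= kap y <= 2 * x ->
  lyap (kap y, y / 4 + 3 / 4 * (2 * x - kap y)) < lyap (x, y).
Proof.
move=> sp pc yh h; have fE := bowen_mid h.
have sfp : square (bowen (x, y)) by exact: bowen_square.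
have fh : lyap (bowen (x, y)) < 2^-1.
  apply: lyap_lt_half => // fc; apply: pc; rewrite -(bowenK (x, y)) fc.
  by rewrite -{1}bowen_center bowenK.
rewrite fE in sfp fh.
have := sp => -[/= /andP[x0 x1] /andP[y0 y1]].
have ky := kap_ge_half yh.
have [v vE] : exists v, v = 1 - y by exists (1 - y).
have yE : y = 1 - v by lra.
have v0 : 0 < v <= 2^-1 by apply/andP; split; lra.
have a0 := alpha_gt0 v0; have /andP[v1 v2] := v0; have ah := alpha_le_half v2.
move: h sfp fh {fE}; rewrite {}ky -vE; set a := alpha v in a0 ah *.
move=> /andP[h1 h2] sfp fh.
set t := 2 * x - a in sfp fh *.
set Y := y / 4 + 3 / 4 * t in sfp fh *.
have tE : x = (a + t) / 2 by rewrite /t; lra.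
have YE : Y = y / 4 + 3 / 4 * t by [].
have t0 : 0 <= t by rewrite /t; lra.
have t1 : t <= 1 by rewrite /t; lra.
move: t Y tE YE t0 t1 sfp fh => t Y tE YE t0 t1 sfp fh.
case: sfp => /= _ /andP[Y0 Y1].
have la : lyap (a, Y) <= 2 * a * mh Y.
  by apply: le_trans (lyap_le_lam _) _; rewrite /lam/= (mhl ah).
have la' : lyap (a, Y) <= a.
  by apply: le_trans la _; have := mh_le_half Y; set q := mh _ => qh; nra.
have veq : v = 2^-1 \/ 0 < v < 2^-1.
  by move: v2; rewrite le_eqVlt v1 => /predU1P[]; [left|right].
rewrite {2}/lyap lt_min; apply/andP; split.
  rewrite /lam/= (mhr yh).
  have [at1|at1] := leP 1 (a + t).
    rewrite (@mhr x); last by lra.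
    by rewrite (_ : 2 * 2^-1 * 2^-1 = 2^-1)//; lra.
  rewrite (@mhl x); last by lra.
  rewrite (_ : 2 * x * 2^-1 = x); last by lra.
  have [ta|ta] := leP t a; last by lra.
  apply: le_lt_trans la _.
  apply: (@le_lt_trans _ _ (2 * a * Y)); first by rewrite ler_pM2l ?mh_le//; lra.
  (* This is 2 a Y < x. If a > 1/3 and v < 1/2, it follows from t <= a and 3 a - 1 < v. *)
  suff : t * (3 * a - 1) < a * v by rewrite YE tE yE; nra.
  have [a3|a3] := leP a 3^-1.
    apply: (@le_lt_trans _ _ 0); first by nra.
    by rewrite mulr_gt0.
  case: veq => [vh|/alpha_third]; last first.
    rewrite -/a => a3'; have : a * (3 * a - 1) < a * v by rewrite ltr_pM2l//; lra.
    have : t * (3 * a - 1) <= a * (3 * a - 1) by rewrite ler_pM2r//; lra.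
    lra.
  by move: (ah) at1 ta a3; rewrite /a vh alpha_half => *; nra.
rewrite /lam/= -vE (mhl v2).
have [at1|at1] := leP a (1 - t).
  rewrite (@mhr (1 - x)); last by lra.
  rewrite (_ : 2 * 2^-1 * v = v); last by lra.
  case: veq => [->|/alpha_psi]; first by rewrite psi_half.
  exact: le_lt_trans.
rewrite (@mhl (1 - x)); last by lra.
have uh : 2 * (1 - x) * v <= 2^-1 by nra.
(* If a <= v, the new [psi] bound is small enough. Otherwise the new [lam] is at most a <=
   [psi (v / 2)], and a < 1/2 gives x < 3/4, so that v/2 < 2 (1 - x) v. *)
have [av|[av ah']] : a <= v \/ a <= psi (v / 2) /\ a < 2^-1.
  case: veq => [vh|/andP[_ vh]]; first by left; rewrite /a vh alpha_half.
  case: (alpha_alt v0) => av; [by left|right; split=> //].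
  by rewrite -alpha_half; exact: alpha_lt.
  apply: le_lt_trans (lyap_le_psi _) _; apply: psi_lt => //.
  rewrite /lam/= (@mhr (1 - a)); last by lra.
  apply: (@le_lt_trans _ _ (1 - Y)); first by have := mh_le (1 - Y); lra.
  rewrite YE tE yE.
  have : (1 - t) * (3 / 4 - v) < v * (3 / 4 - a) by nra.
  by nra.
apply: le_lt_trans la' _; apply: (le_lt_trans av); apply: psi_lt => //.
rewrite mulrC ltr_pM2r//.
by rewrite tE; lra.
Qed.

Lemma lyap_lt p : square p -> p <> center -> lyap (bowen p) < lyap p.
Proof.
case: p => x y sp pc; case: (bowen_cases x y) => h.
- by rewrite bowen_low// lyap_low.
- by rewrite bowen_up// lyap_up.
- rewrite bowen_mid//; have [yh|yh] := leP y 2^-1; first exact: lyap_mid_le.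
  by apply: lyap_mid_ge => //; exact: ltW.
Qed.

End Lyapunov.

(** * The Euclidean plane and its null sets *)

Section Surface.
Context {R : realType}.

Lemma derive_cst0 {E F : normedModType R} (v : E) (a : F) : 'D_v (cst a : E -> F) = cst 0.
Proof. by apply/funext => p; rewrite derive_cst. Qed.

Lemma smooth_cst {E F : normedModType R} (D : set E) (a : F) : smooth D (cst a : E -> F).
Proof.
move=> k; elim: k a => [|k IHk] a /=; first by move=> p _; exact: cst_continuous.
split=> [p _|v]; first exact: differentiable_cst.
by rewrite derive_cst0; exact: IHk.
Qed.

Lemma smooth_id {E : normedModType R} (D : set E) : smooth D (id : E -> E).
Proof.
case=> [|k] /=; first by move=> p _; exact: cvg_id.
split=> [p _|v]; first exact: ex_diff.
have -> : 'D_v (id : E -> E) = cst v.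
  by apply/funext => p; rewrite derive_id.
exact: smooth_cst.
Qed.

Lemma open_setX (T U : topologicalType) (A : set T) (B : set U) :
  open A -> open B -> open (A `*` B).
Proof.
move=> oA oB; rewrite (_ : A `*` B = fst @^-1` A `&` snd @^-1` B)//.
by apply: openI; apply: open_comp => // x _; [exact: cvg_fst|exact: cvg_snd].
Qed.

Definition box (q : (rat * rat) * (rat * rat)) : set (plane R) :=
  (`]ratr q.1.1, ratr q.1.2[ `*` `]ratr q.2.1, ratr q.2.2[)%classic.

Lemma box_open q : open (box q).
Proof. by apply: open_setX; exact: interval_open. Qed.

Lemma box_nbhs (p : plane R) (U : set (plane R)) : nbhs p U ->
  exists q, box q p /\ box q `<=` U.
Proof.
case: p => x y /nbhs_ballP[e/= e0 eU].
have [a /=] := @rat_in_itvoo R (x - e) x ltac:(lra).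
have [b /=] := @rat_in_itvoo R x (x + e) ltac:(lra).
have [c /=] := @rat_in_itvoo R (y - e) y ltac:(lra).
have [d /=] := @rat_in_itvoo R y (y + e) ltac:(lra).
rewrite !in_itv/= => /andP[d1 d2] /andP[c1 c2] /andP[b1 b2] /andP[a1 a2].
exists ((a, b), (c, d)); split.
  by split; rewrite /= in_itv/=; apply/andP.
move=> [x' y'] [/=]; rewrite !in_itv/= => /andP[x1 x2] /andP[y1 y2].
apply: eU; split => /=; rewrite /ball/= ltr_norml; apply/andP; split; lra.
Qed.

Lemma plane_second_countable : @second_countable (plane R).
Proof.
exists (range box).
  by apply: sub_countable (card_image_le _ _) _; exact: countableP.
split=> [_ [q _ <-]|p U /box_nbhs[q [qp qU]]]; first exact: box_open.
by exists (box q).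
Qed.

Lemma plane_hausdorff : hausdorff_space (plane R).
Proof. exact: norm_hausdorff. Qed.

Definition plane_space : ptopologicalType :=
  HB.pack_for ptopologicalType (R * R)%type
    (Pointed.on (R * R)%type) (Topological.on (R * R)%type).

Definition plane_chart : chart R plane_space.
Proof.
refine (@Chart R plane_space setT id id _ _ _ _ _) => //.
- exact: openT.
- by rewrite image_id; exact: openT.
- by apply: continuous_subspaceT => x; exact: cvg_id.
- by apply: continuous_subspaceT => x; exact: cvg_id.
Defined.

Definition euclid (c : chart R plane_space) (p u v : plane R) : R :=
  u.1 * v.1 + u.2 * v.2.

Definition euclidean_plane : riemannianSurface R.
Proof.
refine (@RiemannianSurface R plane_space plane_hausdorff plane_second_countable
  [set plane_chart] _ _ euclid _ _ _ _ _).
- by move=> x; exists plane_chart.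
- by move=> _ _ -> ->; exact: smooth_id.
- move=> c p _ _ a u u' v; rewrite /euclid.
  have -> : (a *: u + u').1 = a * u.1 + u'.1 by [].
  have -> : (a *: u + u').2 = a * u.2 + u'.2 by [].
  by ring.
- by move=> c p _ _ u v; rewrite /euclid/= mulrC (mulrC u.2).
- move=> c p _ _ [a b] ab0; rewrite /euclid/= -!expr2.
  rewrite lt_neqAle addr_ge0 ?sqr_ge0// andbT eq_sym.
  rewrite paddr_eq0 ?sqr_ge0// !sqrf_eq0.
  by apply: contra ab0 => /andP[/eqP-> /eqP->].
- by move=> c _ u v; exact: smooth_cst.
- move=> _ _ p -> -> _ u v.
  rewrite (_ : transition _ _ = id)//.
  have -> : 'd (id : plane R -> plane R) p = id :> (plane R -> plane R).
    exact: diff_val.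
  by [].
Defined.

Lemma open_measurable_plane (U : set (plane R)) :
  open U -> measurable (U : set (R * R)).
Proof.
move=> oU; pose I := [set q | box q `<=` U].
have -> : U = \bigcup_(q in I) box q.
  apply/seteqP; split=> [p Up|p [q qU qp]]; last exact: qU.
  have [q [qp qU]] := @box_nbhs p U (open_nbhs_nbhs (conj oU Up)).
  by exists q.
rewrite bigcup_mkcond; apply: countable_bigcupT_measurable => // q.
by case: ifP => // _; apply: measurableX; exact: measurable_itv.
Qed.

(** Two sigma-algebras meet here: that of the topology, in which the statement is phrased, and the
    product one, on which area is defined. Rational boxes show that the first is contained in the
    second, so the volume is a pushforward by the identity. *)
Lemma id_measurable_borel :
  measurable_fun setT (id : (R * R)%type -> borel plane_space).
Proof.
suff : @measurable _ (borel plane_space) `<=`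
       (@measurable _ (R * R)%type : set (set (R * R))).
  by move=> h _ Y mY; rewrite setTI; exact: h.
apply: smallest_sub; last exact: open_measurable_plane.
split; first exact: measurable0.
  by move=> A mA; rewrite setTD; exact: measurableC.
by move=> F mF; exact: bigcup_measurable.
Qed.

Lemma borel_measurable (A : set (borel plane_space)) :
  measurable A -> measurable (A : set (R * R)).
Proof.
by move=> mA; have := id_measurable_borel measurableT mA; rewrite setTI.
Qed.

Definition area : set (R * R) -> \bar R :=
  (@lebesgue_measure R \x @lebesgue_measure R)%E.

Definition plane_volume : {measure set (borel euclidean_plane) -> \bar R} :=
  measure_function_pushforward__canonical__measure_function_Measure
    (@lebesgue_measure R \x @lebesgue_measure R)%E id_measurable_borel.

Lemma plane_volumeE A : plane_volume A = area A.
Proof. by []. Qed.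

End Surface.

(** * Lipschitz images of null sets of the line *)

Section NullSets.
Context {R : realType}.
Implicit Types (A B D : set R) (h : R -> R).
Local Notation mu := (@lebesgue_measure R).

(** Here A is arbitrary: as a function on all sets, [mu] is the outer measure. So images of null
    sets can be handled without proving them measurable. *)
Lemma null_cover A (e : R) : mu A = 0%E -> 0 < e ->
  exists F : nat -> R * R, A `<=` \bigcup_k `](F k).1, (F k).2[%classic /\
    (\sum_(0 <= k <oo) mu `](F k).1, (F k).2[%classic <= e%:E)%E.
Proof.
move=> A0 e0.
have A0' : ((wlength idfun)^* A)%mu = 0%E by rewrite -A0.
have [I_ [AI cI] Fe] : exists2 I_, open_itv_cover A I_ &
    (\sum_(0 <= k <oo) (@wlength R idfun) (I_ k) <= e%:E)%E.
  have : ((wlength idfun)^* A)%mu \is a fin_num by rewrite A0'.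
  rewrite outer_measure_open_itv_cover.
  move=> /lb_ereal_inf_adherent-/(_ _ e0)[_/= [F]] AF <- Fe.
  exists F => //; apply/ltW; apply: lt_le_trans Fe _.
  by rewrite -outer_measure_open_itv_cover A0' add0e.
have [F FE] := choice AI.
exists F; split.
  by move=> x /cI[k _ Ik]; exists k => //; rewrite -FE.
apply: le_trans Fe; apply: lee_nneseries => // k _.
by rewrite FE wlength_itv lebesgue_measure_itv.
Qed.

Definition lip_on D h := exists K : R, forall x y, D x -> D y ->
  `|h x - h y| <= K * `|x - y|.

(** As [h] is controlled on D only, each interval of the cover is measured from one of its points in
    A; its length is multiplied by at most 2 C. *)
Lemma lip_on_null D h A : lip_on D h -> A `<=` D -> mu A = 0%E ->
  mu (h @` A) = 0%E.
Proof.
move=> [K hK] AD A0; apply/eqP; rewrite eq_le measure_ge0 andbT.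
apply/lee_addgt0Pr => /= e e0; rewrite add0e.
(* A Lipschitz constant that is positive even if K is not. *)
pose C := `|K| + 1; have C0 : 0 < C by rewrite ltr_pwDr.
have KC : K <= C by rewrite (le_trans (ler_norm K))// lerDl.
have e0' : 0 < e / (2 * C) by rewrite divr_gt0// mulr_gt0.
have [F [AF Fe]] := null_cover A0 e0'.
pose I k := `](F k).1, (F k).2[%classic : set R.
have sub : h @` A `<=` \bigcup_k (h @` (A `&` I k)).
  move=> _ [x Ax <-]; have [k _ Ik] := AF x Ax.
  by exists k => //; exists x.
apply: le_trans (le_outer_measure mu _ _ sub) _.
apply: le_trans (outer_measure_sigma_subadditive mu _) _.
have Ik k : (mu (h @` (A `&` I k)) <= (2 * C)%:E * mu (I k))%E.
  have [->|/set0P[a [Aa Ia]]] := eqVneq (A `&` I k) set0.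
    by rewrite image_set0 measure0 mule_ge0// lee_fin mulr_ge0// ltW.
  have ab : (F k).1 < (F k).2.
    by move: Ia; rewrite /I/= in_itv/= => /andP[]; exact: lt_trans.
  set L := (F k).2 - (F k).1; have L0 : 0 < L by rewrite subr_gt0.
  have -> : mu (I k) = L%:E by rewrite /I lebesgue_measure_itv/= lte_fin ab.
  apply: (@le_trans _ _ (mu `[h a - C * L, h a + C * L]%classic)).
    apply: le_outer_measure => _ [x [Ax Ix] <-] /=; rewrite in_itv/=.
    have := hK x a (AD _ Ax) (AD _ Aa); rewrite -ler_distlC => H.
    rewrite distrC; apply: le_trans H _.
    have xL : `|x - a| <= L.
      move: Ix Ia; rewrite /I/= !in_itv/= ler_norml /L.
      by move=> /andP[? ?] /andP[? ?]; apply/andP; split; lra.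
    apply: (@le_trans _ _ (C * `|x - a|)); first by rewrite ler_wpM2r.
    by rewrite ler_pM2l.
  rewrite lebesgue_measure_itv/=; case: ifP => _; last first.
    by rewrite -EFinM lee_fin !mulr_ge0// ltW.
  by rewrite -EFinB -EFinM lee_fin; lra.
apply: (@le_trans _ _ (\sum_(0 <= k <oo) ((2 * C)%:E * mu (I k)))%E).
  by apply: lee_nneseries => [k _ _|k _]; [exact: measure_ge0|exact: Ik].
rewrite nneseriesZl//.
apply: (@le_trans _ _ ((2 * C)%:E * (e / (2 * C))%:E)%E).
  by rewrite lee_pmul2l// lte_fin mulr_gt0.
by rewrite -EFinM lee_fin mulrC divfK// gt_eqF// mulr_gt0.
Qed.

Lemma lip_on_sub D D' h : D `<=` D' -> lip_on D' h -> lip_on D h.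
Proof. by move=> DD [K hK]; exists K => x y /DD ? /DD ?; exact: hK. Qed.

Lemma lip_on_eq D h g : (forall x, D x -> g x = h x) -> lip_on D h -> lip_on D g.
Proof. by move=> gh [K hK]; exists K => x y Dx Dy; rewrite !gh//; exact: hK. Qed.

Lemma lip_on_affine D (a b : R) : lip_on D (fun x => a * x + b).
Proof.
exists `|a| => x y _ _.
by rewrite -normrM (_ : a * x + b - (a * y + b) = a * (x - y))//; ring.
Qed.

Lemma lip_on_ge0 D h : lip_on D h -> exists2 K, 0 <= K &
  forall x y, D x -> D y -> `|h x - h y| <= K * `|x - y|.
Proof.
move=> [K hK]; exists `|K| => // x y Dx Dy; apply: le_trans (hK x y Dx Dy) _.
by rewrite ler_wpM2r// ler_norm.
Qed.

Lemma lip_on_comp D E h g : (forall x, D x -> E (h x)) -> lip_on D h ->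
  lip_on E g -> lip_on D (g \o h).
Proof.
move=> DE [K hK] /lip_on_ge0[L L0 gL]; exists (L * K) => x y Dx Dy /=.
apply: le_trans (gL _ _ (DE _ Dx) (DE _ Dy)) _.
by rewrite -mulrA ler_wpM2l// hK.
Qed.

Lemma lip_on_max D h g : lip_on D h -> lip_on D g ->
  lip_on D (fun x => Num.max (h x) (g x)).
Proof.
move=> /lip_on_ge0[K K0 hK] /lip_on_ge0[L L0 gL]; exists (K + L) => x y Dx Dy.
have := hK x y Dx Dy; have := gL x y Dx Dy; rewrite !ler_norml => /andP[g1 g2] /andP[h1 h2].
have k0 : 0 <= K * `|x - y| by rewrite mulr_ge0.
have l0 : 0 <= L * `|x - y| by rewrite mulr_ge0.
rewrite mulrDl; case: (leP (h x) (g x)) => ?; case: (leP (h y) (g y)) => ?;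
  apply/andP; split; lra.
Qed.

Lemma lip_on_opp D h : lip_on D h -> lip_on D (fun x => - h x).
Proof. by move=> [K hK]; exists K => x y ? ?; rewrite -opprD normrN hK. Qed.

Lemma lip_on_min D h g : lip_on D h -> lip_on D g ->
  lip_on D (fun x => Num.min (h x) (g x)).
Proof.
move=> lh lg; apply: (@lip_on_eq _ (fun x => - Num.max (- h x) (- g x))).
  by move=> x _; rewrite oppr_max !opprK.
by apply/lip_on_opp/lip_on_max; exact: lip_on_opp.
Qed.

Lemma lip_on_inv (d : R) : 0 < d -> lip_on [set x | d <= x] (@GRing.inv R).
Proof.
move=> d0; exists (d^-1 * d^-1) => x y /= dx dy.
have x0 : 0 < x by apply: lt_le_trans dx.
have y0 : 0 < y by apply: lt_le_trans dy.
have -> : x^-1 - y^-1 = x^-1 * y^-1 * (y - x).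
  by field; rewrite !gt_eqF.
rewrite normrM distrC ler_wpM2r// gtr0_norm ?mulr_gt0 ?invr_gt0//.
by rewrite ler_pM ?lef_pV2 ?posrE// invr_ge0 ltW.
Qed.

Lemma lip_on_expR : lip_on [set x : R | x <= 0] expR.
Proof.
exists 1 => x y /= x0 y0; rewrite mul1r.
wlog xy : x y x0 y0 / x <= y.
  move=> W; have [/W|/ltW/W] := leP x y; first exact.
  by rewrite (distrC (expR x)) (distrC x); exact.
have := expR_ge1Dx (x - y); have := expR_le1 y; rewrite y0.
have := expR_gt0 y; have : expR x = expR y * expR (x - y).
  by rewrite -expRD addrC subrK.
rewrite (distrC (expR x)) ger0_norm ?subr_ge0 ?ler_expR// (distrC x) ger0_norm ?subr_ge0//.
move=> -> e0 e1 h; set E := expR y in e0 e1 *; set F := expR (x - y) in h *.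
by nra.
Qed.

Lemma lip_on_ln (d : R) : 0 < d -> lip_on [set x | d <= x] (@ln R).
Proof.
move=> d0; exists d^-1 => x y /= dx dy.
wlog xy : x y dx dy / x <= y.
  move=> W; have [/W|/ltW/W] := leP x y; first exact.
  by rewrite (distrC (ln x)) (distrC x); exact.
have x0 : 0 < x by apply: lt_le_trans dx.
have y0 : 0 < y by apply: lt_le_trans dy.
rewrite (distrC (ln x)) ger0_norm ?subr_ge0 ?ler_ln ?posrE//.
rewrite (distrC x) ger0_norm ?subr_ge0//.
rewrite -ln_div ?posrE//.
have := @le_ln1Dx R (y / x - 1); rewrite addrCA subrr addr0.
have yx : 0 < y / x by rewrite divr_gt0.
move=> /(_ ltac:(lra)) h; apply: le_trans h _.
rewrite -[X in _ - X](divff (lt0r_neq0 x0)) -mulrBl mulrC.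
by rewrite ler_wpM2r ?subr_ge0// lef_pV2 ?posrE.
Qed.

Lemma lip_on_expo (c d : R) : 0 < c -> 0 < d ->
  lip_on [set x | d <= x <= 2^-1] (expo c).
Proof.
move=> c0 d0.
apply: (@lip_on_eq _ (fun x => 2^-1 * expR (- c * x^-1 + c * 2) + 0)).
  move=> x /= /andP[dx _]; rewrite /expo leNgt (lt_le_trans d0)//=.
  rewrite addr0 mulrC; congr (_ * expR _); lra.
apply: (@lip_on_comp _ setT _ (fun z => 2^-1 * z + 0)) => //; last exact: lip_on_affine.
apply: (@lip_on_comp _ [set x | x <= 0] (fun x => - c * x^-1 + c * 2)).
- move=> x /= /andP[dx xh]; have x0 : 0 < x by apply: lt_le_trans dx.
  have : 2 <= x^-1 by rewrite -(invrK 2) lef_pV2 ?posrE.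
  by nra.
- apply: (@lip_on_comp _ setT _ (fun z => - c * z + c * 2)) => //; last exact: lip_on_affine.
  by apply: lip_on_sub (lip_on_inv d0) => x /= /andP[].
- exact: lip_on_expR.
Qed.

Lemma lip_on_logo (c d : R) : 0 < c -> 0 < d ->
  lip_on [set x | d <= x <= 2^-1] (logo c).
Proof.
move=> c0 d0.
apply: (@lip_on_eq _ (fun x => (- c^-1 * ln (2 * x + 0) + 2)^-1)).
  move=> x /= /andP[dx _]; rewrite /logo leNgt (lt_le_trans d0)//=.
  by rewrite addr0; congr (_^-1); lra.
apply: (@lip_on_comp _ [set x | 2 <= x] (fun x => - c^-1 * ln (2 * x + 0) + 2)).
- move=> x /= /andP[dx xh]; have x0 : 0 < x by apply: lt_le_trans dx.
  have : ln (2 * x + 0) <= 0 by apply: ln_le0; lra.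
  have : 0 < c^-1 by rewrite invr_gt0.
  by nra.
- apply: (@lip_on_comp _ setT _ (fun z => - c^-1 * z + 2)) => //; last exact: lip_on_affine.
  apply: (@lip_on_comp _ [set x | 2 * d <= x] (fun x => 2 * x + 0)).
  + by move=> x /= /andP[dx _]; lra.
  + exact: lip_on_affine.
  + by apply: lip_on_ln; lra.
- exact: lip_on_inv.
Qed.

End NullSets.

(** * Null sets of the plane, by sections *)

Section Nonsingular.
Context {R : realType}.
Local Notation mu := (@lebesgue_measure R).

Lemma outer_subset0 (A B : set R) : A `<=` B -> mu B = 0%E -> mu A = 0%E.
Proof.
move=> AB B0; apply/eqP; rewrite eq_le measure_ge0 andbT -B0.
exact: le_outer_measure.
Qed.

Lemma outer_bigcup0 (A : nat -> set R) : (forall n, mu (A n) = 0%E) ->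
  mu (\bigcup_n A n) = 0%E.
Proof.
move=> A0; apply/eqP; rewrite eq_le measure_ge0 andbT.
apply: le_trans (outer_measure_sigma_subadditive mu _) _.
by rewrite eseries0// => n _ _; exact: A0.
Qed.

Lemma image_null_cover (D : nat -> set R) (h : R -> R) (A : set R) :
  (forall n, lip_on (D n) h) -> (forall x, exists n, D n x) ->
  mu A = 0%E -> mu (h @` A) = 0%E.
Proof.
move=> lD cD A0; apply: (@outer_subset0 _ (\bigcup_n (h @` (A `&` D n)))).
  by move=> _ [x Ax <-]; have [n Dnx] := cD x; exists n => //; exists x.
apply: outer_bigcup0 => n; apply: lip_on_null (lD n) _ _; first by move=> x [].
by apply: outer_subset0 A0 => x [].
Qed.

(* The pieces within the open unit interval stay away from its ends, where
   [logo] prevents [kap] or [kapi] from being Lipschitz. *)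
Definition glue_piece (n : nat) : set R := match n with
  | 0 => [set y | y <= 0]
  | 1 => [set y | 1 <= y]
  | n'.+2 => if odd n' then [set y | n'.+1%:R^-1 <= y <= 2^-1]
             else [set y | n'.+1%:R^-1 <= 1 - y <= 2^-1]
  end.

Lemma glue_piece_cover (y : R) : exists n, glue_piece n y.
Proof.
(* Doubling an index that is large enough makes its inverse only smaller, and leaves the parity
   free; the parity selects the half of the interval. *)
have small (z : R) (b : bool) : 0 < z -> exists n, odd n = b /\ n.+1%:R^-1 <= z.
  move=> z0; have [n _ /= nz] := near_infty_natSinv_lt (PosNum z0).
  exists (n.*2 + b)%N; split; first by rewrite oddD odd_double; case: b.
  apply/ltW; have := nz (n.*2 + b)%N; apply => /=.
  by rewrite -addnn -addnA leq_addr.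
have [y0|y0] := leP y 0; first by exists 0%N.
have [y1|y1] := leP 1 y; first by exists 1%N.
have [yh|yh] := leP y 2^-1.
  have [n [on nz]] := small _ true y0.
  by exists n.+2; rewrite /= on; apply/andP.
have [n [on nz]] := small (1 - y) false ltac:(lra).
by exists n.+2; rewrite /= on/= nz/=; lra.
Qed.

Lemma glue_lip (b a : R -> R) : b 2^-1 = 2^-1 -> a 2^-1 = 2^-1 ->
  (forall y, y <= 0 -> b y = y) -> (forall y, y <= 0 -> a y = y) ->
  (forall d, 0 < d -> lip_on [set y | d <= y <= 2^-1] b) ->
  (forall d, 0 < d -> lip_on [set y | d <= y <= 2^-1] a) ->
  forall n, lip_on (glue_piece n) (glue b a).
Proof.
move=> bh ah b0 a0 bl al.
have lin : forall D, lip_on D (fun y : R => -1 * y + 1).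
  by move=> D; exact: lip_on_affine.
move=> [|[|n]] /=.
- apply: lip_on_eq (lin _) => y /= y0; rewrite /glue b0// ifT; lra.
- apply: lip_on_eq (lin _) => y /= y1; rewrite /glue a0; last by lra.
  by rewrite ifF; [lra|apply/negbTE; rewrite -ltNge; lra].
- have n0 : 0 < n.+1%:R^-1 :> R by rewrite invr_gt0.
  move: (n.+1%:R^-1 : R) n0 => d n0; case: ifP => _.
    apply: (@lip_on_eq _ _ ((fun y => -1 * y + 1) \o b)).
      by move=> y /= /andP[_ yh]; rewrite /glue yh; lra.
    by apply: (@lip_on_comp _ _ setT) => //; exact: bl.
  apply: (@lip_on_eq _ _ (a \o (fun y => -1 * y + 1))).
    move=> y /= /andP[y1 y2]; rewrite /glue.
    have [yh|yh] := leP y 2^-1; last by congr a; lra.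
    have -> : y = 2^-1 by lra.
    by rewrite bh (_ : -1 * 2^-1 + 1 = 2^-1) ?ah; lra.
  apply: (@lip_on_comp _ _ [set y | d <= y <= 2^-1]); last exact: al.
    by move=> y /= /andP[? ?]; apply/andP; split; lra.
  exact: lin.
Qed.

Lemma lip_on_line (D : set R) : lip_on D (fun y => 2 * y - 2^-1).
Proof. exact: lip_on_affine. Qed.

Lemma lip_on_line' (D : set R) : lip_on D (fun y => (y + 2^-1) / 2).
Proof.
apply: (@lip_on_eq _ _ (fun y => 2^-1 * y + 2^-1 / 2)); last exact: lip_on_affine.
by move=> y _; lra.
Qed.

Lemma kap_image_null A : mu A = 0%E -> mu (kap @` A) = 0%E.
Proof.
apply: (image_null_cover _ glue_piece_cover); apply: glue_lip.
- exact: beta_half.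
- exact: alpha_half.
- exact: beta_le0.
- exact: alpha_le0.
- by move=> d d0; apply: lip_on_max; [exact: lip_on_line|exact: lip_on_expo].
- by move=> d d0; apply: lip_on_max; [exact: lip_on_line|exact: lip_on_logo].
Qed.

Lemma kapi_image_null A : mu A = 0%E -> mu (kapi @` A) = 0%E.
Proof.
apply: (image_null_cover _ glue_piece_cover); apply: glue_lip.
- exact: alphai_half.
- exact: betai_half.
- exact: alphai_le0.
- exact: betai_le0.
- by move=> d d0; apply: lip_on_min; [exact: lip_on_line'|exact: lip_on_expo].
- by move=> d d0; apply: lip_on_min; [exact: lip_on_line'|exact: lip_on_logo].
Qed.

Definition null_preserving (k : R -> R) :=
  forall A, mu A = 0%E -> mu (k @^-1` A) = 0%E.

Lemma kap_null_preserving : null_preserving kap.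
Proof.
move=> A /kapi_image_null; apply: outer_subset0 => y Ay.
by exists (kap y) => //; rewrite kapK.
Qed.

Lemma kapi_null_preserving : null_preserving kapi.
Proof.
move=> A /kap_image_null; apply: outer_subset0 => y Ay.
by exists (kapi y) => //; rewrite kapiK.
Qed.

Lemma affine_null_preserving (a b : R) : a != 0 ->
  null_preserving (fun y => a * y + b).
Proof.
move=> a0 A A0.
have := lip_on_null (@lip_on_affine R setT a^-1 (- (a^-1 * b))) (@subsetT _ A) A0.
apply: outer_subset0 => y /= Ay; exists (a * y + b) => //.
by rewrite mulrDr mulrA mulVf// mul1r addrK.
Qed.

(** Area is the integral of the measures of the sections, and a nonnegative integral vanishes
    exactly when the integrand vanishes almost everywhere. *)
Lemma area_null_sections (A : set (R * R)) : measurable A ->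
  area A = 0%E <-> mu [set x | mu (xsection A x) != 0%E] = 0%E.
Proof.
move=> mA.
have mf : measurable_fun setT (mu \o xsection A) by exact: measurable_fun_xsection.
have h := ae_eq_integral_abs mu measurableT mf.
have -> : area A = (\int[mu]_x `|(mu \o xsection A) x|)%E.
  by rewrite /area; apply: eq_integral => x _; rewrite gee0_abs.
rewrite h; split.
  move=> [N [mN N0 sN]]; apply: outer_subset0 N0 => x /= x0.
  by apply: sN => /= /(_ I) /eqP; rewrite (negbTE x0).
move=> Z0; exists [set x | mu (xsection A x) != 0%E]; split => //.
  have := emeasurable_neq measurableT mf 0%E.
  by rewrite setTI.
by move=> x /= /not_implyP[_ /eqP].
Qed.

Lemma continuous_borel (g : plane R -> plane R) (B : set (borel (@plane_space R))) :
  continuous g -> measurable B ->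
  measurable (g @^-1` B : set (borel (@plane_space R))).
Proof.
move=> gc; suff : @measurable _ (borel plane_space) `<=`
    [set B : set (borel plane_space) | measurable
       (g @^-1` B : set (borel (@plane_space R)))].
  by apply.
apply: smallest_sub.
  split => /=; first by rewrite preimage_set0; exact: measurable0.
    move=> A mA; rewrite setTD preimage_setC; exact: measurableC.
  by move=> F mF; rewrite preimage_bigcup; exact: bigcup_measurable.
move=> U oU; apply: sub_sigma_algebra.
by apply: open_comp => // p _; exact: gc.
Qed.

(** Tonelli's theorem, in the form of uniqueness of the product measure. *)
Lemma area_swap (A : set (R * R)) : measurable A -> area (swap @^-1` A) = area A.
Proof.
move=> mA; rewrite [RHS]/area.
have -> : (mu \x mu)%E A = (mu \x^ mu)%E A.
  by apply: product_measure_unique => //= *; rewrite product_measure2E.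
rewrite /area; apply: eq_integral => x _ /=; congr (mu _).
Qed.

Definition null_pulling (g : plane R -> plane R) :=
  forall B : set (borel (@plane_space R)), measurable B -> area B = 0%E ->
    area (g @^-1` B) = 0%E.

(** The section of the preimage over x is an affine preimage of the section over [k x], so the
    exceptional x lie in the preimage by [k] of a null set. *)
Lemma null_pulling_fiber (k c : R -> R) (a : R) : continuous k -> continuous c ->
  a != 0 -> null_preserving k ->
  null_pulling (fun p => (k p.1, a * p.2 + c p.1)).
Proof.
move=> kc cc a0 kn B mB B0; set g := fun p => _.
have gc : continuous g.
  apply: pair_continuous => p.
    by apply: (cvg_comp _ _ (@cvg_fst _ _ _ _ _)); exact: kc.
  apply: cvgD.
    by apply: cvgM; [exact: cvg_cst|exact: cvg_snd].
  by apply: (cvg_comp _ _ (@cvg_fst _ _ _ _ _)); exact: cc.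
have mgB := borel_measurable (continuous_borel gc mB).
apply/(area_null_sections mgB).
move/(area_null_sections (borel_measurable mB)) : B0 => /kn.
apply: outer_subset0 => x /=; apply: contraNneq => B0; apply/eqP.
have := @affine_null_preserving a (c x) a0 _ B0.
by apply: outer_subset0 => y; rewrite /xsection/= !inE.
Qed.

(* At each point, [eye] agrees with one of three maps fibred over a coordinate,
   and for these Fubini's theorem reduces the claim to [k]. *)
Lemma null_pulling_eye l m k : 1 < l -> 0 < m < 1 -> continuous k ->
  null_preserving k -> null_pulling (eye l m k).
Proof.
move=> l1 /andP[m0 m1] kc kn B mB B0.
have m0' : m != 0 by rewrite gt_eqF.
have l0 : l != 0 by rewrite gt_eqF//; lra.
have idc : continuous (fun x : R => l * x).
  by move=> x; apply: cvgM; [exact: cvg_cst|exact: cvg_id].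
pose g1 p : plane R := (l * p.1 + 0, m * p.2 + 0).
pose g2 p : plane R := (l * p.1 + - (l - 1), m * p.2 + (1 - m)).
(* The middle formula of [eye] is, for fixed y, affine in x with slope [a] and offset [c y]; hence
   [g3] takes the coordinates in exchanged order. *)
pose a := (1 - m) * (l / (l - 1)).
pose c y := m * y - (1 - m) / (l - 1) * k y.
pose g3 p : plane R := (k p.1, a * p.2 + c p.1).
have lc (b : R) : continuous (fun x => l * x + b).
  by move=> x; apply: cvgD; [exact: idc|exact: cvg_cst].
have cstc (b : R) : continuous (fun _ : R => b) by move=> x; exact: cvg_cst.
have n1 : null_pulling g1.
  apply: (@null_pulling_fiber (fun x => l * x + 0) (fun=> 0) m) => //; exact: affine_null_preserving.
have n2 : null_pulling g2.
  apply: (@null_pulling_fiber (fun x => l * x - (l - 1)) (fun=> 1 - m) m) => //; exact: affine_null_preserving.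
have cc : continuous c.
  move=> x; apply: cvgB; apply: cvgM;
    [exact: cvg_cst|exact: cvg_id|exact: cvg_cst|exact: kc].
have a0 : a != 0.
  by rewrite gt_eqF// mulr_gt0 ?divr_gt0//; lra.
have n3 : null_pulling g3 by exact: null_pulling_fiber.
have mg3 : measurable (g3 @^-1` B : set (R * R)).
  apply: borel_measurable; apply: continuous_borel => //.
  apply: pair_continuous => p.
    by apply: (cvg_comp _ _ (@cvg_fst _ _ _ _ _)); exact: kc.
  apply: cvgD.
    by apply: cvgM; [exact: cvg_cst|exact: cvg_snd].
  by apply: (cvg_comp _ _ (@cvg_fst _ _ _ _ _)); exact: cc.
have mg1 : measurable (g1 @^-1` B : set (R * R)).
  apply: borel_measurable; apply: continuous_borel => //.
  by apply: pair_continuous => p; apply: cvgD; try exact: cvg_cst; apply: cvgM;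
    (exact: cvg_cst || exact: cvg_fst || exact: cvg_snd).
have mg2 : measurable (g2 @^-1` B : set (R * R)).
  apply: borel_measurable; apply: continuous_borel => //.
  by apply: pair_continuous => p; apply: cvgD; try exact: cvg_cst; apply: cvgM;
    (exact: cvg_cst || exact: cvg_fst || exact: cvg_snd).
have ms : measurable (swap @^-1` (g3 @^-1` B) : set (R * R)).
  have -> : swap @^-1` (g3 @^-1` B) = (g3 \o swap) @^-1` B by [].
  apply: borel_measurable; apply: continuous_borel => //.
  move=> p; apply: continuous_comp; first exact: swap_continuous.
  apply: pair_continuous => {}p.
    by apply: (cvg_comp _ _ (@cvg_fst _ _ _ _ _)); exact: kc.
  apply: cvgD.
    by apply: cvgM; [exact: cvg_cst|exact: cvg_snd].
  by apply: (cvg_comp _ _ (@cvg_fst _ _ _ _ _)); exact: cc.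
have me : measurable (eye l m k @^-1` B : set (R * R)).
  by apply: borel_measurable; apply: continuous_borel => //; exact: eye_continuous.
have sub : eye l m k @^-1` B `<=`
    g1 @^-1` B `|` g2 @^-1` B `|` swap @^-1` (g3 @^-1` B).
  move=> [x y]; case: (eye_cases l k x y) => h; rewrite /preimage/=.
  - by rewrite eye_low// => Bxy; left; left; rewrite /g1/= !addr0.
  - by rewrite eye_up// => Bxy; left; right; rewrite /g2/=.
  - rewrite eye_mid// => Bxy; right; rewrite /g3/= /c /a.
    move: Bxy; congr (B (_, _)); field.
    by rewrite subr_eq0 gt_eqF.
apply/eqP; rewrite eq_le; apply/andP; split; last exact: measure_ge0.
have m12 : measurable (g1 @^-1` B `|` g2 @^-1` B : set (R * R)).
  exact: measurableU.
apply: (@le_trans _ _ (area (g1 @^-1` B `|` g2 @^-1` B `|` swap @^-1` (g3 @^-1` B)))).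
  by apply: le_measure; rewrite ?inE//; exact: measurableU.
rewrite /area measureU0//; last exact: etrans (area_swap mg3) (n3 B mB B0).
by rewrite measureU0//; [rewrite [X in (X <= _)%E](n1 B mB B0)|exact: n2].
Qed.

Lemma null_pulling_swap g : continuous g -> null_pulling g ->
  null_pulling (swap \o g \o swap).
Proof.
move=> gc ng B mB B0.
have -> : (swap \o g \o swap) @^-1` B = swap @^-1` (g @^-1` (swap @^-1` B)) by [].
have msB : measurable (swap @^-1` B : set (borel (@plane_space R))).
  by apply: continuous_borel => //; exact: swap_continuous.
have mg : measurable (g @^-1` (swap @^-1` B) : set (borel (@plane_space R))).
  exact: continuous_borel.
rewrite area_swap; last exact: borel_measurable.
by rewrite ng// area_swap//; exact: borel_measurable.
Qed.

Lemma plane_volume_is_volume : is_volume (@plane_volume R).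
Proof.
move=> _ A -> mA _; rewrite plane_volumeE.
have -> : plane_chart @` A = A by rewrite image_id.
rewrite (eq_integral (fun=> 1%E)); last first.
  move=> p _; rewrite /area_density; congr (_%:E).
  rewrite (_ : \matrix_(i, j) _ = 1%:M) ?det1 ?sqrtr1//.
  apply/matrixP => i j; rewrite !mxE /= /euclid /plane_basis/=.
  by case: i => -[|[|//]] ?; case: j => -[|[|//]] ?;
    rewrite /= ?(mulr0, mul0r, mulr1, addr0, add0r).
by rewrite integral_cst ?mul1e//; exact: borel_measurable.
Qed.

End Nonsingular.

(** * Local behaviour at the fixed points *)

Section LocallyAffine.
Context {R : realType}.
Context {E F : normedModType R}.
Implicit Types (h : E -> F) (A : {linear E -> F}) (p : E).

Definition affine_near h A p := continuous A /\
  \forall q \near p, h q = A q + (h p - A p).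

Lemma affine_near_diff h A p :
  affine_near h A p -> differentiable h p /\ 'd h p = A :> (E -> F).
Proof.
move=> [Ac hA].
have H : h \o shift p = cst (h p) + A +o_ 0 id.
  apply/eqaddoP => e e0; near=> q.
  have -> : (h \o shift p - (cst (h p) + A)) q = h (q + p) - (h p + A q) by [].
  have -> : h (q + p) = A (q + p) + (h p - A p).
    near: q; have := hA; rewrite (near_shift 0) /=.
    by apply: filterS => q /=; rewrite subr0 addrC.
  have -> : A (q + p) + (h p - A p) = h p + A q.
    by rewrite linearD -addrA (addrC (A p)) subrK addrC.
  rewrite subrr normr0.
  by rewrite mulr_ge0// ltW.
have dE := diff_unique Ac H; split => //.
by apply/diff_locallyP; rewrite dE.
Unshelve. all: by end_near. Qed.

Lemma affine_near_sub h A p : affine_near h A p ->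
  \forall q \near p, affine_near h A q.
Proof.
move=> [Ac hA]; near=> q; split => //.
have -> : h q - A q = h p - A p.
  have -> : h q = A q + (h p - A p) by near: q.
  by rewrite addrAC subrr add0r.
by near: q; exact: nbhs_interior.
Unshelve. all: by end_near. Qed.

(** Directional derivatives are locally constant. *)
Lemma affine_near_Ck1 (D : set E) h :
  (forall p, D p -> exists A, affine_near h A p) -> Ck 1 D h.
Proof.
move=> hD; split => [p /hD[A /affine_near_diff[]]//|v p /hD[A hA]].
have e q : affine_near h A q -> 'D_v h q = A v.
  by move=> /affine_near_diff[dh <-]; rewrite deriveE.
have eq1 : \forall q \near p, cst (A v) q = 'D_v h q.
  by apply: filterS (affine_near_sub hA) => q /e ->.
have H : 'D_v h q @[q --> p] --> 'D_v h p.
  rewrite (e p hA).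
  by apply: cvg_trans (near_eq_cvg eq1) _; exact: cvg_cst.
exact: H.
Qed.

End LocallyAffine.

Section AffineOn.
Context {R : realType}.
Context {E F : normedModType R}.

Lemma affine_on_near (O : set E) (h : E -> F) (A : {linear E -> F}) (c : F) :
  continuous A -> open O -> (forall q, O q -> h q = A q + c) ->
  forall p, O p -> affine_near h A p.
Proof.
move=> Ac oO hA p Op; split => //.
apply: filterS (open_nbhs_nbhs (conj oO Op)) => q Oq.
by rewrite !hA// addrAC subrr add0r.
Qed.

Lemma affine_on_inv (O : set E) (f : E -> F) (g : F -> E)
    (A : {linear E -> F}) (B : {linear F -> E}) (c : F) :
  continuous B -> cancel A B -> continuous g -> cancel f g -> cancel g f ->
  open O -> (forall q, O q -> f q = A q + c) ->
  forall p, (f @` O) p -> affine_near g B p.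
Proof.
move=> Bc AB gc fg gf oO fA p [q Oq fqp].
have H z : O (g z) -> g z = B z - B c.
  by move=> Oz; rewrite -{2}(gf z) fA// linearD AB addrK.
have Op : O (g p) by rewrite -fqp fg.
split => //; have : nbhs p (g @^-1` O).
  by apply: gc; exact: open_nbhs_nbhs.
by apply: filterS => z /H ->; rewrite H// addrAC subrr add0r.
Qed.

End AffineOn.

(** * Eigenvalues of the differentials *)

Section PlaneLinear.
Context {R : realType}.
Implicit Types (a b c d : R).

Definition lin2_fun a b c d (p : plane R) : plane R :=
  (a * p.1 + b * p.2, c * p.1 + d * p.2).

Fact lin2_linear a b c d : linear (lin2_fun a b c d).
Proof.
move=> k u v; rewrite /lin2_fun.
have -> : (k *: u + v).1 = k * u.1 + v.1 by [].
have -> : (k *: u + v).2 = k * u.2 + v.2 by [].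
rewrite [RHS](_ : _ = (k * (a * u.1 + b * u.2) + (a * v.1 + b * v.2),
  k * (c * u.1 + d * u.2) + (c * v.1 + d * v.2)))//.
by congr pair; ring.
Qed.

HB.instance Definition _ a b c d :=
  GRing.isLinear.Build R (plane R) (plane R) _ (lin2_fun a b c d)
    (lin2_linear a b c d).

Definition lin2 a b c d : {linear plane R -> plane R} := lin2_fun a b c d.

Lemma lin2_continuous a b c d : continuous (lin2 a b c d).
Proof.
by apply: pair_continuous => p; apply: cvgD; apply: cvgM;
  (exact: cvg_cst || exact: cvg_fst || exact: cvg_snd).
Qed.

Local Notation C := (real_complex R).

(** The rows of [plane_mx] are the images of the basis vectors, so the equation of a row eigenvector
    (x, y) is the usual one for the linear map. *)
Lemma spectrum_lin2 a b c d (z : R[i]) : spectrum (lin2 a b c d) z <->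
  exists x y : R[i], [/\ (x != 0) || (y != 0),
    z * x = x * C a + y * C b & z * y = x * C c + y * C d].
Proof.
have e00 : plane_mx (lin2 a b c d) 0 0 = a.
  by rewrite !mxE /plane_basis/= /plane_coord/= /lin2_fun/= mulr1 mulr0 addr0.
have e01 : plane_mx (lin2 a b c d) 0 1 = c.
  by rewrite !mxE /plane_basis/= /plane_coord/= /lin2_fun/= mulr1 mulr0 addr0.
have e10 : plane_mx (lin2 a b c d) 1 0 = b.
  by rewrite !mxE /plane_basis/= /plane_coord/= /lin2_fun/= mulr1 mulr0 add0r.
have e11 : plane_mx (lin2 a b c d) 1 1 = d.
  by rewrite !mxE /plane_basis/= /plane_coord/= /lin2_fun/= mulr1 mulr0 add0r.
have o1 : lift ord0 ord0 = 1 :> 'I_2 by apply/val_inj.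
have o0 : ord0 = 0 :> 'I_2 by apply/val_inj.
have vP (v : 'rV[R[i]]_2) : v *m map_mx C (plane_mx (lin2 a b c d)) =
    \row_j (if j == 0 then v 0 0 * C a + v 0 1 * C b
            else v 0 0 * C c + v 0 1 * C d).
  apply/rowP => j; rewrite mxE [RHS]mxE !big_ord_recl big_ord0 addr0 o1 o0.
  rewrite [X in _ * X + _]mxE [X in _ + _ * X]mxE.
  have [->|->] : j = 0 \/ j = 1.
    by case: j => -[|[|//]] ?; [left|right]; apply/val_inj.
  - by rewrite e00 e10.
  - by rewrite e01 e11.
rewrite /spectrum/=; split.
  move=> /eigenvalueP[v]; rewrite vP => /rowP vM v0; exists (v 0 0), (v 0 1); split.
  - apply: contraNT v0 => /norP[/negPn/eqP x0 /negPn/eqP y0].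
    apply/eqP/rowP => j; rewrite mxE.
    have [->|->] // : j = 0 \/ j = 1.
    by case: j => -[|[|//]] ?; [left|right]; apply/val_inj.
  - by have := vM 0; rewrite mxE [RHS]mxE/= => <-.
  - by have := vM 1; rewrite mxE [RHS]mxE/= => <-.
move=> [x [y [xy zx zy]]]; apply/eigenvalueP.
exists (\row_j if j == 0 then x else y); last first.
  apply: contraTneq xy => /rowP v0; rewrite negb_or !negbK.
  by have := v0 0; have := v0 1; rewrite !mxE/= => -> ->; rewrite eqxx.
rewrite vP; apply/rowP => j; rewrite !mxE/= -zx -zy.
by case: ifP.
Qed.

Lemma normC (a : R) : `|C a| = C `|a|.
Proof. by rewrite normc_def/= expr0n/= addr0 sqrtr_sqr. Qed.

Lemma saddle_diag : saddle (lin2 2 0 0 4^-1 : plane R -> plane R).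
Proof.
have sp z : spectrum (lin2 2 0 0 4^-1) z <-> z = C 2 \/ z = C 4^-1.
  rewrite spectrum_lin2; split.
    move=> [x [y []]]; rewrite !rmorph0 !mulr0 addr0 add0r.
    move=> /orP[x0|y0] zx zy.
      by left; apply: (mulIf x0); rewrite zx mulrC.
    by right; apply: (mulIf y0); rewrite zy mulrC.
  move=> [->|->]; [exists 1, 0|exists 0, 1]; split;
    by rewrite ?oner_eq0 ?eqxx ?orbT// ?rmorph0 ?mulr0 ?mul0r ?addr0 ?add0r ?mulr1 ?mul1r.
have n1 : 1 < `|C 2|.
  by rewrite normC ger0_norm// -(rmorph1 C) ltcR; lra.
have n2 : `|C 4^-1| < 1.
  by rewrite normC ger0_norm ?invr_ge0// -(rmorph1 C) ltcR; lra.
split.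
- by move=> z /sp[->|->]; [rewrite gt_eqF|rewrite lt_eqF].
- by exists (C 4^-1) => //; apply/sp; right.
- by exists (C 2) => //; apply/sp; left.
Qed.

(** The trace is 7/4 and the determinant 3, so z^2 - 7/4 z + 3 = 0; a root with |z| <= 1 would give
    3 <= 7/4 + 1. *)
Lemma source_spiral : source (lin2 0 (-2) (3 / 2) (7 / 4) : plane R -> plane R).
Proof.
move=> z /spectrum_lin2[x [y []]]; rewrite !rmorph0 !mulr0 add0r.
move=> xy zx zy.
have y0 : y != 0.
  apply: contraTneq xy => y0; rewrite y0 eqxx orbF negbK.
  move: zy; rewrite y0 mulr0 mul0r addr0 => /esym/eqP.
  rewrite mulf_eq0 => /orP[//|]; by rewrite fmorph_eq0 mulf_eq0 invr_eq0 !pnatr_eq0.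
have e : z * z * y = y * C (-2) * C (3 / 2) + z * y * C (7 / 4).
  by rewrite -[LHS]mulrA {1}zy mulrDr mulrA zx mulrA.
have e2 : C 3 = z * C (7 / 4) - z * z.
  apply: (mulIf y0); rewrite mulrBl e.
  have -> : C 3 = - (C (-2) * C (3 / 2)) by rewrite -rmorphM -rmorphN; congr C; lra.
  by ring.
rewrite real_ltNge//; apply/negP => z1.
have h74 : `|7 / 4 : R| = 7 / 4 by rewrite ger0_norm ?divr_ge0.
have : `|C 3| <= C (7 / 4) + 1.
  rewrite e2 (le_trans (ler_normB _ _))// lerD//.
    rewrite normrM normC h74.
    by rewrite ler_piMl// ler0c divr_ge0.
  by rewrite normrM mulr_ile1.
rewrite normC ger0_norm// -(rmorph1 C) -rmorphD lecR leNgt => /negP; apply.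
clear; lra.
Qed.

End PlaneLinear.

Section LocalBowen.
Context {R : realType}.

Definition bowen_inv : plane R -> plane R := swap \o eye 4 2^-1 kapi \o swap.

Lemma kap_continuous : continuous (@kap R).
Proof. exact: decreasing_continuous kap_lt kapiK. Qed.

Lemma kapi_continuous : continuous (@kapi R).
Proof. exact: decreasing_continuous kapi_lt kapK. Qed.

Lemma bowen_continuous : continuous (@bowen R).
Proof. exact: eye_continuous kap_continuous. Qed.

Lemma swap_conj_continuous (g : plane R -> plane R) : continuous g ->
  continuous (swap \o g \o swap).
Proof.
move=> gc p; apply: continuous_comp; first exact: swap_continuous.
by apply: continuous_comp; [exact: gc|exact: swap_continuous].
Qed.

Lemma bowen_inv_continuous : continuous bowen_inv.
Proof. exact/swap_conj_continuous/eye_continuous/kapi_continuous. Qed.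

Lemma bowen_invK : cancel bowen_inv (@bowen R).
Proof.
have h : cancel (eye 4 2^-1 (@kapi R)) (swap \o eye 2 4^-1 kap \o swap).
  have := @eyeK R 4 2^-1 kapi kap; rewrite invrK; apply.
  - by lra.
  - by apply/andP; split; lra.
  - exact: kapi_lt.
  - exact: kapiK.
  - exact: kapK.
move=> p; have e := congr1 swap (h (swap p)); rewrite /comp !swapK in e.
exact: e.
Qed.

Lemma bowen_null_pulling : null_pulling (@bowen R).
Proof.
apply: null_pulling_eye; [lra|apply/andP; split; lra|exact: kap_continuous|].
exact: kap_null_preserving.
Qed.

Lemma bowen_inv_null_pulling : null_pulling bowen_inv.
Proof.
apply: null_pulling_swap; first exact: eye_continuous kapi_continuous.
apply: null_pulling_eye; [lra|apply/andP; split; lra|exact: kapi_continuous|].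
exact: kapi_null_preserving.
Qed.

Lemma bowen_nonsing : nonsingular (@plane_volume R)
  (bowen : euclidean_plane -> euclidean_plane).
Proof.
move=> B mB; split => [h|]; last exact: bowen_null_pulling.
have mf : measurable (bowen @^-1` B : set (borel (@plane_space R))).
  by apply: continuous_borel => //; exact: bowen_continuous.
have := bowen_inv_null_pulling mf h.
have -> // : bowen_inv @^-1` (bowen @^-1` B) = B.
by apply/seteqP; split=> p /=; rewrite bowen_invK.
Qed.

Definition obox (a b c d : R) : set (plane R) :=
  `]a, b[%classic `*` `]c, d[%classic.

Definition cbox (a b c d : R) : set (plane R) :=
  `[a, b]%classic `*` `[c, d]%classic.

Lemma obox_open a b c d : open (obox a b c d).
Proof. by apply: open_setX; exact: interval_open. Qed.

Lemma cbox_compact a b c d : compact (cbox a b c d).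
Proof. by apply: compact_setX; exact: segment_compact. Qed.

Lemma oboxP a b c d x y : obox a b c d (x, y) <-> a < x < b /\ c < y < d.
Proof. by rewrite /obox /= !in_itv. Qed.

Lemma cboxP a b c d x y : cbox a b c d (x, y) <-> a <= x <= b /\ c <= y <= d.
Proof. by rewrite /cbox /= !in_itv. Qed.

Lemma cbox_nbhs a b c d (x y : R) : a < x < b -> c < y < d ->
  nbhs (x, y) (cbox a b c d).
Proof.
move=> xab ycd; apply: (@filterS _ _ _ (obox a b c d)); last first.
  by apply: open_nbhs_nbhs; split; [exact: obox_open|exact/oboxP].
move=> [x' y'] /oboxP[/andP[? ?] /andP[? ?]]; apply/cboxP.
by split; apply/andP; split; exact: ltW.
Qed.

(** At a saddle the size 1/4 keeps 2 x, respectively 2 x - 1, and [kap y] on opposite sides of 1/2.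
    The box at the centre stays in the middle case and in the range of [kap_affine]. *)
Definition near1 := obox (- 4^-1) 4^-1 (- 4^-1) 4^-1.
Definition near2 := obox (3 / 4) (5 / 4) (3 / 4) (5 / 4).
Definition near3 := obox (7 / 16) (9 / 16) (7 / 16) (9 / 16).

Lemma kap_gt_half (y : R) : y < 2^-1 -> 2^-1 < kap y.
Proof. by move=> yh; rewrite -[ltLHS]kap_half kap_lt. Qed.

Lemma kap_lt_half (y : R) : 2^-1 < y -> kap y < 2^-1.
Proof. by move=> yh; rewrite -[ltRHS]kap_half kap_lt. Qed.

Lemma bowen_near1 p : near1 p -> bowen p = lin2 2 0 0 4^-1 p + 0.
Proof.
case: p => x y /oboxP[/andP[? ?] /andP[? ?]].
have yh : y < 2^-1 by lra.
have ky := kap_gt_half yh.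
rewrite addr0 bowen_low; last by lra.
rewrite /lin2/= /lin2_fun/=; congr pair; lra.
Qed.

Lemma bowen_near2 p : near2 p -> bowen p = lin2 2 0 0 4^-1 p + (-1, 3 / 4).
Proof.
case: p => x y /oboxP[/andP[? ?] /andP[? ?]].
have yh : 2^-1 < y by lra.
have ky := kap_lt_half yh.
rewrite bowen_up; last by lra.
by congr pair => /=; lra.
Qed.

Lemma bowen_near3 p : near3 p ->
  bowen p = lin2 0 (-2) (3 / 2) (7 / 4) p + (3 / 2, - 9 / 8).
Proof.
case: p => x y /oboxP[/andP[? ?] /andP[? ?]].
have yh : 3^-1 <= y <= 5 / 8 by apply/andP; split; lra.
have ky := kap_affine yh.
rewrite bowen_mid ky; last by apply/andP; split; lra.
by congr pair => /=; lra.
Qed.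

Lemma bowen_affine p : (near1 `|` near2 `|` near3) p ->
  exists A, affine_near bowen A p.
Proof.
move=> [[p1|p2]|p3].
- exists (lin2 2 0 0 4^-1).
  by apply: (affine_on_near (O := near1) _ _ bowen_near1) => //;
    [exact: lin2_continuous|exact: obox_open].
- exists (lin2 2 0 0 4^-1).
  by apply: (affine_on_near (O := near2) _ _ bowen_near2) => //;
    [exact: lin2_continuous|exact: obox_open].
- exists (lin2 0 (-2) (3 / 2) (7 / 4)).
  by apply: (affine_on_near (O := near3) _ _ bowen_near3) => //;
    [exact: lin2_continuous|exact: obox_open].
Qed.

Lemma lin2_diagK : cancel (lin2 2 0 0 4^-1 : plane R -> plane R) (lin2 2^-1 0 0 4).
Proof. by move=> [x y]; rewrite /lin2/= /lin2_fun/=; congr pair; field. Qed.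

Lemma lin2_spiralK : cancel (lin2 0 (-2) (3 / 2) (7 / 4) : plane R -> plane R)
  (lin2 (7 / 12) (2 / 3) (- 2^-1) 0).
Proof. by move=> [x y]; rewrite /lin2/= /lin2_fun/=; congr pair; field. Qed.

Lemma bowen_inv_affine p : (bowen @` (near1 `|` near2 `|` near3)) p ->
  exists A, affine_near bowen_inv A p.
Proof.
move=> [q [[q1|q2]|q3] qp].
- exists (lin2 2^-1 0 0 4).
  apply: (affine_on_inv (O := near1) _ lin2_diagK bowen_inv_continuous bowenK bowen_invK
    _ bowen_near1); [exact: lin2_continuous|exact: obox_open|by exists q].
- exists (lin2 2^-1 0 0 4).
  apply: (affine_on_inv (O := near2) _ lin2_diagK bowen_inv_continuous bowenK bowen_invK
    _ bowen_near2); [exact: lin2_continuous|exact: obox_open|by exists q].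
- exists (lin2 (7 / 12) (2 / 3) (- 2^-1) 0).
  apply: (affine_on_inv (O := near3) _ lin2_spiralK bowen_inv_continuous bowenK bowen_invK
    _ bowen_near3); [exact: lin2_continuous|exact: obox_open|by exists q].
Qed.

Lemma C1_map_plane (O : set (plane R)) (f : plane R -> plane R) :
  (forall p, O p -> exists A, affine_near f A p) ->
  C1_map (O : set euclidean_plane) (f : euclidean_plane -> euclidean_plane).
Proof.
move=> hf c d -> ->; apply: affine_near_Ck1 => _ [q [[Oq _] _] <-].
exact: hf.
Qed.

Lemma bowen_local_diffeo : exists U1 U2 U3 : set (euclidean_plane : riemannianSurface R),
    [/\ [/\ compact U1, compact U2 & compact U3],
        [/\ nbhs ((0, 0) : plane R) U1, nbhs ((1, 1) : plane R) U2
          & nbhs (center : plane R) U3],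
        [/\ U1 `&` U2 = set0, U1 `&` U3 = set0 & U2 `&` U3 = set0]
      & diffeo_on (U1 `|` U2 `|` U3)
          (bowen : euclidean_plane -> euclidean_plane) bowen_inv].
Proof.
exists (cbox (- 8^-1) 8^-1 (- 8^-1) 8^-1), (cbox (7 / 8) (9 / 8) (7 / 8) (9 / 8)).
exists (cbox (15 / 32) (17 / 32) (15 / 32) (17 / 32)); split.
- by split; exact: cbox_compact.
- by split; apply: cbox_nbhs; apply/andP; split; lra.
- by split; rewrite -subset0 => -[x y] [/cboxP[/andP[? ?] _] /cboxP[/andP[? ?] _]];
    exfalso; lra.
- exists (near1 `|` near2 `|` near3); split.
  + by do 2?apply: openU; exact: obox_open.
  + move=> [x y] [[|]|] /cboxP[/andP[? ?] /andP[? ?]]; [left; left|left; right|right];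
      apply/oboxP; split; apply/andP; split; lra.
  + by apply: C1_map_plane; exact: bowen_affine.
  + by apply: C1_map_plane; exact: bowen_inv_affine.
Qed.

Lemma bowen_diff (O : set (plane R)) (A : {linear plane R -> plane R}) c p :
  continuous A -> open O -> (forall q, O q -> bowen q = A q + c) -> O p ->
  'd bowen p = A :> (plane R -> plane R).
Proof.
by move=> Ac oO hO Op; have [] := affine_near_diff (affine_on_near Ac oO hO Op).
Qed.

Lemma bowen_hyperbolic_points :
  [/\ saddle_at (bowen : euclidean_plane -> euclidean_plane) ((0, 0) : plane R),
      saddle_at (bowen : euclidean_plane -> euclidean_plane) ((1, 1) : plane R)
    & source_at (bowen : euclidean_plane -> euclidean_plane) (center : plane R)].
Proof.
split=> c -> _.
- have o : open (near1 : set (plane R)) by exact: obox_open.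
  have e := bowen_diff (@lin2_continuous R _ _ _ _) o bowen_near1.
  have {}e := e (0, 0) ltac:(apply/oboxP; split; apply/andP; split; lra).
  by have := saddle_diag (R := R); rewrite -e.
- have o : open (near2 : set (plane R)) by exact: obox_open.
  have e := bowen_diff (@lin2_continuous R _ _ _ _) o bowen_near2.
  have {}e := e (1, 1) ltac:(apply/oboxP; split; apply/andP; split; lra).
  by have := saddle_diag (R := R); rewrite -e.
- have o : open (near3 : set (plane R)) by exact: obox_open.
  have e := bowen_diff (@lin2_continuous R _ _ _ _) o bowen_near3.
  have {}e := e center ltac:(apply/oboxP; split; apply/andP; split; lra).
  by have := source_spiral (R := R); rewrite -e.
Qed.

Lemma bowen_fixed_points : [/\ bowen ((0, 0) : plane R) = (0, 0),
  bowen ((1, 1) : plane R) = (1, 1) & bowen (center : plane R) = center].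
Proof.
split; last exact: bowen_center.
- by rewrite bowen_low ?kap0; [congr pair; lra|lra].
- by rewrite bowen_up ?kap1; [congr pair; lra|lra].
Qed.

Lemma bowen_homeo_plane : homeomorphism
  (bowen : (euclidean_plane : riemannianSurface R) -> euclidean_plane) bowen_inv.
Proof.
split; [exact: bowen_continuous|exact: bowen_inv_continuous|exact: bowenK|].
exact: bowen_invK.
Qed.

End LocalBowen.

(** * Stable sets and heteroclinic connections *)

Section StableSets.
Context {R : realType}.
Local Notation M := (@euclidean_plane R).

Lemma shift_cvg (T : topologicalType) (u : nat -> T) (n : nat) (l : T) :
  u (i + n)%N @[i --> \oo] --> l -> u i @[i --> \oo] --> l.
Proof.
move=> h A /h[N _ HN]; exists (N + n)%N => // i /= Ni.
have ni : (n <= i)%N by apply: leq_trans Ni; rewrite leq_addl.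
by rewrite -(subnK ni); apply: HN => /=; rewrite leq_subRL// addnC.
Qed.

Section EyeStable.
Variables (l m : R) (k : R -> R).
Hypotheses (l1 : 1 < l) (m01 : 0 < m < 1) (kd : decreasing k) (kc : continuous k).
Hypotheses (k0 : k 0 = 1) (k1 : k 1 = 0).

Let f : plane R -> plane R := eye l m k.

Let kge0 y : (0 <= k y) = (y <= 1).
Proof. by rewrite -k1 decreasing_le. Qed.

Lemma iter_eye_axis n y : y <= 1 -> iter n f (0, y) = (0, m ^+ n * y) /\ m ^+ n * y <= 1.
Proof.
move=> y1; have /andP[m0 m1] := m01; elim: n => [|n [IH1 IH2]].
  by rewrite expr0 mul1r.
have e : f (0, m ^+ n * y) = (0, m ^+ n.+1 * y).
  by rewrite /f eye_low ?mulr0 ?kge0// exprS mulrA.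
rewrite iterS IH1 e; split => //.
by rewrite exprS -mulrA; nra.
Qed.

(** Each step along the top side multiplies the distance 1 - x by l, so the corner is passed after a
    bounded number of steps. *)
Lemma iter_eye_top N x : 0 <= x < 1 -> 1 <= l ^+ N * (1 - x) ->
  exists n y, y <= 1 /\ iter n f (x, 1) = (0, y).
Proof.
have l0 : 0 < l by exact: lt_trans l1.
elim: N x => [|N IH] x /andP[x0 x1] h.
  by exists 0%N, 1; split => //=; congr pair; move: h; rewrite expr0; lra.
have [xl|xl] := leP (l - 1) (l * x).
  have e : f (x, 1) = (l * x - (l - 1), 1).
    by rewrite /f eye_up ?k1 ?subr_ge0//; congr pair; lra.
  have [||n [y [y1 H]]] := IH (l * x - (l - 1)).
  - by rewrite subr_ge0 xl/=; nra.
  - by move: h; rewrite exprSr; congr (_ <= _); ring.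
  - by exists n.+1, y; split => //; rewrite iterSr e.
have := @eye_stable_line R l m k l1 m01 kd k1 (x, 1).
have e : f (x, 1) = (0, m * 1 + (1 - m) * ((l * x - 0) / (l - 1))).
  rewrite /f eye_mid ?k1//; apply/andP; split; first by lra.
  by rewrite mulr_ge0// ltW.
move=> [_ /(_ (or_intror (conj erefl _)))]; rewrite /= x0 x1 => /(_ isT).
rewrite -/f e; set Y := _ + _ => H; exists 1%N, Y; split; last exact: e.
by case: H => -[/= y1 y2] //; rewrite y1.
Qed.

(** An orbit tending to (0, 0) is eventually in [W], where the first coordinate is multiplied by l >
    1 at each step and must therefore vanish; invariance carries this back to the starting point.
    Conversely, the top side reaches the left side, on which the map is a contraction. *)
Lemma stable_set_eye : stable_set (f : M -> M) ((0, 0) : plane R) = stable_line.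
Proof.
have l0 : 0 < l by exact: lt_trans l1.
have back n p : stable_line (iter n f p) -> stable_line p.
  elim: n p => [//|n IH] p; rewrite iterSr => /IH.
  by move/(eye_stable_line l1 m01 kd k1).
apply/seteqP; split => p.
  rewrite /stable_set/= => cvp.
  (* On [W] the value 1/2 separates l x from [k y], which is the lower case of [eye]. *)
  pose W : set (plane R) := [set q | l * q.1 < 2^-1] `&` [set q | 2^-1 < k q.2].
  have WN : nbhs ((0, 0) : plane R) W.
    apply: open_nbhs_nbhs; split; last by split; rewrite /= ?mulr0 ?k0//; lra.
    apply: openI.
      apply: (@open_comp _ _ (fun q : plane R => l * q.1) [set z | z < 2^-1]).
        by move=> q _; apply: cvgM; [exact: cvg_cst|exact: cvg_fst].
      exact: open_lt.
    apply: (@open_comp _ _ (fun q : plane R => k q.2) [set z | 2^-1 < z]).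
      by move=> q _; apply: (cvg_comp _ _ (@cvg_snd _ _ _ _ _)); exact: kc.
    exact: open_gt.
  have [N _ HN] := cvp _ WN.
  have step q : W q -> f q = (l * q.1, m * q.2).
    by case: q => a b [/= h1 h2]; rewrite /f eye_low//; exact/ltW/(lt_trans h1).
  have xn n : (iter (n + N) f p).1 = l ^+ n * (iter N f p).1.
    elim: n => [|n IH]; first by rewrite expr0 mul1r.
    have Wn : W (iter (n + N) f p) by apply: HN; rewrite /= leq_addl.
    by rewrite addSn iterS step// IH exprS mulrA.
  have x0 : (iter N f p).1 = 0.
    apply/eqP; apply: contrapT => /negP x0.
    pose U : set (plane R) := [set q | `|q.1| < `|(iter N f p).1| ].
    have UN : nbhs ((0, 0) : plane R) U.
      apply: open_nbhs_nbhs; split; last by rewrite /U/= normr0 normr_gt0.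
      apply: (@open_comp _ _ (fun q : plane R => `|q.1|) [set z | z < `|(iter N f p).1| ]).
        move=> q _; apply: (cvg_comp _ _ (@cvg_fst _ _ _ _ _)).
        exact: norm_continuous.
      exact: open_lt.
    have [N' _ HN'] := cvp _ UN.
    have := HN' (N' + N)%N; rewrite /= leq_addr => /(_ isT).
    rewrite /U/= xn normrM ltNge => /negP; apply.
    rewrite ler_peMl//; apply: le_trans (ler_norm _).
    by rewrite exprn_ege1// ltW.
  apply: (back N); left; split => //.
  have [/= _ h] : W (iter N f p) by apply: HN => /=.
  by rewrite -kge0; lra.
have axis y : y <= 1 -> iter n f (0, y) @[n --> \oo] --> ((0, 0) : plane R).
  move=> y1; have -> : (fun n => iter n f (0, y)) = (fun n => (0, m ^+ n * y)).
    by apply/funext => n; have [-> _] := iter_eye_axis n y1.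
  apply: (@cvg_pair _ _ _ \oo (nbhs (0 : R)) (nbhs (0 : R))); first exact: cvg_cst.
  rewrite -[0 in X in _ --> X](mul0r y); apply: cvgM; last exact: cvg_cst.
  apply: cvg_expr; have /andP[m0 m1] := m01.
  by rewrite ger0_norm ?ltW.
case: p => x y [/= [-> y1]|/= [-> x01]]; first exact: axis.
have [N hN] : exists N, 1 <= l ^+ N * (1 - x).
  have /cvgrPdist_lt : (l^-1) ^+ n @[n --> \oo] --> (0 : R).
    by apply: cvg_expr; rewrite ger0_norm ?invf_lt1// invr_ge0 ltW.
  have x1 : 0 < 1 - x by case/andP: x01; rewrite subr_gt0.
  move=> /(_ _ x1)[N _ /(_ N (leqnn N))]/=; rewrite sub0r normrN => h.
  exists N; rewrite -ler_pdivrMl ?exprn_gt0// mulr1 -exprVn.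
  exact/ltW/(le_lt_trans (ler_norm _)).
have [n [y' [y1' e]]] := iter_eye_top x01 hN.
have e' : (fun i => iter (i + n) f (x, 1)) = (fun i => iter i f (0, y')).
  by apply/funext => i; rewrite iterD e.
have : iter (i + n) f (x, 1) @[i --> \oo] --> ((0, 0) : plane R).
  by rewrite e'; exact: axis.
exact: shift_cvg.
Qed.

End EyeStable.
End StableSets.

Section Branches.
Context {R : realType}.
Local Notation M := (@euclidean_plane R).
Implicit Types (s g : plane R -> plane R) (t : R).

Lemma stable_set_conj s g (x : plane R) : continuous s -> involutive s ->
  stable_set ((s \o g \o s) : M -> M) (s x) = s @` stable_set (g : M -> M) x.
Proof.
move=> sc sK.
have it n p : iter n (s \o g \o s) p = s (iter n g (s p)).
  by elim: n => [|n IH]; rewrite ?sK// !iterS IH /= sK.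
apply/seteqP; split => p.
  rewrite /stable_set/= => H; exists (s p); last by rewrite sK.
  have -> : (fun n => iter n g (s p)) = s \o (fun n => iter n (s \o g \o s) p).
    by apply/funext => n /=; rewrite it sK.
  rewrite -[x]sK; apply: cvg_comp H _; exact: sc.
move=> [q Hq <-]; rewrite /stable_set/=.
have -> : (fun n => iter n (s \o g \o s) (s q)) = s \o (fun n => iter n g q).
  by apply/funext => n /=; rewrite it sK.
by apply: cvg_comp Hq _; exact: sc.
Qed.

Definition branch : set (plane R) :=
  [set p | (p.1 = 0 /\ 0 <= p.2 <= 1) \/ (p.2 = 1 /\ 0 <= p.1 < 1)].

(** Goes up the left side at unit speed, turns at t = 1 and tends to (1, 1) along the top side at
    infinite time. *)
Definition branch_curve t : plane R := (1 - (Num.max t 1)^-1, Num.min t 1).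

(** One formula inverts both pieces of the curve, since on each of them the other summand equals
    1. *)
Definition branch_time (p : plane R) : R := p.2 + (1 - p.1)^-1 - 1.

Lemma branch_curveK : cancel branch_curve branch_time.
Proof.
move=> t; rewrite /branch_time /branch_curve/= subKr invrK.
by case: leP => ?; lra.
Qed.

Lemma branch_curve_lo t : t <= 1 -> branch_curve t = (0, t).
Proof. by move=> t1; rewrite /branch_curve max_r// min_l// invr1 subrr. Qed.

Lemma branch_curve_hi t : 1 <= t -> branch_curve t = (1 - t^-1, 1).
Proof. by move=> t1; rewrite /branch_curve max_l// min_r. Qed.

Lemma branch_curve_continuous : continuous branch_curve.
Proof.
apply: pair_continuous => t; last first.
  by apply: (@continuous_min _ _ id (fun=> 1)); [exact: cvg_id|exact: cvg_cst].
apply: cvgB; first exact: cvg_cst.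
apply: cvgV.
  by rewrite gt_eqF// lt_max ltr01 orbT.
by apply: (@continuous_max _ _ id (fun=> 1)); [exact: cvg_id|exact: cvg_cst].
Qed.

Lemma range_branch_curve : range branch_curve = stable_line.
Proof.
apply/seteqP; split => [_ [t _ <-]|[x y] [/= [-> y1]|/= [-> /andP[x0 x1]]]].
- have [t1|t1] := leP t 1; first by rewrite branch_curve_lo//; left.
  rewrite branch_curve_hi ?(ltW t1)//; right; split => //=.
  have : 0 < t^-1 by rewrite invr_gt0; lra.
  have : t^-1 <= 1 by rewrite invf_le1; lra.
  by move=> ? ?; apply/andP; split; lra.
- by exists y; rewrite // branch_curve_lo.
- exists (1 - x)^-1 => //; rewrite branch_curve_hi ?invrK ?subKr//.
  by rewrite invf_ge1; lra.
Qed.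

Lemma branch_curve_image : branch_curve @` `[0, +oo[ = branch.
Proof.
apply/seteqP; split => [_ [t + <-]|[x y] [/= [-> /andP[y0 y1]]|/= [-> /andP[x0 x1]]]].
- rewrite /= in_itv/= andbT => t0.
  have [t1|t1] := leP t 1.
    by rewrite branch_curve_lo//; left; rewrite /= t0.
  rewrite branch_curve_hi ?(ltW t1)//; right; split => //=.
  have : 0 < t^-1 by rewrite invr_gt0; lra.
  have : t^-1 <= 1 by rewrite invf_le1; lra.
  by move=> ? ?; apply/andP; split; lra.
- by exists y; [rewrite /= in_itv/= y0|rewrite branch_curve_lo].
- exists (1 - x)^-1.
    by rewrite /= in_itv/= andbT invr_ge0; lra.
  by rewrite branch_curve_hi ?invrK ?subKr// invf_ge1; lra.
Qed.

(** The four half-branches are images of one arc under symmetries of the square. The arc turns at t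
    = 1 but is a segment with velocity [v] for |t| < 1, whence the class C^1 near the saddle. *)
Lemma half_branch_conj s (v : plane R) : continuous s -> involutive s ->
  v != 0 -> (forall t, s (0, t) = s (0, 0) + t *: v) ->
  half_branch (s @` stable_line : set M) (s (0, 0)) (s @` branch : set M).
Proof.
move=> sc sK v0 sv; pose gam := s \o branch_curve.
exists gam; split.
- split.
  + move=> t; apply: continuous_comp; last exact: sc.
    exact: branch_curve_continuous.
  + by move=> t u /(inv_inj sK)/(can_inj branch_curveK).
  + by rewrite /gam/= branch_curve_lo.
- by rewrite -range_branch_curve image_comp.
- move=> c -> _; exists 1 => //.
  have loc p : `]- 1, 1[%classic p -> \forall q \near (p : R^o),
      (gam : R^o -> plane R) q = q *: v + s (0, 0).
    move=> p1; have : nbhs (p : R^o) (`]- 1, 1[%classic : set R).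
      by apply: open_nbhs_nbhs; split => //; exact: interval_open.
    apply: filterS => q /=; rewrite in_itv/= => /andP[_ q1].
    by rewrite /gam/= branch_curve_lo ?ltW// sv addrC.
  have sx_lin : linear ( *:%R ^~ v : R^o -> plane R).
    by move=> a y z; rewrite scalerDl scalerA.
  pose sxlM := GRing.isLinear.Build _ _ _ _ _ sx_lin.
  pose A : {linear R^o -> plane R} := HB.pack ( *:%R ^~ v : R^o -> plane R) sxlM.
  have aff p : `]- 1, 1[%classic p ->
      affine_near (gam : R^o -> plane R) A (p : R^o).
    move=> p1; split; first exact: scalel_continuous.
    have := loc p p1; apply: filterS => q ->.
    by rewrite (nbhs_singleton (loc p p1)) /= (addrC (p *: v)) addrK.
  split; first by apply: affine_near_Ck1 => p /aff ?; exists A.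
  move=> t /aff /affine_near_diff[dg dE].
  have -> : 'D_(1 : R^o) (gam : R^o -> plane R) t = v.
    by rewrite deriveE// dE /= scale1r.
  by [].
- by rewrite -branch_curve_image image_comp.
- exists (branch_time \o s); last first.
    by move=> t _; rewrite /gam/= sK branch_curveK.
  apply: continuous_in_subspaceT => p; rewrite inE => -[q qb <-].
  have q1 : q.1 < 1.
    by case: qb => -[]; [move=> -> _; exact: ltr01|move=> _ /andP[]].
  apply: continuous_comp; first exact: sc.
  rewrite sK; apply: cvgB; last exact: cvg_cst.
  apply: cvgD; first exact: cvg_snd.
  apply: cvgV; first by rewrite gt_eqF// subr_gt0.
  by apply: cvgB; [exact: cvg_cst|exact: cvg_fst].
Qed.

End Branches.

Section BowenEye.
Context {R : realType}.
Local Notation M := (@euclidean_plane R).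
Implicit Types (p : plane R).

Definition flip_swap_map p : plane R := flip (swap p).

Lemma flip_swap_mapK : involutive flip_swap_map.
Proof. by move=> [x y]; rewrite /flip_swap_map /flip /swap/= !subKr. Qed.

Lemma flip_swap_map_continuous : continuous flip_swap_map.
Proof.
by move=> p; apply: continuous_comp;
  [exact: swap_continuous|exact: flip_continuous].
Qed.

Lemma kflip_continuous (k : R -> R) : continuous k -> continuous (kflip k).
Proof.
move=> kc y; apply: cvgB; first exact: cvg_cst.
apply: (cvg_comp (fun x => 1 - x) k _ (kc (1 - y))).
by apply: cvgB; [exact: cvg_cst|exact: cvg_id].
Qed.

Lemma pair_continuous_at (T U W : topologicalType) (f : T -> U) (g : T -> W) x :
  {for x, continuous f} -> {for x, continuous g} ->
  {for x, continuous (fun x => (f x, g x))}.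
Proof. by move=> fc gc; apply: cvg_pair; [exact: fc|exact: gc]. Qed.

Lemma eye_flipE l m (k : R -> R) : 1 < l ->
  flip \o eye l m (kflip k) \o flip = eye l m k.
Proof. by move=> l1; apply/funext => p /=; rewrite eye_flip// flipK. Qed.

Lemma stable_bowen1 : stable_set (bowen : M -> M) ((0, 0) : plane R) = stable_line.
Proof.
apply: stable_set_eye.
- by lra.
- by apply/andP; split; lra.
- exact: kap_lt.
- exact: kap_continuous.
- exact: kap0.
- exact: kap1.
Qed.

Lemma stable_bowen2 : stable_set (bowen : M -> M) ((1, 1) : plane R) =
  flip @` stable_line.
Proof.
have -> : (1, 1) = flip (0, 0) :> plane R by rewrite /flip/= subr0.
have -> : bowen = flip \o eye 2 4^-1 (kflip (@kap R)) \o flip.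
  by rewrite eye_flipE//; lra.
rewrite stable_set_conj; [congr image|exact: flip_continuous|exact: flipK].
apply: stable_set_eye.
- by lra.
- by apply/andP; split; lra.
- exact/decreasing_kflip/kap_lt.
- exact/kflip_continuous/kap_continuous.
- by rewrite /kflip subr0 kap1 subr0.
- by rewrite /kflip subrr kap0 subrr.
Qed.

Lemma unstable_bowen1 : stable_set (bowen_inv : M -> M) ((0, 0) : plane R) =
  swap @` stable_line.
Proof.
have -> : (0, 0) = swap (0, 0) :> plane R by [].
rewrite stable_set_conj; [congr image|exact: swap_continuous|exact: swapK].
apply: stable_set_eye.
- by lra.
- by apply/andP; split; lra.
- exact: kapi_lt.
- exact: kapi_continuous.
- exact: kapi0.
- exact: kapi1.
Qed.

Lemma unstable_bowen2 : stable_set (bowen_inv : M -> M) ((1, 1) : plane R) =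
  flip_swap_map @` stable_line.
Proof.
have -> : (1, 1) = flip_swap_map (0, 0) :> plane R.
  by rewrite /flip_swap_map /flip/= subr0.
have -> : bowen_inv =
    flip_swap_map \o eye 4 2^-1 (kflip (@kapi R)) \o flip_swap_map.
  rewrite /bowen_inv -(@eye_flipE 4 2^-1 kapi); last by lra.
  by [].
rewrite stable_set_conj; [congr image|exact: flip_swap_map_continuous|
  exact: flip_swap_mapK].
apply: stable_set_eye.
- by lra.
- by apply/andP; split; lra.
- exact/decreasing_kflip/kapi_lt.
- exact/kflip_continuous/kapi_continuous.
- by rewrite /kflip subr0 kapi1 subr0.
- by rewrite /kflip subrr kapi0 subrr.
Qed.

Definition W1s : set (plane R) := branch.
Definition W1u : set (plane R) := swap @` branch.
Definition W2s : set (plane R) := flip @` branch.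
Definition W2u : set (plane R) := flip_swap_map @` branch.

Lemma image_involutive (T : Type) (s : T -> T) (A : set T) : involutive s ->
  s @` A = s @^-1` A.
Proof.
move=> sK; apply/seteqP; split => p /=; first by move=> [q Aq <-]; rewrite sK.
by exists (s p) => //; rewrite sK.
Qed.

Lemma pair_neq0 (a b : R) : (a != 0) || (b != 0) -> (a, b) != 0 :> plane R.
Proof.
by move=> ab; apply: contraL ab => /eqP[-> ->]; rewrite eqxx.
Qed.

Lemma bowen_half_branches :
  [/\ half_branch (stable_set (bowen : M -> M) ((0, 0) : plane R)) ((0, 0) : plane R) W1s,
      half_branch (stable_set (bowen_inv : M -> M) ((0, 0) : plane R)) ((0, 0) : plane R) W1u,
      half_branch (stable_set (bowen : M -> M) ((1, 1) : plane R)) ((1, 1) : plane R) W2s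
    & half_branch (stable_set (bowen_inv : M -> M) ((1, 1) : plane R)) ((1, 1) : plane R) W2u].
Proof.
rewrite stable_bowen1 stable_bowen2 unstable_bowen1 unstable_bowen2; split.
- have := @half_branch_conj R id (0, 1); rewrite !image_id; apply.
  + by move=> p; exact: cvg_id.
  + by [].
  + by apply: pair_neq0; rewrite oner_eq0 orbT.
  + move=> t; rewrite [RHS](_ : _ = (0 + t * 0, 0 + t * 1))//.
    by congr pair; ring.
- apply: (@half_branch_conj R swap (1, 0)).
  + exact: swap_continuous.
  + exact: swapK.
  + by apply: pair_neq0; rewrite oner_eq0.
  + move=> t; rewrite [RHS](_ : _ = (0 + t * 1, 0 + t * 0))//.
    by rewrite /swap; congr pair => /=; ring.
- have -> : (1, 1) = flip (0, 0) :> plane R by rewrite /flip/= subr0.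
  apply: (@half_branch_conj R flip (0, -1)).
  + exact: flip_continuous.
  + exact: flipK.
  + by apply: pair_neq0; rewrite oppr_eq0 oner_eq0 orbT.
  + move=> t; rewrite [RHS](_ : _ = ((1 - 0) + t * 0, (1 - 0) + t * -1))//.
    by rewrite /flip; congr pair => /=; ring.
- have -> : (1, 1) = flip_swap_map (0, 0) :> plane R.
    by rewrite /flip_swap_map /flip/= subr0.
  apply: (@half_branch_conj R flip_swap_map (-1, 0)).
  + exact: flip_swap_map_continuous.
  + exact: flip_swap_mapK.
  + by apply: pair_neq0; rewrite oppr_eq0 oner_eq0.
  + move=> t; rewrite [RHS](_ : _ = ((1 - 0) + t * -1, (1 - 0) + t * 0))//.
    by rewrite /flip_swap_map /flip /swap; congr pair => /=; ring.
Qed.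

Lemma W1sP x y : W1s (x, y) <-> (x = 0 /\ 0 <= y <= 1) \/ (y = 1 /\ 0 <= x < 1).
Proof. by []. Qed.

Lemma W2sP x y : W2s (x, y) <-> (x = 1 /\ 0 <= y <= 1) \/ (y = 0 /\ 0 < x <= 1).
Proof.
rewrite /W2s (image_involutive _ flipK) /branch /flip/=; split.
  by move=> [[h /andP[? ?]]|[h /andP[? ?]]]; [left|right]; split; try lra;
    apply/andP; split; lra.
by move=> [[h /andP[? ?]]|[h /andP[? ?]]]; [left|right]; split; try lra;
  apply/andP; split; lra.
Qed.

Lemma W1uP x y : W1u (x, y) <-> (y = 0 /\ 0 <= x <= 1) \/ (x = 1 /\ 0 <= y < 1).
Proof. by rewrite /W1u (image_involutive _ swapK) /branch /swap/=. Qed.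

Lemma W2uP x y : W2u (x, y) <-> (y = 1 /\ 0 <= x <= 1) \/ (x = 0 /\ 0 < y <= 1).
Proof.
rewrite /W2u (image_involutive _ flip_swap_mapK) /branch /flip_swap_map /flip/=.
split.
  by move=> [[h /andP[? ?]]|[h /andP[? ?]]]; [left|right]; split; try lra;
    apply/andP; split; lra.
by move=> [[h /andP[? ?]]|[h /andP[? ?]]]; [left|right]; split; try lra;
  apply/andP; split; lra.
Qed.

(** The first connection consists of the left and top sides without the saddles, the second of the
    bottom and right sides; the descriptions differ only in the side to which the corner belongs. *)
Lemma bowen_heteroclinic :
  W1s `\ (0, 0) = W2u `\ (1, 1) /\ W1u `\ (0, 0) = W2s `\ (1, 1).
Proof.
have ne (a b c d : R) : (a, b) <> (c, d) <-> (a != c) || (b != d).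
  split => [h|/orP[|]/eqP h [? ?]//]; rewrite -negb_and; apply/negP.
  by move=> /andP[/eqP ? /eqP ?]; apply: h; congr pair.
split; apply/seteqP; split => -[x y] [].
- move=> /W1sP H /ne N; split; [apply/W2uP|apply/ne].
    case: H => -[h /andP[h1 h2]]; [right|left]; split=> //; last by rewrite h1 ltW.
    by move: N; rewrite h eqxx/= => N; rewrite lt_neqAle eq_sym N h1.
  by case: H => -[-> /andP[h1 h2]]; rewrite ?(lt_eqF h2)//= eq_sym oner_eq0.
- move=> /W2uP H /ne N; split; [apply/W1sP|apply/ne].
    case: H => -[h /andP[h1 h2]]; [right|left]; split=> //; last by rewrite ltW.
    by move: N; rewrite h eqxx orbF => N; rewrite lt_neqAle N h1 h2.
  by case: H => -[-> /andP[h1 h2]]; rewrite ?oner_eq0 ?orbT// (gt_eqF h1) orbT.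
- move=> /W1uP H /ne N; split; [apply/W2sP|apply/ne].
    case: H => -[h /andP[h1 h2]]; [right|left]; split=> //; last by rewrite h1 ltW.
    by move: N; rewrite h eqxx orbF => N; rewrite lt_neqAle eq_sym N h1.
  by case: H => -[-> /andP[h1 h2]];
    [rewrite (eq_sym 0) oner_eq0 orbT|rewrite (lt_eqF h2) orbT].
- move=> /W2sP H /ne N; split; [apply/W1uP|apply/ne].
    case: H => -[h /andP[h1 h2]]; [right|left]; split=> //; last by rewrite ltW.
    by move: N; rewrite h eqxx/= => N; rewrite lt_neqAle N h1 h2.
  by case: H => -[-> /andP[h1 h2]]; rewrite ?oner_eq0 ?orbT// (gt_eqF h1).
Qed.

(** Runs once around the square from (0, 0), a quarter of the time on each side; both coordinates
    are truncated tent functions. *)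
Definition perimeter (t : R) : plane R :=
  (Num.max 0 (Num.min 1 (3 / 2 - `|4 * t - 3 / 2|)),
   Num.max 0 (Num.min 1 (3 / 2 - `|4 * t - 5 / 2|))).

Lemma perimeter1 t : 0 <= t <= 4^-1 -> perimeter t = (4 * t, 0).
Proof.
move=> t01; rewrite /perimeter ler0_norm ?ler0_norm; [|lra..].
by congr pair; [rewrite min_r ?max_r|rewrite min_r ?max_l]; lra.
Qed.

Lemma perimeter2 t : 4^-1 <= t <= 2^-1 -> perimeter t = (1, 4 * t - 1).
Proof.
move=> t01; rewrite /perimeter (@ler0_norm _ (4 * t - 5 / 2)); last by lra.
congr pair; last by rewrite min_r ?max_r; lra.
by rewrite min_l ?max_r//; case: ler0P; lra.
Qed.

Lemma perimeter3 t : 2^-1 <= t <= 3 / 4 -> perimeter t = (3 - 4 * t, 1).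
Proof.
move=> t01; rewrite /perimeter (@ger0_norm _ (4 * t - 3 / 2)); last by lra.
congr pair; first by rewrite min_r ?max_r; lra.
by rewrite min_l ?max_r//; case: ler0P; lra.
Qed.

Lemma perimeter4 t : 3 / 4 <= t <= 1 -> perimeter t = (0, 4 - 4 * t).
Proof.
move=> t01; rewrite /perimeter ger0_norm ?ger0_norm; [|lra..].
by congr pair; [rewrite min_r ?max_l|rewrite min_r ?max_r]; lra.
Qed.

Lemma perimeter_cases (t : R) : 0 <= t <= 1 ->
  [\/ 0 <= t <= 4^-1, 4^-1 <= t <= 2^-1, 2^-1 <= t <= 3 / 4 | 3 / 4 <= t <= 1].
Proof.
move=> t01; have [h1|h1] := leP t 4^-1; first by constructor 1; lra.
have [h2|h2] := leP t 2^-1; first by constructor 2; lra.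
have [h3|h3] := leP t (3 / 4); first by constructor 3; lra.
by constructor 4; lra.
Qed.

Lemma perimeter_continuous : continuous perimeter.
Proof.
have c (b : R) : continuous (fun t : R => Num.max 0 (Num.min 1 (3 / 2 - `|4 * t - b|))).
  move=> t; apply: (@continuous_max _ _ (fun=> 0)
    (fun t : R => Num.min 1 (3 / 2 - `|4 * t - b|))); first exact: cvg_cst.
  apply: (@continuous_min _ _ (fun=> 1) (fun t : R => 3 / 2 - `|4 * t - b|)).
    exact: cvg_cst.
  apply: cvgB; first exact: cvg_cst.
  apply: cvg_norm; apply: cvgB; last exact: cvg_cst.
  by apply: cvgM; [exact: cvg_cst|exact: cvg_id].
by apply: pair_continuous; exact: c.
Qed.

Lemma bowen_simple_curve : simple_closed_curve (W1s `|` W2s : set M).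
Proof.
exists perimeter; split.
- by apply: continuous_subspaceT; exact: perimeter_continuous.
- by rewrite perimeter1 ?perimeter4; [congr pair; lra|lra..].
- move=> t u; rewrite !in_itv/= => /andP[t0 t1] /andP[u0 u1].
  have t01 : 0 <= t <= 1 by lra.
  have u01 : 0 <= u <= 1 by lra.
  case: (perimeter_cases t01) => ht; case: (perimeter_cases u01) => hu;
  rewrite ?(perimeter1 ht) ?(perimeter2 ht) ?(perimeter3 ht) ?(perimeter4 ht)
   ?(perimeter1 hu) ?(perimeter2 hu) ?(perimeter3 hu) ?(perimeter4 hu) => e;
  have := congr1 fst e; have := congr1 snd e; move=> /= ? ?; lra.
- apply/seteqP; split => [[x y]|_ [t /= + <-]].
    move=> [/W1sP|/W2sP] [[-> /andP[h1 h2]]|[-> /andP[h1 h2]]].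
    + exists (1 - y / 4); first by rewrite /= in_itv/=; lra.
      by rewrite perimeter4; [congr pair; lra|lra].
    + exists ((3 - x) / 4); first by rewrite /= in_itv/=; lra.
      by rewrite perimeter3; [congr pair; lra|lra].
    + exists ((1 + y) / 4); first by rewrite /= in_itv/=; lra.
      by rewrite perimeter2; [congr pair; lra|lra].
    + exists (x / 4); first by rewrite /= in_itv/=; lra.
      by rewrite perimeter1; [congr pair; lra|lra].
  rewrite in_itv/= => /perimeter_cases[] h.
  + rewrite perimeter1//; have [->|t0] := eqVneq t 0.
      by left; left; split; rewrite /= ?mulr0// lexx ler01.
    right; apply/W2sP; right; split => //.
    have : 0 < t by rewrite lt_neqAle eq_sym t0; case/andP: h.
    by move=> ?; lra.
  + by rewrite perimeter2//; right; apply/W2sP; left; split => //; lra.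
  + rewrite perimeter3//; have [->|t0] := eqVneq t 2^-1.
      right; apply/W2sP; left; split; first by lra.
      by rewrite lexx ler01.
    left; right; split => //=.
    have : 2^-1 < t by rewrite lt_neqAle eq_sym t0; case/andP: h.
    by move=> ?; lra.
  + by rewrite perimeter4//; left; left; split => //=; lra.
Qed.

Lemma squareE : square = obox 0 1 0 1 :> set (plane R).
Proof. by apply/seteqP; split => -[x y] /oboxP. Qed.

Lemma square_open : open (square : set M).
Proof. by have := @obox_open R 0 1 0 1; rewrite -squareE. Qed.

Lemma closure_square : closure (square : set M) = cbox 0 1 0 1.
Proof.
have cc : closed (cbox 0 1 0 1 : set (plane R)).
  apply: compact_closed; first exact: plane_hausdorff.
  exact: cbox_compact.
apply/seteqP; split.
  rewrite [X in _ `<=` X]((closure_id _).1 cc); apply: closure_subset.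
  by move=> [x y] [/= /andP[? ?] /andP[? ?]]; apply/cboxP;
    split; apply/andP; split; exact: ltW.
move=> [x y] /cboxP[x01 y01] B /nbhs_ballP[e/= e0 eB].
pose d := Num.min (2^-1 : R) e.
have d0 : 0 < d by rewrite /d lt_min e0; apply/andP; split => //; lra.
have dh : d <= 2^-1 by rewrite /d ge_min lexx.
have de : d <= e by rewrite /d ge_min lexx orbT.
(* The point is pushed towards the centre by the proportion d. *)
exists (x + d * (2^-1 - x), y + d * (2^-1 - y)); split.
  by split => /=; apply/andP; split; nra.
by apply: eB; split => /=; rewrite /ball/= ltr_norml; apply/andP; split; nra.
Qed.

Lemma square_boundary : closure (square : set M) `\` square = W1s `|` W2s.
Proof.
rewrite closure_square; apply/seteqP; split => [[x y]|[x y]].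
  move=> [/cboxP[/andP[x0 x1] /andP[y0 y1]] /= ns].
  have [xe|xn] := eqVneq x 0; first by left; left; split => //=; rewrite y0 y1.
  have [xe|xn1] := eqVneq x 1; first by right; apply/W2sP; left; rewrite y0 y1.
  have [ye|yn] := eqVneq y 0.
    by right; apply/W2sP; right; rewrite x1 lt_neqAle eq_sym xn x0.
  have [ye|yn1] := eqVneq y 1.
    by left; right; split => //=; rewrite x0 lt_neqAle xn1 x1.
  exfalso; apply: ns; split => /=; apply/andP; split;
    by rewrite lt_neqAle ?x0 ?x1 ?y0 ?y1 ?xn1 ?yn1// eq_sym ?xn ?yn.
move=> [/W1sP|/W2sP] [[-> /andP[h1 h2]]|[-> /andP[h1 h2]]]; split;
  try (by apply/cboxP; split; apply/andP; split => //; lra);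
  by move=> [/= /andP[? ?] /andP[? ?]]; lra.
Qed.

(** Once the square is rescaled to side 2, each vertical segment is shrunk onto a chord of the disc,
    of half-length sqrt (1 - X^2). *)
Lemma square_disc : homeomorphic_to_disc (square : set M).
Proof.
exists (fun p : plane R => (2 * p.1 - 1, (2 * p.2 - 1) *
  Num.sqrt (1 - (2 * p.1 - 1) ^+ 2)) : plane R).
exists (fun p : plane R => ((p.1 + 1) / 2,
  (p.2 / Num.sqrt (1 - p.1 ^+ 2) + 1) / 2) : plane R).
have sq (z : R) : -1 < z -> z < 1 -> 0 < 1 - z ^+ 2.
  by move=> z1 z2; rewrite expr2; nra.
split.
- apply: continuous_subspaceT; apply: pair_continuous => p.
    apply: cvgB; last exact: cvg_cst.
    by apply: cvgM; [exact: cvg_cst|exact: cvg_fst].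
  have c (u : plane R -> R) : {for p, continuous u} -> {for p, continuous (fun p => 2 * u p - 1)}.
    move=> uc; apply: cvgB; last exact: cvg_cst.
    by apply: cvgM; [exact: cvg_cst|exact: uc].
  apply: cvgM; first by apply: (c snd); exact: cvg_snd.
  apply: (@continuous_comp _ _ _ (fun p : plane R => 1 - (2 * p.1 - 1) ^+ 2) Num.sqrt);
    last exact: sqrt_continuous.
  apply: cvgB; first exact: cvg_cst.
  rewrite expr2; apply: cvgM; (apply: (c fst); exact: cvg_fst).
- apply: continuous_in_subspaceT => p; rewrite inE /open_disc/= => pd.
  suff : {for p, continuous (fun p : plane R => ((p.1 + 1) / 2,
      (p.2 / Num.sqrt (1 - p.1 ^+ 2) + 1) / 2) : plane R)} by exact.
  apply: (pair_continuous_at (f := fun p : plane R => (p.1 + 1) / 2)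
    (g := fun p : plane R => (p.2 / Num.sqrt (1 - p.1 ^+ 2) + 1) / 2)).
    apply: cvgM; last exact: cvg_cst.
    by apply: cvgD; [exact: cvg_fst|exact: cvg_cst].
  apply: cvgM; last exact: cvg_cst.
  apply: cvgD; last exact: cvg_cst.
  apply: cvgM; first exact: cvg_snd.
  apply: cvgV.
    rewrite gt_eqF// sqrtr_gt0.
    by have := sqr_ge0 p.2; lra.
  apply: (@continuous_comp _ _ _ (fun p : plane R => 1 - p.1 ^+ 2) Num.sqrt);
    last exact: sqrt_continuous.
  apply: cvgB; first exact: cvg_cst.
  by rewrite expr2; apply: cvgM; exact: cvg_fst.
- move=> [x y] [/= /andP[x0 x1] /andP[y0 y1]].
  have s0 := @sq (2 * x - 1) ltac:(lra) ltac:(lra).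
  split.
    rewrite /open_disc/= exprMn sqr_sqrtr ?ltW//.
    have := mulr_gt0 s0 (@sq (2 * y - 1) ltac:(lra) ltac:(lra)).
    by set a := (2 * x - 1) ^+ 2; set b := (2 * y - 1) ^+ 2 => ?; lra.
  congr pair; first by lra.
  by rewrite mulfK; [lra|rewrite gt_eqF// sqrtr_gt0].
- move=> [x y]; rewrite /open_disc/= => xy.
  have y2 := sqr_ge0 y; have x2 : x ^+ 2 < 1 by lra.
  have [x0 x1] : -1 < x /\ x < 1.
    by move: x2; rewrite expr2 => x2; split; nra.
  have s0 := @sq x x0 x1.
  have r0 : 0 < Num.sqrt (1 - x ^+ 2) by rewrite sqrtr_gt0.
  have q : (y / Num.sqrt (1 - x ^+ 2)) ^+ 2 < 1.
    rewrite expr_div_n sqr_sqrtr ?ltW// ltr_pdivrMr//; lra.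
  have [q0 q1] : -1 < y / Num.sqrt (1 - x ^+ 2) /\ y / Num.sqrt (1 - x ^+ 2) < 1.
    by move: q; set w := y / _; rewrite expr2 => q; split; nra.
  split; first by split => /=; apply/andP; split; lra.
  have e : 2 * ((x + 1) / 2) - 1 = x by lra.
  congr pair; rewrite e//.
  have -> : forall z : R, 2 * ((z + 1) / 2) - 1 = z by move=> z; lra.
  by rewrite divfK// gt_eqF.
Qed.

End BowenEye.

(** * Limit sets *)

Section OmegaLimit.
Context {R : realType}.

Lemma cluster_continuous (T : topologicalType) (f : T -> T) (p q : T) :
  continuous f -> cluster (iter n f p @[n --> \oo]) q ->
  cluster (iter n f p @[n --> \oo]) (f q).
Proof.
move=> fc cq A B [N _ HN] Bfq.
have tailN : (iter n f p @[n --> \oo]) [set iter n f p | n in [set n | (N <= n)%N]].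
  by exists N => // n Nn; exists n.
have [_ [[n /= Nn <-] Bn]] := cq _ (f @^-1` B) tailN (fc q B Bfq).
by exists (f (iter n f p)); split => //; apply: (HN n.+1) => /=; exact: leqW.
Qed.

Lemma cluster_inverse (T : topologicalType) (f g : T -> T) (p q : T) :
  continuous g -> cancel f g -> cluster (iter n f p @[n --> \oo]) q ->
  cluster (iter n f p @[n --> \oo]) (g q).
Proof.
move=> gc fg cq A B [N _ HN] Bgq.
(* The tail starts after N, so that the predecessor of its points is still in the given set. *)
have tailN : (iter n f p @[n --> \oo]) [set iter n f p | n in [set n | (N < n)%N]].
  by exists N.+1 => // n Nn; exists n.
have [_ [[n /= Nn <-] Bn]] := cq _ (g @^-1` B) tailN (gc q B Bgq).
case: n Nn Bn => [//|n] Nn; rewrite /preimage/= fg => Bn.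
by exists (iter n f p); split => //; apply: (HN n).
Qed.

Lemma cluster_limit (T : topologicalType) (F : set_system T) (v : nat -> T) (z : T) :
  Filter F -> (forall n, cluster F (v n)) -> v n @[n --> \oo] --> z -> cluster F z.
Proof.
move=> FF cv vz A B FA Bz.
have [N _ HN] := vz _ (nbhs_interior Bz).
exact: cv FA (HN N (leqnn N)).
Qed.

Lemma cluster_lyapunov (T : topologicalType) (u : nat -> T) (L : T -> R) (l : R) (q : T) :
  continuous L -> L (u n) @[n --> \oo] --> l -> cluster (u n @[n --> \oo]) q -> L q = l.
Proof.
move=> Lc Ll cq; apply/eqP; apply: contrapT => /negP; rewrite -subr_eq0 => ne.
have e0 : 0 < `|L q - l| / 2 by rewrite divr_gt0 ?normr_gt0.
have A1 : (u n @[n --> \oo]) [set z | `|l - L z| < `|L q - l| / 2].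
  by move/cvgrPdist_lt : Ll => /(_ _ e0).
have B1 : nbhs q [set z | `|L q - L z| < `|L q - l| / 2].
  by have /cvgrPdist_lt := Lc q; exact.
have [z [/= h1 h2]] := cq _ _ A1 B1.
have := ler_distD (L z) (L q) l; rewrite (distrC (L z)).
by rewrite leNgt => /negP; apply; lra.
Qed.

Lemma decreasing_sequence_cvg (u : nat -> R) :
  (forall n, u n.+1 <= u n) -> (exists a, forall n, a <= u n) ->
  exists l, u n @[n --> \oo] --> l /\ forall n, l <= u n.
Proof.
move=> ud [a ua].
have nu : nonincreasing_seq u by apply/nonincreasing_seqP.
have lu : has_lbound (range u) by exists a => _ [n _ <-].
exists (inf (range u)); split; first exact: nonincreasing_cvgn.
by move=> n; apply: ge_inf => //; exists n.
Qed.

(* [psi] has a pole beyond 1/2, so it is changed there to keep [lyapX] continuous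
   on the whole plane. *)
Definition psiX (z : R) := if z <= 2^-1 then psi z else z.

(** [psiX] is an increasing bijection of the line, so [decreasing_continuous] applies to its
    opposite. *)
Lemma psiX_continuous : continuous psiX.
Proof.
pose k y := - psiX y; pose e (y : R) := if y <= 2^-1 then expo 2^-1 y else y.
have kd : decreasing k.
  move=> y1 y2 y12; rewrite /k ltrN2 /psiX.
  have [h2|h2] := leP y2 2^-1.
    by rewrite ifT ?psi_lt//; lra.
  have [h1|h1] := leP y1 2^-1; last by [].
  by apply: le_lt_trans h2; rewrite -[leRHS]psi_half psi_le.
have kK : cancel (fun y => e (- y)) k.
  move=> y; rewrite /k /psiX /e; have [h|h] := leP (- y) 2^-1.
    rewrite ifT; first by rewrite /psi expoK// opprK.
    by rewrite -[leRHS](expo_half 2^-1); move: h; rewrite le_eqVlt =>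
      /orP[/eqP->//|h]; exact/ltW/expo_lt.
  by rewrite leNgt h/= opprK.
have -> : psiX = (fun y => - k y) by apply/funext => y; rewrite /k opprK.
by move=> y; apply: cvgN; exact: (decreasing_continuous kd kK).
Qed.

Definition lyapX (p : plane R) := Num.min (lam p) (psiX (lam (flip p))).

Lemma lyapXE p : square p -> lyapX p = lyap p.
Proof.
by move=> /square_flip/lam_le_half h; rewrite /lyapX /lyap /psiX h.
Qed.

Lemma mh_continuous : continuous (@mh R).
Proof.
by move=> x; apply: (@continuous_min _ _ id (fun=> 2^-1)); [exact: cvg_id|exact: cvg_cst].
Qed.

Lemma lam_continuous : continuous (@lam R).
Proof.
move=> p; apply: cvgM; last first.
  by apply: (cvg_comp _ _ (@cvg_snd _ _ _ _ _)); exact: mh_continuous.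
apply: cvgM; first exact: cvg_cst.
by apply: (cvg_comp _ _ (@cvg_fst _ _ _ _ _)); exact: mh_continuous.
Qed.

Lemma lyapX_continuous : continuous lyapX.
Proof.
move=> p; apply: (@continuous_min _ _ (@lam R) (fun p => psiX (lam (flip p)))).
  exact: lam_continuous.
apply: (@continuous_comp _ _ _ (fun p => lam (flip p)) psiX).
  by apply: continuous_comp; [exact: flip_continuous|exact: lam_continuous].
exact: psiX_continuous.
Qed.

Lemma lyapX_gt0 (p : plane R) : cbox 0 1 0 1 p -> 0 < lyapX p -> square p.
Proof.
case: p => x y /cboxP[/andP[x0 x1] /andP[y0 y1]].
rewrite /lyapX lt_min /lam/= => /andP[l1 l2].
have z0 : mh (0 : R) = 0 by rewrite mhl// invr_ge0.
have p0 : psiX 0 = 0 by rewrite /psiX ifT ?invr_ge0// /psi logo_le0.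
have xn : x != 0 by apply: contraTneq l1 => ->; rewrite z0 mulr0 mul0r ltxx.
have yn : y != 0 by apply: contraTneq l1 => ->; rewrite z0 mulr0 ltxx.
have xn1 : x != 1.
  by apply: contraTneq l2 => ->; rewrite subrr z0 mulr0 mul0r p0 ltxx.
have yn1 : y != 1.
  by apply: contraTneq l2 => ->; rewrite subrr z0 mulr0 p0 ltxx.
by split => /=; rewrite !lt_neqAle ?x0 ?x1 ?y0 ?y1 ?xn1 ?yn1 ?andbT// eq_sym ?xn ?yn.
Qed.

Lemma eye_square l m (k : R -> R) p : 1 < l -> 0 < m < 1 ->
  (forall y, 0 < y < 1 -> 0 < k y < 1) -> square p -> square (eye l m k p).
Proof.
move=> l1 /andP[m0 m1] k01; case: p => x y [/= /andP[x0 x1] /andP[y0 y1]].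
have /andP[t0 t1] := eyeT_itv k (x, y) l1.
have /andP[ky0 ky1] := k01 y ltac:(by rewrite y0).
split; last by rewrite /=; apply/andP; split; nra.
by rewrite /= /eyeX/= lt_max gt_max lt_min gt_min ky0 ky1 mulr_gt0 ?orbT ?andbT//=; nra.
Qed.

Lemma bowen_inv_square p : square p -> square (@bowen_inv R p).
Proof.
move=> [p1 p2]; rewrite /bowen_inv/=.
have [] : square (eye 4 2^-1 kapi (swap p)); last by [].
apply: eye_square => //; [lra|apply/andP; split; lra|].
by move=> y /andP[y0 y1]; apply/andP; split;
  [rewrite -kapi1|rewrite -kapi0]; exact: kapi_lt.
Qed.

Lemma square_iter (f : plane R -> plane R) p n :
  (forall q, square q -> square (f q)) -> square p -> square (iter n f p).
Proof. by move=> fs ps; elim: n => //= n IH; exact: fs. Qed.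

Lemma square_cbox p : square p -> cbox (0 : R) 1 0 1 p.
Proof.
by case: p => x y [/= /andP[? ?] /andP[? ?]]; apply/cboxP;
  split; apply/andP; split; exact: ltW.
Qed.

Section Orbit.
Variable p : plane R.
Hypotheses (sp : square p) (pc : p <> center).

Let u n := iter n bowen p.

Let us n : square (u n).
Proof. by apply: square_iter => // q; exact: bowen_square. Qed.

Let uc n : u n <> center.
Proof.
elim: n => // n IH; rewrite /u iterS => h; apply: IH.
by apply: (can_inj bowenK); rewrite bowen_center.
Qed.

Lemma lyap_orbit_cvg : exists l, [/\ lyapX (u n) @[n --> \oo] --> l, l < 2^-1
  & forall q, cluster (u n @[n --> \oo]) q -> lyapX q = l /\ lyapX (bowen q) = l].
Proof.
have [||l [Ll lL]] := @decreasing_sequence_cvg (fun n => lyapX (u n)).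
- move=> n; rewrite (lyapXE (us n.+1)) (lyapXE (us n)) ltW//.
  exact: lyap_lt (us n) (@uc n).
- by exists 0 => n; rewrite (lyapXE (us n)) ltW// lyap_gt0.
exists l; split => //.
  by apply: le_lt_trans (lL 0%N) _; rewrite (lyapXE (us 0%N)) lyap_lt_half.
move=> q cq; split; first exact: cluster_lyapunov lyapX_continuous Ll cq.
apply: cluster_lyapunov lyapX_continuous Ll _.
exact: cluster_continuous bowen_continuous cq.
Qed.

Lemma cluster_cbox (f : plane R -> plane R) q : (forall n, square (iter n f p)) ->
  cluster (iter n f p @[n --> \oo]) q -> cbox (0 : R) 1 0 1 q.
Proof.
move=> sq cq; rewrite -closure_square => B Bq.
have tail0 : (iter n f p @[n --> \oo]) (range (fun n => iter n f p)).
  by exists 0%N => // n _; exists n.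
have [z [[n _ <-] Bz]] := cq _ B tail0 Bq.
by exists (iter n f p).
Qed.

(** LaSalle's principle: [lyapX] takes the same value at a limit point and at its image, which
    strict decrease forbids inside the square. The centre is excluded because the limit value is
    below the maximum 1/2. *)
Lemma omega_boundary q : cluster (u n @[n --> \oo]) q ->
  (@W1s R `|` W2s) q.
Proof.
move=> cq; rewrite -square_boundary closure_square; split.
  exact: cluster_cbox cq.
move=> sq; have [l [_ lh /(_ _ cq)[Lq Lfq]]] := lyap_orbit_cvg.
have [qc|qc] := pselect (q = center).
  have := lyapXE sq; rewrite Lq qc /lyap.
  have -> : flip (center : plane R) = center by rewrite /flip/=; congr pair; lra.
  rewrite /lam/= mhr// (_ : 2 * 2^-1 * 2^-1 = 2^-1 :> R); last by lra.
  by rewrite psi_half minxx => h; rewrite h ltxx in lh.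
by have := lyap_lt sq qc; rewrite -!lyapXE ?Lq ?Lfq ?ltxx//; exact: bowen_square.
Qed.

Lemma omega_nonempty : exists q, cluster (u n @[n --> \oo]) q.
Proof.
have [|q [_ cq]] := @cbox_compact R 0 1 0 1 (u n @[n --> \oo]) _.
  by exists 0%N => // n _; exact: square_cbox.
by exists q.
Qed.

(** In a compact set a unique cluster point is a limit. The box exceeds the unit square because it
    has to be a neighbourhood of a corner. *)
Lemma omega_not_singleton (z : plane R) : nbhs z (cbox (-1) 2 (-1) 2) ->
  ~ stable_set (bowen : @euclidean_plane R -> euclidean_plane) z p ->
  exists2 q, cluster (u n @[n --> \oo]) q & q <> z.
Proof.
move=> zV nz; apply: contrapT => H; apply: nz.
have cz : cluster (u n @[n --> \oo]) = [set z].
  apply/seteqP; split => q.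
    by move=> cq; apply: contrapT => qz; apply: H; exists q.
  move=> ->; have [q' cq] := omega_nonempty.
  by have [<-//|qz] := pselect (q' = z); exfalso; apply: H; exists q'.
apply: (compact_cluster_set1 _ (@cbox_compact R (-1) 2 (-1) 2) zV _ _ cz).
- exact: plane_hausdorff.
- exists 0%N => // n _; have := square_cbox (us n).
  rewrite /u/=; case: (iter n bowen p) => x y /cboxP[/andP[? ?] /andP[? ?]]; apply/cboxP.
  by split; apply/andP; split; lra.
Qed.

(* The limit set is invariant by [bowen] and its inverse, and a boundary point
   other than the saddles tends to one of them in the future and to the other
   one in the past. *)
Lemma omega_saddles :
  cluster (u n @[n --> \oo]) ((0, 0) : plane R) /\
  cluster (u n @[n --> \oo]) ((1, 1) : plane R).
Proof.
have fwd z q : stable_set (bowen : @euclidean_plane R -> euclidean_plane) z q ->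
    cluster (u n @[n --> \oo]) q -> cluster (u n @[n --> \oo]) z.
  move=> sq cq; apply: cluster_limit sq => n.
  elim: n => // n IH; rewrite iterS.
  exact: cluster_continuous bowen_continuous IH.
have bwd z q : stable_set (bowen_inv : @euclidean_plane R -> euclidean_plane) z q ->
    cluster (u n @[n --> \oo]) q -> cluster (u n @[n --> \oo]) z.
  move=> sq cq; apply: cluster_limit sq => n.
  elim: n => // n IH; rewrite iterS.
  exact: cluster_inverse bowen_inv_continuous bowenK IH.
have bs : @branch R `<=` stable_line.
  by move=> q [[? /andP[? ?]]|]; [left|right].
have n1 : ~ stable_set (bowen : @euclidean_plane R -> euclidean_plane)
    ((0, 0) : plane R) p.
  rewrite stable_bowen1; case: (p) sp => x y [/= /andP[? ?] /andP[? ?]].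
  by move=> [/= [? _]|/= [? _]]; lra.
have n2 : ~ stable_set (bowen : @euclidean_plane R -> euclidean_plane)
    ((1, 1) : plane R) p.
  rewrite stable_bowen2 (image_involutive _ flipK).
  case: (p) sp => x y [/= /andP[? ?] /andP[? ?]].
  by move=> [/= [? _]|/= [? _]]; lra.
have nb1 : nbhs ((0, 0) : plane R) (cbox (-1) 2 (-1) 2).
  by apply: cbox_nbhs; apply/andP; split; lra.
have nb2 : nbhs ((1, 1) : plane R) (cbox (-1) 2 (-1) 2).
  by apply: cbox_nbhs; apply/andP; split; lra.
have [h1 h2] := @bowen_heteroclinic R.
split.
  have [q cq qz] := omega_not_singleton nb2 n2.
  case: (omega_boundary cq) => [q1|q2].
    by apply: fwd cq; rewrite stable_bowen1; exact: bs.
  apply: bwd cq; rewrite unstable_bowen1.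
  have : (W2s `\ (1, 1)) q by [].
  by rewrite -h2 => -[[q' q'b <-] _]; exists q' => //; exact: bs.
have [q cq qz] := omega_not_singleton nb1 n1.
case: (omega_boundary cq) => [q1|q2]; last first.
  apply: fwd cq; rewrite stable_bowen2; case: q2 => q' q'b <-.
  by exists q' => //; exact: bs.
apply: bwd cq; rewrite unstable_bowen2.
have : (W1s `\ (0, 0)) q by [].
by rewrite h1 => -[[q' q'b <-] _]; exists q' => //; exact: bs.
Qed.

Let w n := iter n bowen_inv p.

Let ws n : square (w n).
Proof. by apply: square_iter => // q; exact: bowen_inv_square. Qed.

Let wc n : w n <> center.
Proof.
elim: n => // n IH; rewrite /w iterS => h; apply: IH.
by rewrite /w -(bowen_invK (iter n bowen_inv p)) h bowen_center.
Qed.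

(** Backwards [lyapX] increases, so it stays away from 0 and limit points are interior; strict
    monotonicity then leaves only the centre. The opposite sign turns this into a decreasing
    sequence. *)
Lemma alpha_center : cluster (w n @[n --> \oo]) = [set (center : plane R)].
Proof.
have inc n : lyapX (w n) < lyapX (w n.+1).
  rewrite (lyapXE (ws n.+1)) (lyapXE (ws n)) -{1}(bowen_invK (w n)).
  exact: lyap_lt (ws n.+1) (@wc n.+1).
have [||l [Ll lL]] := @decreasing_sequence_cvg (fun n => - lyapX (w n)).
- by move=> n; rewrite lerN2 ltW.
- exists (- 2^-1) => n; rewrite lerN2 (lyapXE (ws n)) ltW//; exact: lyap_lt_half.
have Lc : continuous (fun q => - lyapX q).
  by move=> q; apply: cvgN; exact: lyapX_continuous.
have sub q : cluster (w n @[n --> \oo]) q -> q = center.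
  move=> cq; have cq' := cluster_continuous bowen_inv_continuous cq.
  have e1 := cluster_lyapunov Lc Ll cq.
  have e2 := cluster_lyapunov Lc Ll cq'.
  have lp : lyapX q = lyapX (bowen_inv q) by apply: oppr_inj; rewrite [LHS]e1 -e2.
  have pos : 0 < lyapX q.
    have : 0 < lyapX (w 0%N) by rewrite (lyapXE (ws 0%N)) lyap_gt0.
    by move: (lL 0%N) e1 => /= ? ? ?; lra.
  have sq : square q by apply: lyapX_gt0 pos; exact: cluster_cbox ws cq.
  apply: contrapT => qc; have sq' := bowen_inv_square sq.
  have qc' : bowen_inv q <> center.
    by move=> h; apply: qc; rewrite -(bowen_invK q) h bowen_center.
  have := lyap_lt sq' qc'; rewrite bowen_invK -!lyapXE// -lp ltxx//.
apply/seteqP; split => q; first exact: sub.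
move=> ->; have [|q' [_ cq]] := @cbox_compact R 0 1 0 1 (w n @[n --> \oo]) _.
  by exists 0%N => // n _; exact: square_cbox.
by rewrite -(sub q' cq).
Qed.

End Orbit.

End OmegaLimit.

(** * Time averages *)

Section Potential.
Context {R : realType}.
Implicit Types (u v x y : R).

(** The three branches are summarised by relations valid in all of them; 2 (1 - x) - (1 - X) is one
    minus the clamping share. *)
Lemma bowen_step x y X Y : bowen (x, y) = (X, Y) ->
  [/\ 1 - X <= 2 * (1 - x), X <= 2 * x &
      1 - Y = (1 - y) / 4 + 3 / 4 * (2 * (1 - x) - (1 - X))].
Proof.
case: (bowen_cases x y) => h.
- by rewrite bowen_low// => -[<- <-]; split; lra.
- by rewrite bowen_up// => -[<- <-]; split; lra.
- by rewrite bowen_mid// => -[<- <-]; split; lra.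
Qed.

(** This fixes the threshold 1/4 on 1 - u in [weight] and the hypothesis r <= 1/8. *)
Lemma alpha_lt_quarter v : v < 8^-1 -> alpha v < 4^-1.
Proof.
move=> v8; rewrite /alpha gt_max; apply/andP; split; first by lra.
have [v0|v0] := leP v 0; first by rewrite logo_le0//; lra.
rewrite /logo (leNgt v 0) v0/= invrK ltf_pV2 ?posrE; last 2 first.
- have : ln (2 * v) <= 0 by apply: ln_le0; lra.
  by move=> ?; lra.
- by lra.
have := @le_ln1Dx R (2 * v - 1); rewrite addrCA subrr addr0 => /(_ ltac:(lra)).
by lra.
Qed.

(** For v > 0 this is - ln ([logo 8^-1 v]). Up to the factor ln 2 it bounds the length of the stay
    at (0, 0) that follows a departure from (1, 1) at distance v. *)
Definition loglog v := ln (2 - 8 * ln (2 * v)).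

Lemma ln2_gt0 : 0 < ln 2 :> R.
Proof. by apply: ln_gt0; lra. Qed.

Lemma loglog_den v : 0 < v <= 2^-1 -> 2 <= 2 - 8 * ln (2 * v).
Proof. move=> v0; have h : ln (2 * v) <= 0 by apply: ln_le0; lra.
lra. Qed.

(** The argument D >= 2 of the outer logarithm grows by at most 16 ln 2, so it is multiplied by at
    most 1 + 8 ln 2. *)
Lemma loglog_quarter v w : 0 < v <= 2^-1 -> v / 4 <= w -> w <= 2^-1 ->
  loglog w <= loglog v + 8 * ln 2.
Proof.
move=> v0 vw wh; have /andP[v1 v2] := v0.
have w0 : 0 < w by lra.
have l2 := ln2_gt0.
have dv := loglog_den v0; have dw := @loglog_den w ltac:(by rewrite w0).
have h : ln (2 * v) - 2 * ln 2 <= ln (2 * w).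
  have -> : 2 * ln 2 = ln (2 * 2) :> R by rewrite lnM ?posrE//; lra.
  by rewrite -ln_div ?posrE ?ler_ln ?posrE//; lra.
rewrite /loglog; set D := 2 - 8 * ln (2 * v) in dv *.
apply: (@le_trans _ _ (ln (D * (1 + 8 * ln 2)))).
  have Dl : 0 <= (D - 2) * ln 2 by rewrite mulr_ge0; lra.
  have D1 : D = 2 - 8 * ln (2 * v) by [].
  by rewrite ler_ln ?posrE; lra.
rewrite lnM ?posrE; [|lra|lra].
by rewrite lerD2l; apply: le_ln1Dx; lra.
Qed.

Lemma loglog_ge0 v : 0 < v <= 2^-1 -> 0 <= loglog v.
Proof. by move=> /loglog_den h; apply: ln_ge0; lra. Qed.

Lemma loglog_alpha v : 0 < v <= 2^-1 -> - ln (alpha v) <= loglog v.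
Proof.
move=> v0; have d := loglog_den v0; have /andP[v1 v2] := v0.
have := alpha_ge v2; rewrite /logo (leNgt v 0) v1/= invrK (mulrC _ 8) => h.
rewrite lerNl -lnV ?posrE; last by lra.
rewrite ler_ln ?posrE//; first by rewrite invr_gt0; lra.
exact: alpha_gt0.
Qed.

Lemma loglog_small (c e : R) : 0 < e -> exists2 v0, 0 < v0 &
  forall v, 0 < v < v0 -> v <= 2^-1 -> c + loglog v <= - (e * ln v).
Proof.
(* With this a, the bound a D <= e/8 - (e/2) ln v uses half of the allowance -(e ln v); Z makes the
   other half absorb the constants. *)
move=> e0; pose a := e / 16; have a0 : 0 < a by rewrite divr_gt0.
pose Z := 2 / e * (c + e / 8 - 1 - ln a).
exists (expR (- Z)); first exact: expR_gt0.
move=> v /andP[v0 vZ] vh.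
have z : Z < - ln v by rewrite ltrNr -[ltRHS]expRK ltr_ln ?posrE ?expR_gt0.
have l2 := ln2_gt0.
have d := @loglog_den v ltac:(by rewrite v0).
have e1 : ln (2 * v) = ln 2 + ln v by rewrite lnM ?posrE.
set D := 2 - 8 * ln (2 * v) in d.
have h : ln (a * D) <= a * D - 1.
  have := @le_ln1Dx R (a * D - 1); rewrite addrCA subrr addr0; apply.
  have : 0 < a * D by rewrite mulr_gt0//; lra.
  by lra.
rewrite lnM ?posrE// in h; last by lra.
have h2 : a * D <= e / 8 - e / 2 * ln v.
  by rewrite /a /D e1; nra.
have h3 : e / 2 * Z = c + e / 8 - 1 - ln a by rewrite /Z; field; rewrite gt_eqF.
have h4 : e / 2 * Z <= - (e / 2 * ln v) by nra.
rewrite /loglog -/D; lra.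
Qed.

Section Weights.
Variables (r e : R).
Hypotheses (r0 : 0 < r) (r8 : r <= 8^-1) (e0 : 0 < e).

(** [C0] bounds the weight on entering the square {u < r, v < r}; [C1] serves points with v >= r,
    and [C2], [C3] those with v < r <= u, each exceeding the previous one by the cost of passing to
    the next zone. By the choice of [eta], v >= r and u v < [eta] force 6 u < r. *)
Let eta := r ^+ 2 / 6.
Let C0 := - (e * ln (r / 4)).
Let C1 := C0 - ln r + 2 * ln 2.
Let C2 := C1 + ln 2.
Let C3 := C2 + 9 * ln 2.

(* Write [u = 1 - x] and [v = 1 - y]. Along an orbit close to the boundary,
   [weight] counts, up to the factor [ln 2], the steps left before the square
   [{u < r, v < r}] at the second saddle is reached, and it grows by at most
   [e * ln 4] per step inside that square. *)
Definition weight u v :=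
  if v < r then
    if u < r then - (e * ln v)
    else if 1 - u < 4^-1 then C2 + Num.max (- ln (1 - u)) (loglog v)
    else C3 + loglog v - 9 * ln u
  else if u * v < eta then C0 + ln v - ln r + ln 2
  else C1 - ln (1 - u).

Definition pot (p : plane R) := weight (1 - p.1) (1 - p.2).

Let lnr : ln r <= 0. Proof. by apply: ln_le0; apply: le_trans r8 _; lra. Qed.

Let C0ge0 : 0 <= C0.
Proof.
rewrite /C0 oppr_ge0 pmulr_rle0//; apply: ln_le0.
by have := r8; have := r0; lra.
Qed.

Let eta0 : 0 < eta. Proof. by rewrite divr_gt0// exprn_gt0. Qed.

Let etar : 6 * eta = r * r. Proof. by rewrite /eta -expr2; field. Qed.

Lemma weight_ge0 u v : 0 < u < 1 -> 0 < v < 1 -> 0 <= weight u v.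
Proof.
move=> /andP[u0 u1] /andP[v0 v1]; rewrite /weight.
have l2 := ln2_gt0; have lr := lnr; have c0 := C0ge0; have rr := r8.
have lv : ln v <= 0 by apply: ln_le0; lra.
have lu : ln u <= 0 by apply: ln_le0; lra.
have lx : ln (1 - u) <= 0 by apply: ln_le0; lra.
have ev : 0 <= - (e * ln v) by rewrite oppr_ge0 pmulr_rle0.
case: ltP => vr.
  have F0 : 0 <= loglog v by apply: loglog_ge0; rewrite v0/=; lra.
  case: ltP => // ur; case: ltP => x4; last by rewrite /C3 /C2 /C1; lra.
  have : 0 <= Num.max (- ln (1 - u)) (loglog v) by rewrite le_max F0 orbT.
  by rewrite /C2 /C1; set m := Num.max _ _ => m0; lra.
case: ltP => _; last by rewrite /C1; lra.
have : ln r <= ln v by rewrite ler_ln ?posrE.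
by lra.
Qed.

Lemma weight_far u v : r <= v -> v < 1 -> 0 < u < 1 -> weight u v <= C1 - ln (1 - u).
Proof.
move=> vr v1 /andP[u0 u1]; rewrite /weight ltNge vr/=.
have l2 := ln2_gt0; have v0 : 0 < v by apply: lt_le_trans vr.
have lv : ln v <= 0 by apply: ln_le0; lra.
have lx : ln (1 - u) <= 0 by apply: ln_le0; lra.
by case: ltP => // _; rewrite /C1; lra.
Qed.

Lemma weight_bottom u v : r <= v -> v < 1 -> u * v < eta ->
  weight u v <= C1 - ln 2.
Proof.
move=> vr v1 uv; rewrite /weight ltNge vr/= uv.
have v0 : 0 < v by apply: lt_le_trans vr.
have lv : ln v <= 0 by apply: ln_le0; lra.
by rewrite /C1; lra.
Qed.

(** The second distance is at most divided by 4 in one step, so a point entering the square from v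
    >= r has its new distance at least r/4. *)
Lemma weight_in u v : u < r -> v < r -> r / 4 <= v -> weight u v <= C0.
Proof.
move=> ur vr v4; rewrite /weight vr ur /C0 lerN2 ler_pM2l//.
have r40 : 0 < r / 4 by have := r0; lra.
by rewrite ler_ln ?posrE//; lra.
Qed.

Section Step.
Variables (x y X Y : R).
Hypotheses (sp : square (x, y)) (fE : bowen (x, y) = (X, Y)).

Let u := 1 - x.
Let v := 1 - y.
Let U := 1 - X.
Let V := 1 - Y.

Let xE : 1 - u = x. Proof. by rewrite /u subKr. Qed.
Let XE : 1 - U = X. Proof. by rewrite /U subKr. Qed.

Let bounds : [/\ 0 < u < 1, 0 < v < 1, 0 < U < 1 & 0 < V < 1].
Proof.
have sf : square (X, Y) by rewrite -fE; exact: bowen_square.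
case: (sp) => /= /andP[? ?] /andP[? ?]; case: (sf) => /= /andP[? ?] /andP[? ?].
by rewrite /u /v /U /V; split; apply/andP; split; lra.
Qed.

Let step : [/\ U <= 2 * u, X <= 2 * x & V = v / 4 + 3 / 4 * (2 * u - U)].
Proof. exact: bowen_step fE. Qed.

(** A step inside the square costs e ln 4. On leaving it, the weight of the whole next round is
    doubly logarithmic and has to be covered by -(e ln v), as the last hypothesis says. *)
Lemma weight_step_in :
  u < r -> v < r -> C3 + 8 * ln 2 - 9 * ln r + loglog v <= - (e * ln v) ->
  weight U V <= weight u v + e * ln 4.
Proof.
move=> ur vr small.
have [/andP[u0 u1] /andP[v0 v1] /andP[U0 U1] /andP[V0 V1]] := bounds.
have rr := r8; have l2 := ln2_gt0.
have kE : kap y = alpha v by apply: kap_ge_half; move: vr; rewrite /v; lra.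
have ah : alpha v <= 2^-1 by apply: alpha_le_half; lra.
have up : bowen (x, y) = (2 * x - 1, y / 4 + 3 / 4).
  by apply: bowen_up; rewrite kE; move: ur; rewrite /u; lra.
have [UE VE] : U = 2 * u /\ V = v / 4.
  by move: fE; rewrite up; case=> X2 Y2; rewrite /U /V /u /v; split; lra.
have Vr : V < r by lra.
have wuv : weight u v = - (e * ln v) by rewrite /weight vr ur.
have lV : ln V = ln v - ln 4 by rewrite VE ln_div ?posrE.
rewrite wuv {1}/weight Vr; case: ltP => Ur; first by rewrite lV; lra.
rewrite ltNge (_ : 4^-1 <= 1 - U)/=; last by lra.
have lq : loglog V <= loglog v + 8 * ln 2.
  by apply: loglog_quarter; [apply/andP; split; lra|lra|lra].
have lU : ln r <= ln U by rewrite ler_ln ?posrE.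
have l4 : 0 <= e * ln 4 by rewrite mulr_ge0 ?ltW// ln_gt0//; lra.
by lra.
Qed.

(** Here 6 u < r <= v, hence V <= v/2; and U V <= u v keeps the orbit in this zone until V < r. *)
Lemma weight_step_bottom : r <= v -> u * v < eta ->
  weight U V + ln 2 <= weight u v.
Proof.
move=> vr uv.
have [/andP[u0 u1] /andP[v0 v1] /andP[U0 U1] /andP[V0 V1]] := bounds.
have [Uu _ VE] := step; have rr := r8; have rp := r0; have l2 := ln2_gt0.
have ur : 6 * u < r by have := etar; nra.
have Vv : V <= v / 2 by lra.
have Vv4 : v / 4 <= V by lra.
have Ur : U < r by lra.
have -> : weight u v = C0 + ln v - ln r + ln 2.
  by rewrite /weight ltNge vr/= uv.
have lv : ln r <= ln v by rewrite ler_ln ?posrE.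
have [Vr|Vr] := ltP V r.
  by have := @weight_in U V Ur Vr ltac:(lra); lra.
have UV : U * V < eta by nra.
rewrite /weight ltNge Vr/= UV.
have : ln V <= ln v - ln 2.
  by rewrite -ln_div ?posrE ?ler_ln ?posrE//; lra.
by lra.
Qed.

(** Away from the sides at (1, 1), closeness to the boundary means x y < 2 d. In the lower branch x
    doubles; in the middle branch y is tiny, so U <= y takes the orbit to the zone along x = 1 or
    into the square. The other possibilities contradict the smallness of d. *)
Lemma weight_step_side d : r <= v -> eta <= u * v -> d <= eta / 8 ->
  8 * d <= alpha r -> lam (x, y) < d \/ lam (u, v) < d ->
  weight U V + ln 2 <= weight u v.
Proof.
move=> vr uv deta dal lamd.
have [/andP[u0 u1] /andP[v0 v1] /andP[U0 U1] /andP[V0 V1]] := bounds.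
have [Uu Xx VE] := step; have rr := r8; have rp := r0; have l2 := ln2_gt0.
have e6 := etar; have et := eta0; have lr := lnr; have c0 := C0ge0.
have [/= /andP[x0 x1] /andP[y0 y1]] := sp.
have mhx (z : R) : 0 < z -> z < 1 -> z / 2 <= mh z.
  by move=> z0 z1; rewrite /mh le_min; apply/andP; split; lra.
have xy : x * y < 2 * d.
  case: lamd => h.
    have := mhx x x0 x1; have := mhx y y0 y1; move: h; rewrite /lam/=.
    by set a := mh x; set b := mh y => *; nra.
  have := mhx u u0 u1; have := mhx v v0 v1; move: h; rewrite /lam/=.
  by set a := mh u; set b := mh v => *; nra.
have lx : ln x <= 0 by apply: ln_le0; lra.
have yE : y = 1 - v by rewrite /v subKr.
have xuE : x = 1 - u by rewrite xE.
have -> : weight u v = C1 - ln x.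
  by rewrite /weight ltNge vr/= ltNge uv/= xE.
have etas : eta <= 1 / 6 * (r * (1 / 8)) by nra.
have eu : eta <= u.
  have : 0 <= u * (1 - v) by rewrite mulr_ge0; lra.
  by lra.
have far : r <= V -> 0 < X -> X = 2 * x -> weight U V + ln 2 <= C1 - ln x.
  move=> rV X0 X2x; have := @weight_far U V rV V1 ltac:(by rewrite U0); rewrite XE X2x.
  by rewrite lnM ?posrE//; lra.
have x4 : 2^-1 < y -> x < 4 * d.
  move=> yh; have : 0 <= x * (y - 2^-1) by rewrite mulr_ge0; lra.
  by lra.
case: (bowen_cases x y) => h.
- have fl := bowen_low h; rewrite fE in fl; case: fl => X2 Y2.
  apply: far => //; last by lra.
  by rewrite /V Y2; lra.
- exfalso; have [yh|yh] := leP y 2^-1.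
    rewrite kap_le_half// in h; have := beta_le yh => by1.
    have y2 : 2 * eta <= y by lra.
    have x2 : 0 <= y * (x - 2^-1) by rewrite mulr_ge0; lra.
    by lra.
  have ky : 0 < kap y by case/andP: (kap_itv (y := y) ltac:(by rewrite y0)).
  have {}x4 := x4 yh.
  have x2 : 2^-1 < x by lra.
  have : eta <= 1 / 6 * (1 / 8 * (1 / 8)) by nra.
  by lra.
- have [yh|yh] := leP y 2^-1; last first.
    (* Leaving the left side near the top would give 8 d <= [alpha r] <= [kap y] <= 2 x < 8 d. *)
    exfalso; have {}x4 := x4 yh.
    have ke : kap y = alpha v by apply: kap_ge_half; exact: ltW.
    have : alpha r <= alpha v.
      move: vr; rewrite le_eqVlt => /predU1P[<-//|vr].
      by apply/ltW/alpha_lt => //; lra.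
    by rewrite ke in h; lra.
  have fm := bowen_mid h; rewrite fE in fm; case: fm => XE' _.
  rewrite kap_le_half// in h XE'; have by1 := beta_le yh.
  have y8 : y < 8 * d.
    have : 0 <= y * (x - 4^-1) by rewrite mulr_ge0; lra.
    by lra.
  have Uy : U <= y by rewrite /U XE'; lra.
  have Ur : U < r by lra.
  have UV : U * V < eta.
    have : 0 <= U * (1 - V) by rewrite mulr_ge0; lra.
    by lra.
  have [Vr|Vr] := ltP V r.
    by have := @weight_in U V Ur Vr ltac:(lra); rewrite /C1; lra.
  by have := @weight_bottom U V Vr V1 UV; lra.
Qed.

(** In the upper branch u doubles, which gains 9 ln 2, of which [loglog_quarter] takes 8: hence the
    coefficient 9. For x < 1/4 the next X is 2 x or [alpha v], and the maximum in [weight] covers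
    both. *)
Lemma weight_step_top : v < r -> r <= u -> weight U V + ln 2 <= weight u v.
Proof.
move=> vr ur.
have [/andP[u0 u1] /andP[v0 v1] /andP[U0 U1] /andP[V0 V1]] := bounds.
have [Uu Xx VE] := step; have rr := r8; have rp := r0; have l2 := ln2_gt0.
have vi : 0 < v <= 2^-1 by apply/andP; split; lra.
have kE : kap y = alpha v by apply: kap_ge_half; move: vr; rewrite /v; lra.
have a4 : alpha v < 4^-1 by apply: alpha_lt_quarter; lra.
have a0 : 0 < alpha v by exact: alpha_gt0.
have la := loglog_alpha vi; have xu := xE; have XU := XE.
have lq : V <= 2^-1 -> loglog V <= loglog v + 8 * ln 2.
  by move=> Vh; apply: loglog_quarter => //; lra.
have lu : ln u <= 0 by apply: ln_le0; lra.
have F0 := loglog_ge0 vi.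
have [x4|x4] := ltP x 4^-1.
  have -> : weight u v = C2 + Num.max (- ln x) (loglog v).
    by rewrite /weight vr ltNge ur/= xE x4.
  have m1 : - ln x <= Num.max (- ln x) (loglog v) by rewrite le_max lexx.
  have m2 : loglog v <= Num.max (- ln x) (loglog v) by rewrite le_max lexx orbT.
  move: m1 m2; set mm := Num.max _ _ => m1 m2.
  have x0 : 0 < x by lra.
  case: (bowen_cases x y) => h; rewrite kE in h.
  - have fl := bowen_low (y := y) (x := x) ltac:(by rewrite kE).
    rewrite fE in fl; case: fl => X2 Y2.
    have Vr : r <= V by rewrite /V Y2; move: v0; rewrite /v; lra.
    have := @weight_far U V Vr V1 ltac:(by rewrite U0); rewrite XE X2.
    by rewrite lnM ?posrE// /C2; lra.
  - by exfalso; lra.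
  - have fm := bowen_mid (y := y) (x := x) ltac:(by rewrite kE).
    rewrite fE kE in fm; case: fm => X2 _.
    have Vr : r <= V by lra.
    have := @weight_far U V Vr V1 ltac:(by rewrite U0); rewrite XE X2.
    by rewrite /C2; lra.
have -> : weight u v = C3 + loglog v - 9 * ln u.
  by rewrite /weight vr ltNge ur/= xE ltNge x4.
case: (bowen_cases x y) => h; rewrite kE in h.
- by exfalso; lra.
- have fu := bowen_up (y := y) (x := x) ltac:(by rewrite kE).
  rewrite fE in fu; case: fu => X2 Y2.
  have UE : U = 2 * u by rewrite /U X2 /u; lra.
  have VE4 : V = v / 4 by rewrite VE UE; lra.
  have Vr : V < r by lra.
  have {}lq := lq ltac:(lra).
  rewrite /weight Vr ltNge (_ : r <= U)/=; last by lra.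
  rewrite XE; case: ltP => X4; last first.
    by rewrite UE lnM ?posrE//; lra.
  have lX : - ln X <= loglog v.
    by apply: le_trans la; rewrite lerN2 ler_ln ?posrE; lra.
  have : Num.max (- ln X) (loglog V) <= loglog v + 8 * ln 2.
    by rewrite ge_max lq andbT; lra.
  by rewrite /C3; lra.
- have fm := bowen_mid (y := y) (x := x) ltac:(by rewrite kE).
  rewrite fE kE in fm; case: fm => X2 _.
  have [Vr|Vr] := leP r V.
    have := @weight_far U V Vr V1 ltac:(by rewrite U0); rewrite XE X2.
    by rewrite /C3 /C2; lra.
  have {}lq := lq ltac:(lra).
  rewrite /weight Vr ltNge (_ : r <= U)/=; last by lra.
  rewrite XE X2 a4.
  have : Num.max (- ln (alpha v)) (loglog V) <= loglog v + 8 * ln 2.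
    by rewrite ge_max lq andbT; lra.
  by rewrite /C3; lra.
Qed.

End Step.

Lemma pot_step : exists2 d, 0 < d & forall p, square p ->
  lam p < d \/ lam (flip p) < d ->
  pot (bowen p) + (if (1 - p.1 < r) && (1 - p.2 < r) then 0 else ln 2) <=
  pot p + e * ln 4.
Proof.
have [v0 v00 hv0] := loglog_small (C3 + 8 * ln 2 - 9 * ln r) e0.
have rr := r8; have rp := r0; have et := eta0.
have al0 : 0 < alpha r by apply: alpha_gt0; apply/andP; split; lra.
(* The first two bounds are those of [weight_step_side]; the third turns 2 u v < d into v < v0 as
   soon as 2 u >= r. *)
pose d := Num.min (eta / 8) (Num.min (alpha r / 8) (r * v0)).
exists d; first by rewrite /d !lt_min !divr_gt0 ?mulr_gt0.
have d1 : d <= eta / 8 by rewrite /d ge_min lexx.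
have d2 : d <= alpha r / 8 by rewrite /d !ge_min lexx orbT.
have d3 : d <= r * v0 by rewrite /d !ge_min lexx !orbT.
move=> [x y] sp lamd; case fE : (bowen (x, y)) => [X Y].
have l4 : 0 <= e * ln 4 by rewrite mulr_ge0 ?ltW// ln_gt0//; lra.
rewrite /pot/=.
have [/= /andP[x0 x1] /andP[y0 y1]] := sp.
have [vr|vr] := ltP (1 - y) r; last first.
  rewrite andbF; have [uv|uv] := ltP ((1 - x) * (1 - y)) eta.
    by have := weight_step_bottom sp fE vr uv; lra.
  have := @weight_step_side x y X Y sp fE d vr uv d1 ltac:(lra) lamd; lra.
have [ur|ur] := ltP (1 - x) r; last first.
  by rewrite /=; have := weight_step_top sp fE vr ur; lra.
rewrite andbT addr0.
(* If the orbit stays in the square, the step costs e ln 4 whatever the size of v; only an exit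
   needs v < v0. *)
have [u2|u2] := ltP (2 * (1 - x)) r.
  rewrite /weight vr ur.
  have kE : kap y = alpha (1 - y) by apply: kap_ge_half; lra.
  have ah : alpha (1 - y) <= 2^-1 by apply: alpha_le_half; lra.
  have fu := bowen_up (y := y) (x := x) ltac:(by rewrite kE; lra).
  rewrite fE in fu; case: fu => -> ->.
  have -> : 1 - (y / 4 + 3 / 4) = (1 - y) / 4 by lra.
  have -> : 1 - (2 * x - 1) = 2 * (1 - x) by lra.
  rewrite u2 ifT; last by lra.
  by rewrite ln_div ?posrE; lra.
apply: weight_step_in => //; apply: hv0; last by lra.
apply/andP; split; first by lra.
have lx : lam (x, y) = 2^-1.
  by rewrite /lam/= !mhr; lra.
have d4 : d < 2^-1 by move: d1 etar; nra.
case: lamd => [|h]; first by rewrite lx; lra.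
move: h; rewrite /lam/= !mhl; [|lra|lra] => h.
by nra.
Qed.

End Weights.
End Potential.

(** * From the potential to frequencies of visits *)

Section Averages.
Context {R : realType}.
Implicit Types p : plane R.

(* The number of the first [n] iterates lying outside any given neighbourhood
   of [z] is o(n). *)
Definition mostly_near (T : topologicalType) (f : T -> T) (p z : T) :=
  forall U : set T, nbhs z U -> forall e : R, 0 < e -> exists C : R,
    forall n, \sum_(j < n) (iter j f p \notin U)%:R <= C + e * n%:R.

Lemma mostly_near_limit (T : topologicalType) (f : T -> T) (p z : T) :
  iter n f p @[n --> \oo] --> z -> mostly_near f p z.
Proof.
move=> cz U Uz e e0; have [N _ HN] := cz _ Uz; exists N%:R => n.
have en : 0 <= e * n%:R by rewrite mulr_ge0// ltW.
have h k : \sum_(j < k) (iter j f p \notin U)%:R <= (minn k N)%:R :> R.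
  elim: k => [|k IH]; first by rewrite big_ord0.
  rewrite big_ord_recr/=; have [kN|kN] := ltnP k N.
    rewrite (minn_idPl (ltnW kN)) in IH; rewrite (minn_idPl kN) -natr1.
    by apply: lerD => //; rewrite lern1 leq_b1.
  have -> : iter k f p \in U by apply/mem_set; exact: HN.
  rewrite addr0; apply: le_trans IH _.
  by rewrite ler_nat leq_min geq_minr andbT geq_min leqnSn.
apply: le_trans (h n) _; rewrite -[leLHS]addr0 lerD//.
by rewrite ler_nat geq_minr.
Qed.

(** The steps telescope from N on; the first N indices contribute at most N. *)
Lemma potential_average (h : nat -> R) (o : nat -> bool) (c e : R) (N : nat) :
  0 < c -> (forall n, (N <= n)%N -> 0 <= h n) ->
  (forall n, (N <= n)%N -> h n.+1 + c * (o n)%:R <= h n + e * c) ->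
  0 <= e -> exists C, forall n, \sum_(j < n) (o j)%:R <= C + e * n%:R.
Proof.
move=> c0 h0 hstep e0; exists (N%:R + h N / c) => n.
have triv k : \sum_(j < k) (o j)%:R <= k%:R :> R.
  elim: k => [|k IH]; first by rewrite big_ord0.
  by rewrite big_ord_recr/= -natr1 lerD// lern1 leq_b1.
have hN : 0 <= h N / c by rewrite divr_ge0 ?h0// ltW.
have en k : 0 <= e * k%:R by rewrite mulr_ge0.
have [nN|Nn] := leqP n N.
  apply: le_trans (triv n) _; rewrite -addrA -[leLHS]addr0 lerD ?addr_ge0//.
  by rewrite ler_nat.
rewrite -(subnKC (ltnW Nn)); move: (n - N)%N => k.
suff : \sum_(j < N + k) (o j)%:R + h (N + k)%N / c <= N%:R + h N / c + e * k%:R.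
  have : 0 <= h (N + k)%N / c by rewrite divr_ge0 ?h0 ?leq_addr// ltW.
  have := en N; rewrite natrD mulrDr; lra.
elim: k => [|k IH]; first by rewrite addn0 mulr0 addr0 lerD.
rewrite addnS big_ord_recr/= -natr1 mulrDr mulr1.
have := hstep (N + k)%N (leq_addr _ _).
rewrite -(ler_pM2r (x := c^-1)) ?invr_gt0// mulrDl (mulrC c) mulfK ?gt_eqF//.
rewrite mulrDl mulfK ?gt_eqF//; lra.
Qed.

Lemma lyap_orbit_cvg0 p : square p -> p <> center ->
  lyapX (iter n bowen p) @[n --> \oo] --> (0 : R).
Proof.
move=> sp pc; have [l [Ll _ lq]] := lyap_orbit_cvg sp pc.
suff -> : 0 = l by [].
have [q cq] := omega_nonempty sp.
have [<- _] := lq _ cq; apply/eqP; rewrite eq_le; apply/andP; split; last first.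
  rewrite leNgt; apply/negP => lt0.
  have := omega_boundary sp pc cq; rewrite -square_boundary closure_square.
  by move=> [cqq]; apply; exact: lyapX_gt0.
have [-> _] := lq _ cq.
rewrite -(cvg_lim _ Ll)//; apply: limr_ge; first exact: cvgP Ll.
exists 0%N => // n _; have sn : square (iter n bowen p).
  by apply: square_iter => // r; exact: bowen_square.
by rewrite lyapXE// ltW// lyap_gt0.
Qed.

Lemma mostly_near_saddle p : square p -> p <> center ->
  mostly_near bowen p ((1, 1) : plane R).
Proof.
move=> sp pc U U1 e e0.
have [r [r0 r8 rU]] : exists r, [/\ 0 < r, r <= 8^-1 &
    forall q : plane R, square q -> (1 - q.1 < r) && (1 - q.2 < r) -> U q].
  have [A [A1 A2] AU] := U1.
  have /nbhs_ballP[a a0 aA] := A1; have /nbhs_ballP[b b0 bA] := A2.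
  exists (Num.min 8^-1 (Num.min a b)); split.
  - by rewrite !lt_min a0 b0 invr_gt0 ltr0n.
  - by rewrite ge_min lexx.
  - move=> [x y] [/= /andP[x0 x1] /andP[y0 y1]]; rewrite !lt_min.
    move=> /andP[/and3P[_ xa _] /and3P[_ _ yb]]; apply: AU; split => /=.
      by apply: aA; rewrite /ball/= ger0_norm; lra.
    by apply: bA; rewrite /ball/= ger0_norm; lra.
have l2 : 0 < ln 2 :> R := ln2_gt0.
have l4 : ln 4 = 2 * ln 2 :> R.
  by rewrite (_ : 4 = 2 * 2) ?lnM ?posrE//; lra.
(* The potential may grow by (e/2) ln 4 = e ln 2 per step, which is e in units of ln 2. *)
have e2 : 0 < e / 2 by rewrite divr_gt0.
have [d d0 step] := pot_step r0 r8 e2.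
pose u n := iter n bowen p.
have us n : square (u n) by apply: square_iter => // q; exact: bowen_square.
have Ld : \forall n \near \oo, lyapX (u n) < d.
  have /cvgrPdist_lt/(_ _ d0) := lyap_orbit_cvg0 sp pc.
  by apply: filterS => n; rewrite sub0r normrN; apply: le_lt_trans; exact: ler_norm.
have [N _ HN] := Ld.
have pot0 n : 0 <= pot r (e / 2) (u n).
  have [/andP[x0 x1] /andP[y0 y1]] := us n.
  by apply: weight_ge0 => //; apply/andP; split; lra.
have [|C HC] := @potential_average (fun n => pot r (e / 2) (u n))
    (fun n => u n \notin U) (ln 2) e N l2 (fun n _ => pot0 n) _ (ltW e0).
  move=> n Nn; have small : lam (u n) < d \/ lam (flip (u n)) < d.
    have := HN _ Nn; rewrite /= lyapXE// /lyap gt_min => /orP[h|h]; first by left.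
    right; apply: le_lt_trans h; apply: psi_ge; apply: lam_le_half.
    exact: square_flip.
  have := step (u n) (us n) small.
  have -> : e / 2 * ln 4 = e * ln 2 by rewrite l4; field.
  apply: le_trans.
  rewrite lerD2l; case: ifP => h; last by rewrite ler_piMr ?lern1 ?leq_b1// ltW.
  by rewrite (mem_set (rU _ (us n) h)) mulr0.
by exists C.
Qed.

End Averages.
Arguments mostly_near R {T}.

(** * Weak* limits of empirical measures *)

Section WeakStarLimits.
Context {R : realType} (M : ptopologicalType).
Implicit Types (f : M -> M) (x z : M) (mu nu : probability (borel M) R).

Lemma continuous_measurable (phi : M -> R) : continuous phi ->
  measurable_fun setT (phi : borel M -> R).
Proof.
move=> pc; apply: (measurability _ (RGenOInfty.measurableE R)) => _ [_ [a ->] <-].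
rewrite setTI; apply: sub_sigma_algebra; apply: open_comp => [y _|]; first exact: pc.
exact: interval_open.
Qed.

Lemma empirical_integral_ge0 f x n (g : M -> R) : (forall y, 0 <= g y) ->
  measurable_fun setT (g : borel M -> R) ->
  (\int[@empirical R M f x n]_(y in [set: borel M]) (g y)%:E)%E =
  (n.+1%:R^-1 * \sum_(j < n.+1) g (iter j f x))%:E.
Proof.
move=> g0 mg; have mg' : measurable_fun [set: borel M] (EFin \o g).
  exact/measurable_EFinP.
rewrite /empirical ge0_integral_mscale//; last by move=> y _; rewrite lee_fin.
rewrite ge0_integral_measure_sum//; last by move=> y _; rewrite lee_fin.
rewrite EFinM -sumEFin; congr (_ * _)%E; apply: eq_bigr => j _.
by rewrite integral_dirac// diracT mul1e.
Qed.

Lemma test_integral_empirical f x n (phi : test_function M) :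
  test_integral (empirical f x n) phi =
  n.+1%:R^-1 * \sum_(j < n.+1) sval phi (iter j f x) :> R.
Proof.
have [pc _] := svalP phi; have mp := continuous_measurable pc.
rewrite /test_integral /Rintegral/= integralE.
have -> : (\int[empirical f x n]_y ((fun y : borel M => (sval phi y)%:E)^\+ y) =
    \int[empirical f x n]_(y in [set: borel M]) (Num.max (sval phi y) 0)%:E)%E.
  by apply: eq_integral => y _; rewrite funeposE EFin_max.
have -> : (\int[empirical f x n]_y ((fun y : borel M => (sval phi y)%:E)^\- y) =
    \int[empirical f x n]_(y in [set: borel M]) (Num.max (- sval phi y) 0)%:E)%E.
  by apply: eq_integral => y _; rewrite funenegE EFin_max EFinN.
rewrite !empirical_integral_ge0.
- rewrite -EFinB/= -mulrBr -sumrB; congr (_ * _); apply: eq_bigr => j _.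
  set a := sval phi _.
  by have [h1|h1] := leP a 0; have [h2|h2] := leP (- a) 0; lra.
- by move=> y; rewrite le_max lexx orbT.
- by apply: measurable_maxr => //; exact: measurableT_comp.
- by move=> y; rewrite le_max lexx orbT.
- exact: measurable_maxr.
Qed.

Lemma test_integral_dirac z (phi : test_function M) :
  test_integral (\d_(z : borel M) : probability (borel M) R) phi = sval phi z.
Proof.
have [pc _] := svalP phi; rewrite /test_integral /Rintegral/=.
rewrite integral_dirac//; first by rewrite diracT mul1e.
by apply/measurable_EFinP; exact: continuous_measurable.
Qed.

Lemma weak_star_cvg (u : nat -> probability (borel M) R) mu :
  (forall phi, test_integral (u n) phi @[n --> \oo] --> test_integral mu phi) ->
  (u n : weak_star M) @[n --> \oo] --> (mu : weak_star M).
Proof.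
move=> H A [B [[C oC <-] Cmu] BA].
have cv : {ptws, (test_integral (u n)) @[n --> \oo] --> test_integral mu}.
  apply/cvg_sup => phi D [E [[G oG <-] Gmu] ED].
  have : nbhs (test_integral mu phi) G by exact: open_nbhs_nbhs.
  by move=> /(H phi); apply: (@filterS _ \oo) => n; exact: ED.
have : nbhs (test_integral mu : {ptws test_function M -> R}) C by exact: open_nbhs_nbhs.
by move=> /cv; apply: (@filterS _ \oo) => n; exact: BA.
Qed.

Lemma mostly_near_average f x z (phi : M -> R) (k : R) :
  mostly_near R f x z -> {for z, continuous phi} -> (forall y, `|phi y| <= k) ->
  n.+1%:R^-1 * (\sum_(j < n.+1) phi (iter j f x)) @[n --> \oo] --> phi z.
Proof.
move=> near pc pk; apply/cvgrPdist_lt => e e0.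
have k0 : 0 <= k by apply: le_trans (pk z).
pose U := [set y | `|phi z - phi y| < e / 2].
have Uz : nbhs z U.
  by have /cvgrPdist_lt := pc; apply; rewrite divr_gt0.
(* Then 2 k a <= e/4. Together with e/2 from the points in [U] this leaves e/4 per step, which
   absorbs the constant 2 k C for large n. *)
pose a := e / (8 * (k + 1)).
have a0 : 0 < a by rewrite divr_gt0// mulr_gt0// ltr_wpDl.
have [C HC] := near U Uz a a0.
have C0 : 0 <= C by have := HC 0%N; rewrite big_ord0 mulr0 addr0.
have ka : 2 * k * a <= e / 4.
  rewrite /a mulrA ler_pdivrMr; last by rewrite mulr_gt0// ltr_wpDl.
  by nra.
have kc : 0 <= 2 * k * C / (e / 4) by rewrite divr_ge0 ?mulr_ge0//; lra.
exists (Num.bound (2 * k * C / (e / 4))) => // n /= Nn.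
have nb : 2 * k * C < n.+1%:R * (e / 4).
  rewrite -ltr_pdivrMr; last by lra.
  apply: lt_le_trans (archi_boundP kc) _; rewrite ler_nat.
  exact: leq_trans Nn (leqnSn _).
have n0 : 0 < n.+1%:R :> R by [].
have -> : phi z = n.+1%:R^-1 * \sum_(j < n.+1) phi z.
  by rewrite sumr_const card_ord -(mulr_natl (phi z)) mulrA mulVf ?mul1r// gt_eqF.
rewrite -mulrBr -sumrB normrM ger0_norm ?invr_ge0// mulrC ltr_pdivrMr//.
apply: (@le_lt_trans _ _ (\sum_(j < n.+1) (e / 2 + 2 * k * (iter j f x \notin U)%:R))).
  apply: le_trans (ler_norm_sum _ _ _) _; apply: ler_sum => j _.
  have [jU|jU] := boolP (iter j f x \in U).
    by rewrite mulr0 addr0 ltW//; move: jU => /set_mem.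
  rewrite mulr1; apply: le_trans (ler_normB _ _) _.
  by have := pk z; have := pk (iter j f x); lra.
rewrite big_split/= sumr_const card_ord -mulr_sumr -mulr_natl.
have k2 : 0 <= 2 * k by lra.
have := ler_wpM2l k2 (HC n.+1).
set N := n.+1%:R in n0 nb *; rewrite mulrDr mulrA => h.
have := ler_wpM2r (ltW n0) ka; lra.
Qed.

Lemma mostly_near_weak_star f x z : mostly_near R f x z ->
  (empirical f x n : weak_star M) @[n --> \oo] -->
  ((\d_(z : borel M) : probability (borel M) R) : weak_star M).
Proof.
move=> near; apply: weak_star_cvg => phi; rewrite test_integral_dirac.
under eq_cvg do rewrite test_integral_empirical.
case: phi => phi [/= pc [k pk]]; exact: mostly_near_average near (pc z) pk.
Qed.

Section Distance.
Variable dist : probability (borel M) R -> probability (borel M) R -> R.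
Hypothesis distP : induces_weak_star dist.

(** Limits are determined up to [measure_eq] only, so uniqueness is expressed as distance zero. *)
Lemma weak_star_limit_unique (u : nat -> weak_star M) (mu nu : weak_star M) :
  u n @[n --> \oo] --> mu -> u n @[n --> \oo] --> nu -> dist mu nu = 0.
Proof.
move=> umu unu; apply/eqP; rewrite eq_le dist_ge0// andbT leNgt.
apply/negP => d0; have d2 : 0 < dist mu nu / 2 by rewrite divr_gt0.
have Amu : nbhs mu ([set xi | dist mu xi < dist mu nu / 2] : set (weak_star M)).
  by apply/(dist_nbhs distP); exists (dist mu nu / 2).
have Anu : nbhs nu ([set xi | dist nu xi < dist mu nu / 2] : set (weak_star M)).
  by apply/(dist_nbhs distP); exists (dist mu nu / 2).
have [n [/= h1 h2]] := filter_ex (filterI (umu _ Amu) (unu _ Anu)).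
have := dist_triangle distP mu n nu; rewrite (dist_sym distP n nu).
by lra.
Qed.

Lemma dist_eq mu nu xi : dist mu nu = 0 -> dist mu xi = dist nu xi.
Proof.
move=> h; have h' : dist nu mu = 0 by rewrite (dist_sym distP).
have := dist_triangle distP mu nu xi; have := dist_triangle distP nu mu xi; lra.
Qed.

Lemma dist_limit_measures f x z mu : mostly_near R f x z ->
  dist_to_set dist (limit_measures f x) mu = (dist \d_(z : borel M) mu)%:E.
Proof.
move=> near; have cv := mostly_near_weak_star near.
rewrite /dist_to_set -[RHS]ereal_inf1; congr ereal_inf; apply/seteqP.
split => [_ [nu [k kh knu] <-]/=|_ ->].
  congr EFin; apply: dist_eq; apply: (weak_star_limit_unique knu).
  apply: (cvg_comp k (fun n => empirical f x n : weak_star M)) cv.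
  apply/cvgnyPge => N; exists N => // n /= Nn; apply: leq_trans Nn _.
  elim: n => // n IH; exact: leq_ltn_trans IH (kh _ _ (ltnSn n)).
exists (\d_(z : borel M) : probability (borel M) R) => //.
by exists id.
Qed.

End Distance.
End WeakStarLimits.

(** * SRB-like measures *)

Section Conclusion.
Context {R : realType}.
Local Notation M := (@euclidean_plane R).
Local Notation f := (bowen : M -> M).
Local Notation x1 := ((0, 0) : plane R).
Local Notation x2 := ((1, 1) : plane R).
Implicit Types (p : plane R) (A : set (borel M)).

Lemma square_center : square (center : plane R).
Proof. by split; apply/andP; split => /=; lra. Qed.

Lemma bowen_limit_sets p : square p -> p <> center ->
  [/\ omega_limit f p x1, omega_limit f p x2
    & omega_limit (bowen_inv : M -> M) p = [set (center : plane R)]].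
Proof.
move=> sp pc; have [h1 h2] := omega_saddles sp pc.
by split => //; exact: alpha_center.
Qed.

Lemma bowen_is_bowen : bowen_homeomorphism (@plane_volume R) f x1 x2 square.
Proof.
exists bowen_inv, center, W1s, W1u, W2s, W2u; split.
- exact: bowen_homeo_plane.
- exact: bowen_nonsing.
- exact: bowen_fixed_points.
- exact: bowen_local_diffeo.
- exact: bowen_hyperbolic_points.
- exact: bowen_half_branches.
- exact: bowen_heteroclinic.
- exact: bowen_simple_curve.
- exact: square_open.
- exact: square_disc.
- exact: square_boundary.
- exact: square_center.
- exact: bowen_limit_sets.
Qed.

Lemma bowen_closure : closure (square : set M) `<=` f @^-1` (closure square).
Proof.
move=> p cp B Bfp; have [q [sq Bq]] := cp _ (bowen_continuous Bfp).
by exists (bowen q); split => //; exact: bowen_square.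
Qed.

Lemma half_branch_subset (N : riemannianSurface R) (W : set N) x H :
  half_branch W x H -> H `<=` W.
Proof. by move=> [g [_ <- _ -> _]] _ [t _ <-]; exists t. Qed.

Lemma W1s_mostly p : W1s p -> mostly_near R f p x1.
Proof.
have [h _ _ _] := @bowen_half_branches R.
by move=> /(half_branch_subset h); exact: mostly_near_limit.
Qed.

Lemma W2s_mostly p : W2s p -> mostly_near R f p x2.
Proof.
have [_ _ h _] := @bowen_half_branches R.
by move=> /(half_branch_subset h); exact: mostly_near_limit.
Qed.

Lemma center_mostly : mostly_near R f center center.
Proof.
apply: mostly_near_limit; have e n : iter n f center = center.
  by elim: n => //= n ->; exact: bowen_center.
by under eq_cvg do rewrite e; exact: cvg_cst.
Qed.

Lemma closed_borel (A : set M) : closed A -> measurable (A : set (borel M)).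
Proof.
move=> cA; rewrite -(setCK A); apply: measurableC; apply: sub_sigma_algebra.
exact: closed_openC.
Qed.

Lemma cbox_borel a b c d : measurable (cbox a b c d : set (borel M)).
Proof.
apply: closed_borel; apply: compact_closed; first exact: plane_hausdorff.
exact: cbox_compact.
Qed.

Lemma obox_borel a b c d : measurable (obox a b c d : set (borel M)).
Proof. by apply: sub_sigma_algebra; exact: obox_open. Qed.

Lemma point_borel p : measurable ([set p] : set (borel M)).
Proof.
case: p => a b; suff -> : [set (a, b)] = cbox a a b b by exact: cbox_borel.
apply/seteqP; split => [_ ->|[x y] /cboxP[xa yb]].
  by apply/cboxP; rewrite !lexx.
by congr pair; apply/eqP; rewrite eq_le andbC.
Qed.

Lemma W1s_borel : measurable (W1s : set (borel M)).
Proof.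
suff -> : W1s = cbox 0 0 0 1 `|` (cbox 0 1 1 1 `\ x2) :> set (plane R).
  apply: measurableU; first exact: cbox_borel.
  by apply: measurableD; [exact: cbox_borel|exact: point_borel].
apply/seteqP; split => -[x y].
  move=> /W1sP[[-> y01]|[-> /andP[x0 x1]]]; [left|right].
    by apply/cboxP; rewrite lexx.
  split; first by apply/cboxP; rewrite lexx x0 ltW.
  by move=> [x1']; move: x1; rewrite x1' ltxx.
move=> [/cboxP[x0 y0]|[/cboxP[/andP[x0 x1] y1] ne]]; [left|right].
  by split => //; apply/eqP; rewrite eq_le andbC.
have ye : y = 1 by apply/eqP; rewrite eq_le andbC.
split => //=; rewrite x0 lt_neqAle x1 andbT.
by apply/eqP => xe; apply: ne; rewrite xe ye.
Qed.

Lemma W2s_borel : measurable (W2s : set (borel M)).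
Proof.
rewrite /W2s (image_involutive _ flipK); apply: continuous_borel W1s_borel.
exact: flip_continuous.
Qed.

Lemma area_setX (i j : interval R) :
  area ([set` i] `*` [set` j]) =
  (@lebesgue_measure R [set` i] * @lebesgue_measure R [set` j])%E.
Proof. by rewrite /area product_measure1E. Qed.

Lemma segment_volume (a b c d : R) : a = b \/ c = d ->
  plane_volume (cbox a b c d) = 0%E.
Proof.
have z (t : R) : @lebesgue_measure R `[t, t]%classic = 0%E.
  by rewrite set_itv1 lebesgue_measure_set1.
move=> ab; apply: etrans (area_setX `[a, b] `[c, d]) _.
by case: ab => ->; rewrite z ?mul0e ?mule0.
Qed.

Lemma strip_volume : (0 < plane_volume (obox (0 : R) 4^-1 0 1))%E.
Proof.
have h : (0 < area (obox (0 : R) 4^-1 0 1))%E.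
  rewrite area_setX !lebesgue_measure_itv/= !lte_fin invr_gt0 ltr0n ltr01/=.
  by rewrite !oppr0 !adde0 mule1 lte_fin invr_gt0 ltr0n.
exact: h.
Qed.

(** A product set that avoids the centre, so that its area is explicit and all its orbits average to
    the second saddle. *)
Lemma strip_square p : obox 0 4^-1 0 1 p -> square p /\ p <> center.
Proof.
case: p => x y /oboxP[/andP[x0 x1'] y01]; split; last by move=> [h _]; lra.
by split => //=; apply/andP; split => //; lra.
Qed.

Lemma cbox_cases p : closure (square : set M) p ->
  [\/ square p /\ p <> center, p = center, W1s p | W2s p].
Proof.
move=> cp; have [sp|sp] := pselect (square p); last first.
  have : (closure (square : set M) `\` square) p by split.
  by rewrite square_boundary => -[h|h]; [constructor 3|constructor 4].
by have [pc|pc] := pselect (p = center); [constructor 2|constructor 1].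
Qed.

Section SRB.
Variable dist : probability (borel M) R -> probability (borel M) R -> R.
Hypothesis distP : induces_weak_star dist.
Implicit Types mu : probability (borel M) R.
Local Notation delta z := (\d_((z : M) : borel M)).
Local Notation D p mu := (dist_to_set dist (limit_measures f p) mu).

Lemma measurable_const_cond (P : Prop) (B : set (borel M)) : measurable B ->
  measurable (B `&` [set _ | P]).
Proof.
move=> mB; apply: measurableI => //.
have [h|h] := pselect P.
  by rewrite (_ : [set _ | P] = setT) //; apply/seteqP; split.
by rewrite (_ : [set _ | P] = set0) //; apply/seteqP; split.
Qed.

(** Every point of the closed square has one limit measure, the Dirac mass at a saddle or at the
    centre. So the set in the definition of SRB-like measures is a union of fixed Borel pieces, each
    present or absent according to a condition independent of the point. *)
Lemma near_set mu (e : R) :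
  [set p : borel M | closure square p /\ (D p mu < e%:E)%E] =
  (((square `\ center) `|` W2s) `&` [set _ | dist (delta x2) mu < e]) `|`
  (W1s `&` [set _ | dist (delta x1) mu < e]) `|`
  ([set center] `&` [set _ | dist (delta center) mu < e]).
Proof.
have DE p z : mostly_near R f p z -> (D p mu < e%:E)%E = (dist (delta z) mu < e).
  by move=> /(dist_limit_measures distP) ->; rewrite lte_fin.
have bd p : (W1s `|` W2s) p -> closure (square : set M) p.
  by rewrite -square_boundary => -[].
apply/seteqP; split => p /=.
  move=> [cp]; have [[sp pc]|->|w|w] := cbox_cases cp.
  - by rewrite (DE _ _ (mostly_near_saddle sp pc)) => h; left; left; split => //; left.
  - by rewrite (DE _ _ center_mostly) => h; right.
  - by rewrite (DE _ _ (W1s_mostly w)) => h; left; right.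
  - by rewrite (DE _ _ (W2s_mostly w)) => h; left; left; split => //; right.
move=> [[[[[sp pc]|w] h]|[w h]]|[-> h]].
- by split; [exact: subset_closure|rewrite (DE _ _ (mostly_near_saddle sp pc))].
- by split; [apply: bd; right|rewrite (DE _ _ (W2s_mostly w))].
- by split; [apply: bd; left|rewrite (DE _ _ (W1s_mostly w))].
- split; last by rewrite (DE _ _ center_mostly).
  by apply: subset_closure; exact: square_center.
Qed.

Lemma near_set_measurable mu (e : R) : measurable
  [set p : borel M | closure square p /\ (D p mu < e%:E)%E].
Proof.
rewrite near_set; apply: measurableU; last first.
  by apply: measurable_const_cond; exact: point_borel.
apply: measurableU; last first.
  by apply: measurable_const_cond; exact: W1s_borel.
apply: measurable_const_cond; apply: measurableU; last exact: W2s_borel.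
apply: measurableD; last exact: point_borel.
by apply: sub_sigma_algebra; exact: square_open.
Qed.

Lemma bowen_SRB : SRB_like (@plane_volume R) dist f (closure square) =
  [set mu | measure_eq mu (delta x2)].
Proof.
apply/seteqP; split => mu /=.
  move=> srb; apply/(dist_eq0 distP); apply/eqP; rewrite eq_le dist_ge0// andbT.
  (* Taking for e the distance from [mu] to the Dirac mass at (1, 1) discards the piece of positive
     area; what may remain, [W1s] and the centre, is null. *)
  rewrite leNgt; apply/negP => e0; have [mA] := srb _ e0.
  apply/negP; rewrite -leNgt.
  pose B : set (borel M) :=
    cbox 0 0 0 1 `|` cbox 0 1 1 1 `|` cbox 2^-1 2^-1 2^-1 2^-1.
  have B0 : plane_volume B = 0%E.
    rewrite /B measureU0 ?measureU0 ?segment_volume//.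
    all: try by left.
    all: try by right.
    all: try exact: cbox_borel.
    by apply: measurableU; exact: cbox_borel.
  rewrite -B0; apply: le_measure; rewrite ?inE//.
    by apply: measurableU; [apply: measurableU|]; exact: cbox_borel.
  rewrite near_set => p [[[_ /=]|[w _]]|[-> _]].
  - by rewrite (dist_sym distP) ltxx.
  - left; case: p w => x y /W1sP[[-> y01]|[-> /andP[x0 x1]]]; [left|right];
      apply/cboxP; first by rewrite lexx.
    by rewrite lexx x0 ltW.
  - by right; apply/cboxP; rewrite !lexx.
move=> muE e e0 A; split; first exact: near_set_measurable.
apply: lt_le_trans strip_volume _; apply: le_measure; rewrite ?inE.
- exact: obox_borel.
- exact: near_set_measurable.
- rewrite /A near_set => p /strip_square[sp pc]; left; left; split; first by left.
  have h : dist mu (delta x2) = 0 by apply/(dist_eq0 distP).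
  by rewrite /= (dist_sym distP) h.
Qed.

End SRB.
End Conclusion.

Theorem mainTheorem5 (R : realType) :
  exists (M : riemannianSurface R) (m : {measure set (borel M) -> \bar R})
         (f : M -> M) (x1 x2 : M) (V : set M),
    [/\ is_volume m,
        bowen_homeomorphism m f x1 x2 V,
        closure V `<=` f @^-1` (closure V),
        (0 < m (closure V))%E
      & forall dist : probability (borel M) R -> probability (borel M) R -> R,
          induces_weak_star dist ->
          SRB_like m dist f (closure V) =
            [set mu : probability (borel M) R | measure_eq mu (\d_(x2 : borel M))]].
Proof.
exists (@euclidean_plane R), (@plane_volume R), bowen, (0, 0), (1, 1), square.
split.
- exact: plane_volume_is_volume.
- exact: bowen_is_bowen.
- exact: bowen_closure.
- apply: lt_le_trans strip_volume _; apply: le_measure; rewrite ?inE.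
  + exact: obox_borel.
  + by apply: closed_borel; exact: closed_closure.
  + by move=> p /strip_square[sp _]; exact: subset_closure.
- exact: bowen_SRB.
Qed.
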